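(* Let $\nu$ be a probability distribution on $\mathbb{N}=\{0,1,2,\ldots\}$ with $\nu(0)<1$, let $\bar\nu=\sum_{k\ge 0}k\,\nu(k)\in(0,\infty]$ be its (possibly infinite) expectation, let $\rho>0$, and let $(S_n,\mathcal{T}_n)_{n\ge 0}$ be the $(\rho,\nu)$-TBRW. Then: (1) If $\rho<1+2\bar\nu$, the walk $S_n$ is transient, i.e. almost surely each vertex ever created is visited only finitely many times by the walk; in particular, the walk returns only finitely many times to the root almost surely. (2) If $\rho\ge 1+2\bar\nu$, the walk $S_n$ is recurrent, i.e. almost surely every vertex ever created is visited infinitely often by the walk. Furthermore: (2a) if $\rho=1+2\bar\nu$, then all return times to the root have infinite expectation (``null recurrence''): for every $k\ge1$, the $k$-th return time to the root has infinite expectation; (2b) if $\rho>1+2\bar\nu$, then all return times to the root have finite expectation (``positive recurrence''): for every $k\ge1$, the $k$-th return time to the root has finite expectation.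
   Context: Definition of the $(\rho,\nu)$-tree builder random walk (TBRW): it is a random growing sequence of rooted trees $(\mathcal{T}_n)_{n\ge 0}$ together with a walk $S_n\in\mathcal{T}_n$. At time $0$, $\mathcal{T}_0$ is a single vertex $o$ (the root) and $S_0=o$. Inductively, given $\mathcal{T}_n$ and $S_n$: first, independently of everything else, draw $\xi_n$ with law $\nu$ and obtain $\mathcal{T}_{n+1}$ from $\mathcal{T}_n$ by attaching $\xi_n$ new leaves (children) to the vertex $S_n$; second, if $S_n=v$ has father $v^0$ and children $v^1,\ldots,v^k$ in $\mathcal{T}_{n+1}$, then $S_{n+1}=v^0$ with probability $\frac{\rho}{k+\rho}$ and $S_{n+1}=v^i$ with probability $\frac{1}{k+\rho}$ for each $1\le i\le k$. By convention, the father of the root $o$ is $o$ itself (so there is a loop at the root). A vertex is ``created'' if it belongs to $\bigcup_n\mathcal{T}_n$. The $k$-th return time to the root is the $k$-th time $n\ge1$ such that $S_n=o$. *)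

(* Defs.v *)
From mathcomp Require Import all_boot all_order all_algebra finmap.
From mathcomp Require Import all_classical all_reals all_analysis.

Set Implicit Arguments.
Unset Strict Implicit.
Unset Printing Implicit Defensive.
Import Order.TTheory GRing.Theory Num.Theory.
Local Open Scope classical_set_scope.
Local Open Scope ring_scope.

(* Ulam-Harris labelling: the children of [v] are [rcons v 0], [rcons v 1],
   and so on, in order of creation. *)
Definition vertex := seq nat.
Definition tree := {fset vertex}.

Definition tree_root : vertex := [::].

(* By convention the root is its own father: this is the loop at the root. *)
Definition father (v : vertex) : vertex := take (size v).-1 v.

(* The root must be excluded, as it is its own father without being its own
   child. *)
Definition children (t : tree) (v : vertex) : tree :=
  [fset u in t | (u != tree_root) && (father u == v)]%fset.

Definition attach (t : tree) (v : vertex) (m : nat) : tree :=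
  (t `|` [fset rcons v (#|` children t v| + i)%N | i in iota 0 m])%fset.

Definition step_prob (R : realType) (rho : R) (t : tree) (v u : vertex) : R :=
  if u == father v then rho / (#|` children t v|%:R + rho)
  else if u \in children t v then 1 / (#|` children t v|%:R + rho)
  else 0.

Definition past (Omega : Type) (T : nat -> Omega -> tree)
    (S : nat -> Omega -> vertex) (n : nat) (t : nat -> tree) (s : nat -> vertex)
    : set Omega :=
  [set w | forall i, (i <= n)%N -> T i w = t i /\ S i w = s i].

(* The trees and vertices form countable sets, so that measurability and laws
   are determined by the events [T n = t] and [S n = v]. Conditional
   probabilities given the past are written in product form, which is
   vacuous for pasts of probability 0. The variables [xi i], i < n, are
   functions of the past up to time n, since [T i.+1] has exactly [xi i] more
   vertices than [T i]. *)
Record is_TBRW d (Omega : measurableType d) (R : realType)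
    (P : probability Omega R) (rho : R) (nu : probability nat R)
    (xi : nat -> Omega -> nat) (T : nat -> Omega -> tree)
    (S : nat -> Omega -> vertex) : Prop := IsTBRW {
  measurable_xi : forall n m, measurable (xi n @^-1` [set m]) ;
  measurable_T : forall n t, measurable (T n @^-1` [set t]) ;
  measurable_S : forall n v, measurable (S n @^-1` [set v]) ;
  T_init : forall w, T 0%N w = [fset tree_root]%fset ;
  S_init : forall w, S 0%N w = tree_root ;
  T_next : forall n w, T n.+1 w = attach (T n w) (S n w) (xi n w) ;
  xi_law : forall n t s m,
    P (past T S n t s `&` xi n @^-1` [set m]) =
    (P (past T S n t s) * nu [set m])%E ;
  S_law : forall n t s m v,
    P (past T S n t s `&` xi n @^-1` [set m] `&` S n.+1 @^-1` [set v]) =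
    (P (past T S n t s `&` xi n @^-1` [set m]) *
     (step_prob rho (attach (t n) (s n) m) (s n) v)%:E)%E }.

Definition mean (R : realType) (nu : probability nat R) : \bar R :=
  (\sum_(0 <= k <oo) k%:R%:E * nu [set k])%E.

Definition visits (Omega : Type) (S : nat -> Omega -> vertex) (v : vertex)
    (w : Omega) : set nat := [set n | S n w = v].

Definition created (Omega : Type) (T : nat -> Omega -> tree) (w : Omega)
    : set vertex := [set v | exists n, v \in T n w].

Definition transient d (Omega : measurableType d) (R : realType)
    (P : probability Omega R) (T : nat -> Omega -> tree)
    (S : nat -> Omega -> vertex) : Prop :=
  {ae P, forall w, forall v, created T w v -> finite_set (visits S v w)}.

Definition recurrent d (Omega : measurableType d) (R : realType)
    (P : probability Omega R) (T : nat -> Omega -> tree)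
    (S : nat -> Omega -> vertex) : Prop :=
  {ae P, forall w, forall v, created T w v -> infinite_set (visits S v w)}.

Definition is_return_time (Omega : Type) (S : nat -> Omega -> vertex)
    (k : nat) (w : Omega) (n : nat) : Prop :=
  [/\ (1 <= n)%N, S n w = tree_root &
      count (fun j => S j w == tree_root) (iota 1 n) = k].

(* For k >= 1 at most one n satisfies [is_return_time S k w n]; the infimum is
   +oo if there are fewer than k returns. *)
Definition return_time (R : realType) (Omega : Type)
    (S : nat -> Omega -> vertex) (k : nat) (w : Omega) : \bar R :=
  ereal_inf [set n%:R%:E | n in is_return_time S k w].

(* Main.v *)
Require Import Defs.
From mathcomp Require Import all_boot all_order all_algebra finmap.
From mathcomp Require Import ring lra zify.
From mathcomp Require Import all_classical all_reals all_analysis.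
From mathcomp Require Import measurable_realfun.
Set Implicit Arguments.
Unset Strict Implicit.
Unset Printing Implicit Defensive.
Import Order.TTheory GRing.Theory Num.Theory.
Local Open Scope classical_set_scope.
Local Open Scope ring_scope.

(** The tree enters the dynamics only through the numbers of children of its
    vertices, so the walk is a Markov chain on the pairs of such counts and a
    vertex. Its critical value is read off from a potential. Give a vertex with
    [k] children the weight [k + rho]; let the energy of a subtree be the sum of
    its weights, discounted by [rho^-1] per generation; and let the potential of a
    state be the sum of the energies of the subtrees of the current vertex and of
    its ancestors. The discount is such that a jump lowers the potential by
    exactly [rho] on average ([potential_jump]), whereas the birth of [m] children
    at depth [j] raises it by [2 * m * geo j], where [geo j] is the sum of
    [rho^-l] over [l <= j] ([potential_grow]). Away from the root the drift is
    thus [2 * mean * geo j - rho], which equals [- rho^-j] if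
    [rho = 1 + 2 * mean], stays below a negative constant if [rho] is larger, and
    becomes positive at large depths if [rho] is smaller.

    Recurrence. The potential is at least the depth, up to a constant factor. When
    it has a negative drift, the walk has to leave every bounded range of depths
    while the potential stays bounded on average, so it reaches the root
    ([root_hit]). That every child of a vertex visited infinitely often is visited
    as well follows from the logarithm of the number of children, the probability
    of choosing a given one of [k] children being of order [1 / k] ([child_hit]).

    Return times. The mean of the time of the [k]-th return is the sum over [n] of
    the probabilities of fewer than [k] returns up to [n]. Above the critical
    value the drift of the potential is bounded away from 0, and the sum is finite
    ([positive_recurrence]). At the critical value there is a bounded variant of
    the potential, with weights [A j] that decrease with the depth and a slow
    cut-off in the number of children, that loses at most 1 per step and still
    starts from any prescribed height; hence the first excursion alone has a mean
    duration larger than any number ([null_recurrence]).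

    Transience. Below the critical value the weights of the bounded variant can be
    chosen such that it does not decrease on average and starts above 1, when the
    walk is sent back at some depth [d] and rewarded by 1 for each fresh passage
    there. So either this truncated walk may fail to exit, or it makes more than
    one fresh passage on average before its exit; as the excursions from fresh
    vertices in the full walk repeat those from the root, the fresh passages then
    form a supercritical branching process. In both cases the walk leaves a fresh
    subtree with probability at most some [s < 1] ([escape]). Arrivals at fresh
    vertices occur again and again, and from each of them the return to a given
    vertex costs another factor [s]; so infinitely many visits have probability 0
    ([finitely_many_visits]). *)

(** * Child counts and one step of the walk *)

(** In the Ulam-Harris labelling a tree is determined by the numbers of children
    of its vertices; the pair of these counts and of the position is the state of
    the walk. *)
Definition counts := vertex -> nat.

Definition grow (c : counts) (v : vertex) (m : nat) : counts :=
  fun u => if u == v then (c u + m)%N else c u.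

Lemma grow_same c v m : grow c v m v = (c v + m)%N.
Proof. by rewrite /grow eqxx. Qed.

Lemma grow_other c v m u : u != v -> grow c v m u = c u.
Proof. by rewrite /grow => /negbTE ->. Qed.

Arguments father : simpl never.

Lemma father_rcons v i : father (rcons v i) = v.
Proof. by rewrite /father size_rcons -cats1 take_size_cat. Qed.

Lemma father_cons i w : father (i :: w) = if w is [::] then [::] else i :: father w.
Proof. by case: w. Qed.

Lemma rcons_neq_nil (v : vertex) i : rcons v i != [::].
Proof. by case: v. Qed.

Section Step.
Variables (R : realType) (nu : probability nat R).

(** The expectation of a function of the number of children created in a step. *)
Definition Ex (f : nat -> \bar R) : \bar R :=
  (\sum_(0 <= m <oo) nu [set m] * f m)%E.

Lemma Ex_ge0 f : (forall m, 0 <= f m)%E -> (0 <= Ex f)%E.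
Proof. by move=> f0; apply: nneseries_ge0 => m _ _; apply: mule_ge0. Qed.

Lemma Ex_le f g : (forall m, 0 <= f m)%E -> (forall m, f m <= g m)%E ->
  (Ex f <= Ex g)%E.
Proof.
move=> f0 fg; apply: lee_nneseries => [m _ _|m _]; first exact: mule_ge0.
exact: lee_wpmul2l.
Qed.

Lemma eq_Ex f g : f =1 g -> Ex f = Ex g.
Proof. by move=> fg; apply: eq_eseriesr => m _; rewrite fg. Qed.

Lemma ExD f g : (forall m, 0 <= f m)%E -> (forall m, 0 <= g m)%E ->
  (Ex (fun m => f m + g m) = Ex f + Ex g)%E.
Proof.
move=> f0 g0; rewrite /Ex -nneseriesD; last 2 first.
- by move=> m _ _; apply: mule_ge0.
- by move=> m _ _; apply: mule_ge0.
by apply: eq_eseriesr => m _; rewrite ge0_muleDr.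
Qed.

Lemma ExZ (x : R) f : (forall m, 0 <= f m)%E ->
  (Ex (fun m => x%:E * f m) = x%:E * Ex f)%E.
Proof.
move=> f0; rewrite /Ex -nneseriesZl; last by move=> m _; apply: mule_ge0.
by apply: eq_eseriesr => m _; rewrite muleCA.
Qed.

Lemma Ex1 : Ex (fun=> 1%E) = 1%E.
Proof.
rewrite -[RHS](@probability_setT _ _ _ nu).
have -> : [set: nat] = \bigcup_m [set m] by apply/seteqP; split => // m _; exists m.
rewrite measure_bigcup//=; last first.
  by apply/trivIsetP => i j _ _ ij; apply/seteqP; split => // k [/= -> /= /eqP]; rewrite (negbTE ij).
rewrite /Ex [RHS](eq_eseriesl (Q := xpredT)); last by move=> m; rewrite in_setT.
by apply: eq_eseriesr => m _; rewrite mule1.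
Qed.

Lemma Ex_cst (x : R) : Ex (fun=> x%:E) = x%:E.
Proof.
by rewrite -[RHS]mule1 -Ex1 -ExZ//; apply: eq_Ex => m; rewrite mule1.
Qed.

Lemma Ex_mean : Ex (fun m => m%:R%:E) = mean nu.
Proof. by apply: eq_eseriesr => m _; rewrite muleC. Qed.

Lemma Ex_le1 f : (forall m, 0 <= f m)%E -> (forall m, f m <= 1)%E -> (Ex f <= 1)%E.
Proof. by move=> f0 f1; rewrite -Ex1; apply: Ex_le. Qed.

Variable (rho : R).

(** One step from the state [(c, v)]: children are born at [v], then the walk
    moves to the father of [v], where it collects [U], or to the child of index
    [i], where it collects [D _ i]. Leaving [U] free makes the same operator serve
    for the loop at the root, for the exit from a subtree and for a killed walk. *)
Definition Kop (c : counts) (v : vertex) (U : counts -> \bar R)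
    (D : counts -> nat -> \bar R) : \bar R :=
  Ex (fun m => let c' := grow c v m in
    (((c' v)%:R + rho)^-1)%:E * (rho%:E * U c' + \sum_(i < c' v) D c' i))%E.

Hypothesis rho0 : 0 < rho.

Lemma Kden_gt0 (k : nat) : 0 < k%:R + rho.
Proof. by apply: ltr_wpDl. Qed.

Lemma Kinv_ge0 (k : nat) : (0 <= ((k%:R + rho)^-1)%:E)%E.
Proof. by rewrite lee_fin invr_ge0 ltW// Kden_gt0. Qed.

Lemma rhoE_ge0 : (0 <= rho%:E)%E. Proof. by rewrite lee_fin ltW. Qed.

Lemma Kterm_ge0 (k : nat) (u : \bar R) (d : nat -> \bar R) :
  (0 <= u)%E -> (forall i, 0 <= d i)%E ->
  (0 <= ((k%:R + rho)^-1)%:E * (rho%:E * u + \sum_(i < k) d i))%E.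
Proof.
move=> u0 d0; apply: mule_ge0; first exact: Kinv_ge0.
by apply: adde_ge0; [apply: mule_ge0 => //; exact: rhoE_ge0|apply: sume_ge0].
Qed.

Lemma Kop_ge0 c v U D : (forall c, 0 <= U c)%E -> (forall c i, 0 <= D c i)%E ->
  (0 <= Kop c v U D)%E.
Proof. by move=> U0 D0; apply: Ex_ge0 => m; apply: Kterm_ge0. Qed.

(** Two states may be compared that have the same number of children at the
    current vertex, such as a state and its restriction to a subtree. *)
Lemma Kop_le c1 v1 c2 v2 U1 U2 D1 D2 : c1 v1 = c2 v2 ->
  (forall c, 0 <= U1 c)%E -> (forall c i, 0 <= D1 c i)%E ->
  (forall m, U1 (grow c1 v1 m) <= U2 (grow c2 v2 m))%E ->
  (forall m i, (i < c1 v1 + m)%N -> D1 (grow c1 v1 m) i <= D2 (grow c2 v2 m) i)%E ->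
  (Kop c1 v1 U1 D1 <= Kop c2 v2 U2 D2)%E.
Proof.
move=> cv U0 D0 UU DD; apply: Ex_le => m /=; first exact: Kterm_ge0.
rewrite !grow_same -cv; apply: lee_wpmul2l; first exact: Kinv_ge0.
apply: leeD; first by apply: lee_wpmul2l => //; exact: rhoE_ge0.
by apply: lee_sum => i _; apply: DD.
Qed.

Lemma KopD c v U1 D1 U2 D2 :
  (forall c, 0 <= U1 c)%E -> (forall c i, 0 <= D1 c i)%E ->
  (forall c, 0 <= U2 c)%E -> (forall c i, 0 <= D2 c i)%E ->
  (Kop c v (fun c => U1 c + U2 c) (fun c i => D1 c i + D2 c i)
   = Kop c v U1 D1 + Kop c v U2 D2)%E.
Proof.
move=> U10 D10 U20 D20; rewrite /Kop -ExD; last 2 first.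
- by move=> m; apply: Kterm_ge0.
- by move=> m; apply: Kterm_ge0.
apply: eq_Ex => m /=; rewrite big_split/= (ge0_muleDr rho%:E)//.
rewrite -[RHS]ge0_muleDr; last 2 first.
- by apply: adde_ge0; [apply: mule_ge0 => //; exact: rhoE_ge0|apply: sume_ge0].
- by apply: adde_ge0; [apply: mule_ge0 => //; exact: rhoE_ge0|apply: sume_ge0].
by rewrite addeACA.
Qed.

Lemma KopZ c v (x : R) U D : 0 <= x ->
  (forall c, 0 <= U c)%E -> (forall c i, 0 <= D c i)%E ->
  (Kop c v (fun c => x%:E * U c) (fun c i => x%:E * D c i)
   = x%:E * Kop c v U D)%E.
Proof.
move=> x0 U0 D0; rewrite /Kop -ExZ; last by move=> m; apply: Kterm_ge0.
apply: eq_Ex => m /=; rewrite -ge0_sume_distrr// muleCA.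
rewrite -(ge0_muleDr x%:E)//; first by rewrite muleCA.
- by apply: mule_ge0 => //; exact: rhoE_ge0.
- by apply: sume_ge0.
Qed.

Lemma KopE c v (U : counts -> R) (D : counts -> nat -> R) :
  Kop c v (fun c => (U c)%:E) (fun c i => (D c i)%:E) =
  Ex (fun m => let c' := grow c v m in
    ((rho * U c' + \sum_(i < c' v) D c' i) / ((c' v)%:R + rho))%:E).
Proof.
by apply: eq_Ex => m /=; rewrite sumEFin -EFinM mulrC.
Qed.

Lemma Kop_cst c v (x : R) : Kop c v (fun=> x%:E) (fun _ _ => x%:E) = x%:E.
Proof.
rewrite (KopE _ _ (fun=> x) (fun _ _ => x)) -[RHS]Ex_cst; apply: eq_Ex => m /=.
rewrite sumr_const card_ord -[x *+ _]mulr_natl -mulrDl addrC mulrAC mulfV ?mul1r//.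
by rewrite gt_eqF// Kden_gt0.
Qed.

End Step.

(** * Escaping from a fresh subtree *)

Definition below (u : vertex) (c : counts) : counts := fun z => c (u ++ z).

Definition no_counts : counts := fun=> 0%N.

Lemma below_grow u c w m : below u (grow c (u ++ w) m) = grow (below u c) w m.
Proof.
apply/funext => z; rewrite /below /grow.
by rewrite eqseq_cat// eqxx.
Qed.

Lemma father_cat (u : vertex) j w : father (u ++ j :: w) = u ++ father (j :: w).
Proof.
have -> : j :: w = rcons (belast j w) (last j w) by rewrite -lastI.
by rewrite -rcons_cat !father_rcons.
Qed.

Lemma size_father (v : vertex) : size (father v) = (size v).-1.
Proof. by rewrite /father size_takel// leq_pred. Qed.

Fixpoint intree (c : counts) (v : vertex) : bool :=
  if v is i :: w then (i < c [::])%N && intree (below [:: i] c) w else true.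

Lemma intree_rcons c v i : intree c (rcons v i) = intree c v && (i < c v)%N.
Proof.
elim: v c => [|j v IH] c /=; first by rewrite andbT.
by rewrite IH andbA.
Qed.

Lemma intree_father c v : intree c v -> intree c (father v).
Proof.
case/lastP: v => [|v i]; first by [].
by rewrite father_rcons intree_rcons => /andP[].
Qed.

Lemma intree_le (c c' : counts) v :
  (forall u, c u <= c' u)%N -> intree c v -> intree c' v.
Proof.
elim: v c c' => [|j v IH] c c' //= cc /andP[jc cv].
rewrite (leq_trans jc (cc _)) /=; apply: IH cv => u; exact: cc.
Qed.

Lemma grow_ge c v m u : (c u <= grow c v m u)%N.
Proof. by rewrite /grow; case: ifP => // _; rewrite leq_addr. Qed.

(** What holds of the states that the walk can reach: the children of a vertex
    are numbered without gaps, nothing grows on labels that are not yet in use,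
    and the current vertex has been created. *)
Definition good (c : counts) (v : vertex) : Prop :=
  (forall u i, (c u <= i)%N -> c (rcons u i) = 0%N) /\ intree c v.

Lemma good_below c i w : good c (i :: w) -> good (below [:: i] c) w.
Proof.
case=> wf /= /andP[_ iw]; split => // u j; rewrite /below /= -rcons_cons.
exact: wf.
Qed.

Lemma good_grow c v m : good c v -> good (grow c v m) v.
Proof.
case=> wf cv; split; last by apply: intree_le cv => u; exact: grow_ge.
move=> u i ui; rewrite grow_other.
  by apply: wf; apply: leq_trans ui; exact: grow_ge.
apply: contraTneq cv => <-; rewrite intree_rcons negb_and -leqNgt.
by rewrite (leq_trans _ ui) ?grow_ge// orbT.
Qed.

Lemma good_father c v : good c v -> good c (father v).
Proof. by case=> wf cv; split => //; exact: intree_father. Qed.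

Lemma good_rcons c v i : good c v -> (i < c v)%N -> good c (rcons v i).
Proof. by case=> wf cv iv; split => //; rewrite intree_rcons cv. Qed.

Section Escape.
Variables (R : realType) (nu : probability nat R) (rho : R).
Hypothesis rho0 : 0 < rho.

(** The probability of leaving the tree through its root within [n] steps: the
    father step at the root is an exit here and not a loop, as is the case in the
    subtree of a vertex other than the root of the whole tree. *)
Fixpoint exit_prob (n : nat) (c : counts) (v : vertex) : \bar R :=
  if n is n'.+1 then
    Kop nu rho c v
      (fun c' => if v is [::] then 1%E else exit_prob n' c' (father v))
      (fun c' i => exit_prob n' c' (rcons v i))
  else 0%E.

Arguments exit_prob : simpl never.

Lemma exit_prob0 c v : exit_prob 0 c v = 0%E.
Proof. by []. Qed.

Lemma exit_prob_rec n c v : exit_prob n.+1 c v = Kop nu rho c v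
  (fun c' => if v is [::] then 1%E else exit_prob n c' (father v))
  (fun c' i => exit_prob n c' (rcons v i)).
Proof. by []. Qed.

Lemma exit_prob_ge0 n c v : (0 <= exit_prob n c v)%E.
Proof.
elim: n c v => [|n IH] c v; rewrite ?exit_prob_rec//; apply: Kop_ge0 => // c'.
by case: v => // *; exact: IH.
Qed.

Lemma exit_prob_le1 n c v : (exit_prob n c v <= 1)%E.
Proof.
elim: n c v => [|n IH] c v; first by rewrite exit_prob0 lee01.
rewrite exit_prob_rec -[leRHS](Kop_cst nu rho0 c v); apply: Kop_le => //.
- by move=> c'; case: v => // *; exact: exit_prob_ge0.
- by move=> c' i; exact: exit_prob_ge0.
- by move=> m; case: v => // *; exact: IH.
Qed.

Lemma exit_probS n c v : (exit_prob n c v <= exit_prob n.+1 c v)%E.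
Proof.
elim: n c v => [|n IH] c v; first exact: exit_prob_ge0.
rewrite !exit_prob_rec; apply: Kop_le => //.
- by move=> c'; case: v => // *; exact: exit_prob_ge0.
- by move=> c' i; exact: exit_prob_ge0.
- by move=> m; case: v => // *; exact: IH.
Qed.

(** To leave the tree, the walk must first leave the subtree of [u], and what it
    finds outside that subtree is untouched until then. *)
Lemma exit_prob_below n c u w (M : R) : 0 <= M -> u != [::] ->
  (forall c2, (forall z, ~~ prefix u z -> c2 z = c z) ->
     exit_prob n c2 (father u) <= M%:E)%E ->
  (exit_prob n c (u ++ w) <= M%:E * exit_prob n (below u c) w)%E.
Proof.
move=> M0 u0; elim: n c w => [|n IH] c w HM; first by rewrite !exit_prob0 mule0.
have HM' m c2 : (forall z, ~~ prefix u z -> c2 z = grow c (u ++ w) m z) ->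
    (exit_prob n c2 (father u) <= M%:E)%E.
  move=> c2E; apply: le_trans (exit_probS _ _ _) _; apply: HM => z uz.
  rewrite c2E// /grow; case: eqP => // zE.
  by move: uz; rewrite zE prefix_prefix.
rewrite !exit_prob_rec -KopZ//; last 2 first.
- by move=> c'; case: w {HM'} => // *; exact: exit_prob_ge0.
- by move=> c' i; exact: exit_prob_ge0.
apply: Kop_le => //=.
- by move=> c'; case: (u ++ w) => // *; exact: exit_prob_ge0.
- by move=> c' i; exact: exit_prob_ge0.
- move=> m; case: w HM' => [|j w] HM'.
    rewrite mule1 cats0; case: u u0 {IH HM} HM' => // a u _ HM'; apply: HM'.
    by rewrite cats0.
  case E : (u ++ j :: w) => [|a q]; first by case: (u) E.
  rewrite -E father_cat; apply: le_trans (IH _ _ _) _; first exact: HM'.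
  by rewrite below_grow.
- move=> m i _; rewrite rcons_cat; apply: le_trans (IH _ _ _) _; first exact: HM'.
  by rewrite below_grow.
Qed.

Section Truncated.
Variable d : nat.

(** The walk truncated at depth [d] is sent back to the father as soon as it
    enters a vertex of depth [d]; the count of this vertex is set to 1, so that
    its first passage, and only this one, is recognised as fresh. The functional
    pays [e] for an exit, [b] if there is none within [n] steps, and transforms by
    [x |-> r + s * x] at a fresh passage. Thus [trunc 1 s 0 0] is the generating
    function at [s] of the number of fresh passages, on the event of an exit,
    [trunc 0 1 1 0] the probability of no exit, and [trunc 0 1 0 1] the mean
    number of fresh passages. *)
Fixpoint trunc (e s b r : R) (n : nat) (c : counts) (v : vertex) : \bar R :=
  if n is n'.+1 then
    Kop nu rho c v
      (fun c' => if v is [::] then e%:E else trunc e s b r n' c' (father v))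
      (fun c' i => let u := rcons v i in
         if (size u < d)%N then trunc e s b r n' c' u
         else if c' u == 0%N then r%:E + s%:E * trunc e s b r n' (grow c' u 1) v
         else trunc e s b r n' c' v)%E
  else b%:E.

Arguments trunc : simpl never.

Lemma trunc_rec e s b r n c v : trunc e s b r n.+1 c v = Kop nu rho c v
  (fun c' => if v is [::] then e%:E else trunc e s b r n c' (father v))
  (fun c' i => let u := rcons v i in
     if (size u < d)%N then trunc e s b r n c' u
     else if c' u == 0%N then r%:E + s%:E * trunc e s b r n (grow c' u 1) v
     else trunc e s b r n c' v)%E.
Proof. by []. Qed.

Lemma trunc_ge0 e s b r n c v : 0 <= e -> 0 <= s -> 0 <= b -> 0 <= r ->
  (0 <= trunc e s b r n c v)%E.
Proof.
move=> e0 s0 b0 r0; elim: n c v => [|n IH] c v; first by rewrite /trunc lee_fin.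
rewrite trunc_rec; apply: Kop_ge0 => // c'.
  by case: v => [|? ?]; [rewrite lee_fin|exact: IH].
move=> i /=; case: ifP => // _; case: ifP => // _.
by apply: adde_ge0; [rewrite lee_fin|apply: mule_ge0; rewrite ?lee_fin].
Qed.

Lemma trunc_le1 s b n c v : 0 <= s <= 1 -> 0 <= b <= 1 ->
  (trunc 1 s b 0 n c v <= 1)%E.
Proof.
move=> /andP[s0 s1] /andP[b0 b1].
elim: n c v => [|n IH] c v; first by rewrite /trunc lee_fin.
have T0 c' v' : (0 <= trunc 1 s b 0 n c' v')%E by apply: trunc_ge0.
rewrite trunc_rec -[leRHS](Kop_cst nu rho0 c v); apply: Kop_le => //=.
- by move=> c'; case: v.
- move=> c' i; case: ifP => // _; case: ifP => // _.
  by rewrite add0e mule_ge0// lee_fin.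
- by move=> m; case: v.
- move=> m i _; case: ifP => // _; case: ifP => // _.
  rewrite add0e; apply: le_trans (_ : s%:E * 1 <= _)%E; last by rewrite mule1 lee_fin.
  by apply: lee_wpmul2l; rewrite ?lee_fin.
Qed.

Lemma trunc_exit_or_not n c v :
  (trunc 1 1 0 0 n c v + trunc 0 1 1 0 n c v = 1)%E.
Proof.
elim: n c v => [|n IH] c v; first by rewrite /trunc add0e.
have T0 c' v' : (0 <= trunc 1 1 0 0 n c' v')%E by apply: trunc_ge0.
have T1 c' v' : (0 <= trunc 0 1 1 0 n c' v')%E by apply: trunc_ge0.
rewrite !trunc_rec -KopD//=.
- rewrite -[RHS](Kop_cst nu rho0 c v); congr Kop.
    by apply/funext => c'; case: v => [|? ?]; rewrite ?adde0.
  apply/funext => c'; apply/funext => i; case: ifP => // _; case: ifP => // _.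
  by rewrite !mul1e !add0e.
- by move=> c'; case: v.
- move=> c' i; case: ifP => // _; case: ifP => // _.
  by rewrite add0e mul1e.
- by move=> c'; case: v.
- move=> c' i; case: ifP => // _; case: ifP => // _.
  by rewrite add0e mul1e.
Qed.

Lemma trunc_count_le n c v : (trunc 0 1 0 1 n c v <= n%:R%:E)%E.
Proof.
elim: n c v => [|n IH] c v; first by rewrite /trunc lee_fin.
have T0 c' v' : (0 <= trunc 0 1 0 1 n c' v')%E by apply: trunc_ge0.
have IH' c' v' : (trunc 0 1 0 1 n c' v' <= n.+1%:R%:E)%E.
  by apply: le_trans (IH _ _) _; rewrite lee_fin ler_nat.
rewrite trunc_rec -[leRHS](Kop_cst nu rho0 c v); apply: Kop_le => //=.
- by move=> c'; case: v.
- by move=> c' i; case: ifP => // _; case: ifP => // _; rewrite mul1e adde_ge0.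
- by move=> m; case: v => [|? ?]; rewrite ?lee_fin ?ler0n.
- move=> m i _; case: ifP => // _; case: ifP => // _.
  by rewrite mul1e -natr1 addrC EFinD leeD.
Qed.

Lemma between_EFin (x : \bar R) (M : R) : (0 <= x -> x <= M%:E ->
  exists2 y : R, (0 <= y <= M)%R & x = y%:E)%E.
Proof.
case: x => [y| |]//; rewrite !lee_fin => y0 yM; exists y => //.
by rewrite y0 yM.
Qed.

(** Second-order expansion at [s = 1 - t] of the generating function of the
    number of fresh passages to depth [d] within [n] steps. *)
Lemma trunc_gen_fun_le (t : R) n c v : 0 <= t <= 1 ->
  (trunc 1 (1 - t) 1 0 n c v + t%:E * trunc 0 1 0 1 n c v
     <= (1 + (t * n%:R) ^+ 2)%:E)%E.
Proof.
move=> /andP[t0 t1]; have s0 : 0 <= 1 - t by rewrite subr_ge0.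
have s01 : 0 <= 1 - t <= 1 by rewrite s0 gerBl.
elim: n c v => [|n IH] c v.
  by rewrite /trunc mule0 adde0 lee_fin lerDl sqr_ge0.
have T0 c' v' : (0 <= trunc 1 (1 - t) 1 0 n c' v')%E by apply: trunc_ge0.
have T1 c' v' : (0 <= trunc 0 1 0 1 n c' v')%E by apply: trunc_ge0.
have IH' c' v' : (trunc 1 (1 - t) 1 0 n c' v' + t%:E * trunc 0 1 0 1 n c' v'
     <= (1 + (t * n.+1%:R) ^+ 2)%:E)%E.
  apply: le_trans (IH _ _) _; rewrite lee_fin lerD2l !exprMn.
  by rewrite ler_wpM2l ?sqr_ge0// ler_sqr ?nnegrE// ler_nat.
rewrite !trunc_rec -KopZ// -?KopD//=.
- rewrite -[leRHS](Kop_cst nu rho0 c v); apply: Kop_le => //=.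
  + move=> c'; case: v => [|? ?]; first by rewrite mule0 adde0.
    by rewrite adde_ge0 ?mule_ge0.
  + move=> c' i; case: ifP => _; first by rewrite adde_ge0 ?mule_ge0.
    case: ifP => _; last by rewrite adde_ge0 ?mule_ge0.
    by rewrite !adde_ge0 ?mule_ge0 ?adde_ge0 ?mule_ge0.
  + move=> m; case: v => [|? ?]; last exact: IH'.
    by rewrite mule0 adde0 lee_fin lerDl sqr_ge0.
  + move=> m i _; case: ifP => _; first exact: IH'.
    case: ifP => _; last exact: IH'.
    set g := grow _ _ _.
    have [x /andP[x0 x1] xE] : exists2 y, 0 <= y <= 1 & trunc 1 (1 - t) 1 0 n g v = y%:E.
      by apply: between_EFin => //; apply: trunc_le1 => //; rewrite ler01 lexx.
    have [z /andP[z0 z1] zE] : exists2 y, 0 <= y <= n%:R & trunc 0 1 0 1 n g v = y%:E.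
      by apply: between_EFin => //; exact: trunc_count_le.
    have := IH g v; rewrite xE zE -!EFinM -!EFinD !lee_fin add0r mul1r -natr1.
    set N := n%:R => IHg; have N0 : 0 <= N by rewrite ler0n.
    have tz : t * (t * z) <= t * (t * N) by rewrite !ler_wpM2l.
    have tN : 0 <= t * (t * N) ^+ 2 by rewrite mulr_ge0// sqr_ge0.
    have tN1 : 0 <= t * (t * N) by rewrite !mulr_ge0.
    have t2 : 0 <= t * t by rewrite mulr_ge0.
    have := ler_wpM2l s0 IHg; nra.
- by move=> c'; case: v.
- move=> c' i; case: ifP => // _; case: ifP => // _.
  by rewrite add0e mule_ge0.
- by move=> c'; case: v => [|? ?]; rewrite ?mule0 ?mule_ge0.
- by move=> c' i; rewrite mule_ge0//; case: ifP => // _; case: ifP => // _; rewrite mul1e adde_ge0.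
- by move=> c'; case: v.
- by move=> c' i; case: ifP => // _; case: ifP => // _; rewrite mul1e adde_ge0.
Qed.

(** Comparison with the truncated walk: in the real walk every first passage
    to depth [d] starts a fresh excursion, which must end. *)
Lemma exit_prob_le_trunc (s b : R) n N c c' v : 0 <= s <= 1 -> 0 <= b <= 1 ->
  (forall k, (k < n)%N -> exit_prob k no_counts [::] <= s%:E)%E ->
  b = 1 \/ (n <= N)%N ->
  (size v < d)%N ->
  (forall u, (size u < d)%N -> c u = c' u) ->
  (forall u, size u = d -> c' u = 0%N -> forall z, c (u ++ z) = 0%N) ->
  (exit_prob n c v <= trunc 1 s b 0 N c' v)%E.
Proof.
move=> s01 b01; have [s0 _] := andP s01; have [b0 _] := andP b01.
elim: n N c c' v => [|n IH] N c c' v Hs bN vd cc c0.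
  by apply: trunc_ge0.
case: N bN => [[->|//]|N bN]; first exact: exit_prob_le1.
have bN' : b = 1 \/ (n <= N)%N by case: bN; [left|right].
have Hs' k : (k < n)%N -> (exit_prob k no_counts [::] <= s%:E)%E.
  by move=> kn; apply: Hs; apply: ltnW.
have ccm m u : (size u < d)%N -> grow c v m u = grow c' v m u.
  by move=> ud; rewrite /grow; case: ifP => _; rewrite cc.
have c0m m u : size u = d -> grow c' v m u = 0%N ->
    forall z, grow c v m (u ++ z) = 0%N.
  move=> ud; have uv : u == v = false by apply/eqP => uv; rewrite -ud uv ltnn in vd.
  rewrite {1}/grow uv => u0 z; rewrite /grow; case: eqP => [zv|_]; last exact: c0.
  by move: vd; rewrite -zv size_cat ud ltnNge leq_addr.
rewrite exit_prob_rec trunc_rec; apply: Kop_le => //=.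
- exact: cc.
- by move=> ?; case: (v) => // *; exact: exit_prob_ge0.
- by move=> ? i; exact: exit_prob_ge0.
- move=> m; case: v vd ccm c0m => // a v vd ccm c0m.
  apply: IH => //; [|exact: ccm|exact: c0m].
  by rewrite size_father; exact: leq_ltn_trans vd.
move=> m i _; rewrite size_rcons; case: ltnP => [vd'|dv].
  by apply: IH => //; [rewrite size_rcons|exact: ccm|exact: c0m].
have ud : size (rcons v i) = d by apply/eqP; rewrite eqn_leq size_rcons vd dv.
have IHv c2 c2' : (forall u, ~~ prefix (rcons v i) u -> c2 u = grow c v m u) ->
    c2' = grow c' v m \/ c2' = grow (grow c' v m) (rcons v i) 1 ->
    (c2' (rcons v i) = 0%N -> forall z, c2 (rcons v i ++ z) = 0%N) ->
    (exit_prob n c2 v <= trunc 1 s b 0 N c2' v)%E.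
  move=> c2E c2'E c2v; apply: IH => //.
  - move=> u us; rewrite c2E; last first.
      apply/negP => /prefixP[z uE]; move: us.
      by rewrite uE size_cat ud ltnNge leq_addr.
    rewrite ccm//; case: c2'E => -> //; rewrite [RHS]grow_other//.
    by apply: contraTneq us => ->; rewrite ud ltnn.
  - move=> u us; have [->|un] := eqVneq u (rcons v i); first exact: c2v.
    have -> : c2' u = grow c' v m u.
      by case: c2'E => -> //; rewrite grow_other.
    move=> u0 z; rewrite c2E; first exact: c0m.
    apply/negP => /prefixP[y /eqP]; rewrite eqseq_cat ?ud// => /andP[uE _].
    by rewrite uE in un.
have vE : father (rcons v i) = v by exact: father_rcons.
case: eqP => [c'u|c'u].
- rewrite add0e -(cats0 (rcons v i)).
  have Wge0 : (0 <= trunc 1 s b 0 N (grow (grow c' v m) (rcons v i) 1) v)%E.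
    by apply: trunc_ge0.
  have below0 : below (rcons v i) (grow c v m) = no_counts.
    by apply/funext => z; rewrite /below c0m.
  have [M /andP[M0 _] WE] := between_EFin Wge0 (trunc_le1 _ _ _ s01 b01).
  rewrite cats0 WE.
  apply: (@le_trans _ _ (M%:E * exit_prob n (below (rcons v i) (grow c v m)) [::])%E).
    rewrite -{1}(cats0 (rcons v i)); apply: exit_prob_below => //.
      exact: rcons_neq_nil.
    move=> c2 c2E; rewrite vE -WE; apply: IHv => //; first by right.
    by rewrite grow_same addn1.
  rewrite below0 muleC; apply: lee_wpmul2r; first by rewrite lee_fin.
  exact: Hs.
- have Wge0 : (0 <= trunc 1 s b 0 N (grow c' v m) v)%E by apply: trunc_ge0.
  have [M /andP[M0 _] WE] := between_EFin Wge0 (trunc_le1 _ _ _ s01 b01).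
  rewrite WE; apply: (@le_trans _ _ (M%:E * exit_prob n (below (rcons v i) (grow c v m)) [::])%E).
    rewrite -{1}(cats0 (rcons v i)); apply: exit_prob_below => //.
      exact: rcons_neq_nil.
    move=> c2 c2E; rewrite vE -WE; apply: IHv => //; first by left.
  rewrite -[leRHS]mule1; apply: lee_wpmul2l; first by rewrite lee_fin.
  exact: exit_prob_le1.
Qed.

(** A functional that increases on average, when [1] is paid for every fresh
    passage, bounds the mean number of these from below, up to what is left of it
    when there is no exit. *)
Lemma trunc_count_ge (F : counts -> vertex -> R) (C : R) n c v :
  0 <= C -> (forall c v, 0 <= F c v <= C) ->
  (forall c v, good c v -> (size v < d)%N ->
    (F c v)%:E <= Kop nu rho c v
      (fun c' => if v is [::] then 0 else (F c' (father v))%:E)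
      (fun c' i => let u := rcons v i in
         if (size u < d)%N then (F c' u)%:E
         else if c' u == 0%N then 1 + (F (grow c' u 1) v)%:E
         else (F c' v)%:E))%E ->
  good c v -> (size v < d)%N ->
  ((F c v)%:E <= trunc 0 1 0 1 n c v + C%:E * trunc 0 1 1 0 n c v)%E.
Proof.
move=> C0 FC FK; have F0 c' v' : (0 <= (F c' v')%:E)%E.
  by rewrite lee_fin; case/andP: (FC c' v').
elim: n c v => [|n IH] c v cv vd.
  by rewrite /trunc add0e mule1 lee_fin; case/andP: (FC c v).
have T0 c' v' : (0 <= trunc 0 1 0 1 n c' v')%E by apply: trunc_ge0.
have T1 c' v' : (0 <= trunc 0 1 1 0 n c' v')%E by apply: trunc_ge0.
apply: le_trans (FK _ _ cv vd) _; rewrite !trunc_rec -KopZ// -?KopD//=.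
- apply: Kop_le => //=.
  + by move=> c'; case: v {cv vd} => // *; exact: F0.
  + by move=> c' i; case: ifP => // _; case: ifP => // _; rewrite adde_ge0.
  + move=> m; case: v cv vd => [|a v] cv vd; first by rewrite mule0 add0e.
    apply: IH; first by apply: good_father; exact: good_grow.
    by rewrite size_father; exact: leq_ltn_trans vd.
  + move=> m i im; have cv' : good (grow c v m) (rcons v i).
      by apply: good_rcons; [exact: good_grow|rewrite grow_same].
    case: ifP => [ud|_]; first exact: IH.
    case: ifP => _; last by apply: IH => //; exact: good_grow.
    rewrite add0e !mul1e -addeA; apply: leeD => //; apply: IH => //.
    by have := good_father (good_grow 1 cv'); rewrite father_rcons.
all: try by move=> c'; case: v {cv vd} => [|? ?]; rewrite ?mule0 ?mule_ge0 ?lee_fin.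
all: move=> c' i; repeat (case: ifP => // _).
all: by rewrite ?add0e ?mul1e ?adde_ge0 ?mule_ge0 ?lee_fin.
Qed.

(** Either the truncated walk fails to exit with positive probability, and so
    does the walk itself; or it exits, and then the fresh passages to depth
    [d] form a supercritical Galton-Watson process, whose extinction
    probability is a fixed point smaller than 1. *)
Lemma escape (F : counts -> vertex -> R) (C : R) :
  (0 < d)%N -> 0 <= C -> (forall c v, 0 <= F c v <= C) ->
  (forall c v, good c v -> (size v < d)%N ->
    (F c v)%:E <= Kop nu rho c v
      (fun c' => if v is [::] then 0 else (F c' (father v))%:E)
      (fun c' i => let u := rcons v i in
         if (size u < d)%N then (F c' u)%:E
         else if c' u == 0%N then 1 + (F (grow c' u 1) v)%:E
         else (F c' v)%:E))%E ->
  1 < F no_counts [::] ->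
  exists2 s : R, 0 <= s < 1 & forall n, (exit_prob n no_counts [::] <= s%:E)%E.
Proof.
move=> d0 C0 FC FK F1.
have goodo : good no_counts [::] by split.
have Fn n := trunc_count_ge n C0 FC FK goodo d0.
pose pin n := trunc 0 1 1 0 n no_counts [::].
pose eps := (F no_counts [::] - 1) / (2 * (C + 1)).
have C2 : 0 < 2 * (C + 1) by rewrite mulr_gt0// ltr_wpDl.
have eps0 : 0 < eps by rewrite divr_gt0// subr_gt0.
have s01 : 0 <= (1 : R) <= 1 by rewrite ler01 lexx.
have [[N piN]|pib] := pselect (exists N, (pin N < eps%:E)%E); last first.
  have pi1 n : (pin n <= 1)%E.
    by rewrite /pin -(trunc_exit_or_not n no_counts [::]) leeDr//; apply: trunc_ge0.
  have pie n : (eps%:E <= pin n)%E.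
    by rewrite leNgt; apply/negP => pn; apply: pib; exists n.
  have e1 : eps <= 1 by rewrite -lee_fin; apply: le_trans (pie 0%N) (pi1 0%N).
  exists (1 - eps); first by rewrite subr_ge0 e1 ltrBlDr ltrDl.
  move=> n; apply: (@le_trans _ _ (trunc 1 1 0 0 n no_counts [::])).
    apply: exit_prob_le_trunc => //; first by rewrite lexx ler01.
    - by move=> k _; apply: exit_prob_le1.
    - by right.
  have q0 : (0 <= trunc 1 1 0 0 n no_counts [::])%E by apply: trunc_ge0.
  have [q /andP[q0' q1] qE] : exists2 y, 0 <= y <= 1 &
      trunc 1 1 0 0 n no_counts [::] = y%:E.
    by apply: between_EFin => //; apply: trunc_le1 => //; rewrite lexx ler01.
  have p0 : (0 <= pin n)%E by apply: trunc_ge0.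
  have [p /andP[p0' p1] pE] := between_EFin p0 (pi1 n).
  have := trunc_exit_or_not n no_counts [::]; rewrite -/(pin n) qE pE.
  rewrite -EFinD => -[qp]; have := pie n; rewrite pE !lee_fin; lra.
have z0 : (0 <= trunc 0 1 0 1 N no_counts [::])%E by apply: trunc_ge0.
have [z /andP[z0' zN] zE] := between_EFin z0 (trunc_count_le N no_counts [::]).
have z1 : 1 < z.
  have p0 : (0 <= pin N)%E by apply: trunc_ge0.
  have [p /andP[p0' p1] pE] := between_EFin p0 (ltW piN).
  have := Fn N; rewrite zE -/(pin N) pE -EFinM -EFinD lee_fin => Fz.
  have : C * p <= (C + 1) * eps by rewrite ler_pM// lerDl.
  have -> : (C + 1) * eps = (F no_counts [::] - 1) / 2.
    by rewrite /eps invfM mulrCA mulrA; field; rewrite gt_eqF// ltr_wpDl.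
  lra.
have N0 : (0 < N)%N.
  by case: (N) zN => // /(lt_le_trans z1); rewrite ltr10.
pose t := (z - 1) / N%:R ^+ 2.
have NR : 0 < N%:R :> R by rewrite ltr0n.
have N1 : 1 <= N%:R :> R by rewrite ler1n.
have t0 : 0 < t by rewrite divr_gt0 ?exprn_gt0// subr_gt0.
have t1 : t <= 1.
  rewrite ler_pdivrMr ?exprn_gt0// mul1r.
  apply: (@le_trans _ _ N%:R); first by rewrite (le_trans _ zN)// gerBl.
  by rewrite -[leLHS]mulr1 expr2 ler_wpM2l// ltW.
have tz : (t * N%:R) ^+ 2 = t * (z - 1).
  by rewrite exprMn expr2 -mulrA /t mulfVK// gt_eqF// exprn_gt0.
have s01' : 0 <= 1 - t <= 1 by rewrite subr_ge0 t1 gerBl ltW.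
exists (1 - t); first by rewrite subr_ge0 t1 ltrBlDr ltrDl.
suff Hn n : forall k, (k < n)%N -> (exit_prob k no_counts [::] <= (1 - t)%:E)%E.
  by move=> n; apply: (Hn n.+1).
elim: n => [//|n IH] k; rewrite ltnS leq_eqVlt => /predU1P[->|]; last exact: IH.
apply: (@le_trans _ _ (trunc 1 (1 - t) 1 0 N no_counts [::])).
  apply: exit_prob_le_trunc => //; by left.
have B0 : (0 <= trunc 1 (1 - t) 1 0 N no_counts [::])%E.
  by apply: trunc_ge0 => //; case/andP: s01'.
have [b /andP[b0 b1] bE] := between_EFin B0 (trunc_le1 N no_counts [::] s01' s01).
have := @trunc_gen_fun_le t N no_counts [::]; rewrite bE zE -EFinM -EFinD !lee_fin tz.
rewrite (ltW t0) t1 => /(_ isT); lra.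
Qed.

End Truncated.
End Escape.

(** * Potentials of trees *)

Section Energy.
Variables (R : realType) (rho : R).
Hypothesis rho0 : 0 < rho.
Variable al : pred nat.

Implicit Types (Phi : nat -> nat -> R) (c : counts) (v : vertex).

(** The sum of [Phi l k], discounted by [rho^-1] per generation, over the
    vertices of the tree whose labels consist of indices allowed by [al]; [l] is
    the depth of the vertex and [k] the number of its children. The counts being
    functions, [n] bounds the depth of the vertices that are taken into account. *)
Fixpoint energy Phi (n : nat) c : R :=
  if n is n'.+1 then
    Phi 0%N (c [::]) + rho^-1 * \sum_(i < c [::] | al i)
      energy (fun l => Phi l.+1) n' (below [:: val i] c)
  else 0.

(** The sum of the energies of the subtrees of [v] and of all its ancestors; the
    sum is cut at the first index that [al] forbids. *)
Fixpoint potential Phi (n : nat) c v : R :=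
  energy Phi n c +
  (if v is i :: w then
     if al i then potential (fun l => Phi l.+1) n.-1 (below [:: i] c) w else 0
   else 0).

Definition active (n : nat) v : bool := all al v && (size v < n)%N.

Definition geo (j : nat) : R := \sum_(l < j.+1) rho^-1 ^+ l.

Lemma geo0 : geo 0 = 1.
Proof. by rewrite /geo big_ord1 expr0. Qed.

Lemma geoS j : geo j.+1 = geo j + rho^-1 ^+ j.+1.
Proof. by rewrite /geo big_ord_recr. Qed.

Lemma geoS1 j : geo j.+1 = 1 + rho^-1 * geo j.
Proof.
rewrite /geo big_ord_recl expr0 mulr_sumr; congr (_ + _).
by apply: eq_bigr => i _; rewrite exprS.
Qed.

Lemma geo_ge1 j : 1 <= geo j.
Proof.
elim: j => [|j IH]; first by rewrite geo0.
by rewrite geoS ler_wpDr// exprn_ge0// invr_ge0 ltW.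
Qed.

Lemma potential0 Phi c v : potential Phi 0 c v = 0.
Proof.
elim: v Phi c => [|i w IH] Phi c /=; first by rewrite addr0.
by case: ifP; rewrite ?IH ?addr0.
Qed.

Lemma potential_nil Phi n c : potential Phi n c [::] = energy Phi n c.
Proof. by case: n => [|n] /=; rewrite addr0. Qed.

Lemma potential_cons Phi n c i w : potential Phi n c (i :: w) = energy Phi n c +
  (if al i then potential (fun l => Phi l.+1) n.-1 (below [:: i] c) w else 0).
Proof. by case: n. Qed.

Lemma energyS Phi n c : energy Phi n.+1 c = Phi 0%N (c [::]) +
  rho^-1 * \sum_(i < c [::] | al i) energy (fun l => Phi l.+1) n (below [:: val i] c).
Proof. by []. Qed.

Lemma energy_ge0 Phi n c : (forall l k, 0 <= Phi l k) -> 0 <= energy Phi n c.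
Proof.
elim: n Phi c => [|n IH] Phi c P0 //=; rewrite addr_ge0//.
by rewrite mulr_ge0 ?invr_ge0 ?(ltW rho0)// sumr_ge0// => i _; exact: IH.
Qed.

Lemma potential_ge0 Phi n c v : (forall l k, 0 <= Phi l k) -> 0 <= potential Phi n c v.
Proof.
elim: v Phi n c => [|i w IH] Phi n c P0.
  by rewrite potential_nil energy_ge0.
by rewrite potential_cons addr_ge0 ?energy_ge0//; case: ifP => // _; exact: IH.
Qed.

Lemma activeS n i w : active n.+1 (i :: w) = al i && active n w.
Proof. by rewrite /active /= ltnS andbA. Qed.

(** Stepping down to a child adds its energy, stepping up removes that of the
    current vertex, and the discount [rho^-1] is the one for which the energies of
    the descendants cancel out: only the own weight of [v] is lost. *)
Lemma potential_jump Phi n c v :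
  rho * (if v is [::] then 0 else potential Phi n c (father v)) +
    \sum_(i < c v) potential Phi n c (rcons v i) =
  ((c v)%:R + rho) * potential Phi n c v -
    (if active n v then rho * Phi (size v) (c v) else 0).
Proof.
case: n => [|n].
  rewrite /active ltn0 andbF !potential0 big1; last by move=> i _; rewrite potential0.
  by case: v => [|? ?]; rewrite !mulr0 subr0 addr0.
elim: v Phi n c => [|i w IH] Phi n c.
  rewrite [X in rho * X]/= mulr0 add0r potential_nil.
  under eq_bigr => i _ do rewrite [rcons _ _]/= potential_cons potential_nil.
  rewrite big_split [X in X + _]/= sumr_const card_ord -[_ *+ _]mulr_natl.
  rewrite -big_mkcond mulrDl -addrA; congr (_ + _).
  have -> : active n.+1 [::] by [].
  by rewrite /= mulrDr mulrA mulfV ?gt_eqF// mul1r addrAC subrr add0r.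
rewrite father_cons.
have -> : \sum_(j < c (i :: w)) potential Phi n.+1 c (rcons (i :: w) j) =
    (c (i :: w))%:R * energy Phi n.+1 c +
    (if al i then \sum_(j < below [:: i] c w)
        potential (fun l => Phi l.+1) n (below [:: i] c) (rcons w j) else 0).
  under eq_bigr => j _ do rewrite rcons_cons potential_cons.
  rewrite big_split/= sumr_const card_ord -[_ *+ _]mulr_natl; congr (_ + _).
  by case: ifP => // _; rewrite big1.
have -> : potential Phi n.+1 c (if w is [::] then [::] else i :: father w) =
    energy Phi n.+1 c + (if al i then
      (if w is [::] then 0 else potential (fun l => Phi l.+1) n (below [:: i] c) (father w))
      else 0).
  case: w {IH} => [|a w]; last by rewrite potential_cons.
  by rewrite potential_nil; case: ifP; rewrite addr0.
rewrite potential_cons activeS; case: ifP => _; last by rewrite !addr0 subr0; ring.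
rewrite [n.+1.-1]/= [true && _]/= [size (i :: w)]/=.
have IHe : rho * (if w is [::] then 0
      else potential (fun l => Phi l.+1) n (below [:: i] c) (father w)) +
    \sum_(j < below [:: i] c w)
      potential (fun l => Phi l.+1) n (below [:: i] c) (rcons w j) =
    ((c (i :: w))%:R + rho) * potential (fun l => Phi l.+1) n (below [:: i] c) w -
    (if active n w then rho * Phi (size w).+1 (c (i :: w)) else 0).
  case: n => [|n]; last exact: IH.
  rewrite /active ltn0 andbF !potential0 big1; last by move=> ? _; rewrite potential0.
  by case: w {IH} => [|? ?]; rewrite !mulr0 subr0 addr0.
move: IHe; set X := (if w is [::] then 0 else _); set Y := \sum_(_ < _) _.
set Z := (if _ then _ else _); set T := potential _ n _ w.
set E := energy Phi n.+1 c => IHe.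
have -> : rho * (E + X) + ((c (i :: w))%:R * E + Y) =
  (c (i :: w))%:R * E + rho * E + (rho * X + Y) by ring.
by rewrite IHe; ring.
Qed.

Definition gain Phi n c v m : R :=
  Phi (size v) (c v + m)%N - Phi (size v) (c v) +
  rho^-1 * (if ((size v).+1 < n)%N then Phi (size v).+1 0%N else 0) *
    (\sum_(i < m | al (c v + i)%N) 1).

Lemma below_grow_other i v c m : (forall w, v <> i :: w) ->
  below [:: i] (grow c v m) = below [:: i] c.
Proof.
move=> vi; apply/funext => z; rewrite /below grow_other//.
by apply/eqP => /esym; exact: vi.
Qed.

(** The energy of [v] increases by [gain], and reaches the subtree of an ancestor
    with the discount of the generations in between. *)
Lemma energy_grow Phi n c v m : good c v ->
  energy Phi n (grow c v m) = energy Phi n c +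
    (if active n v then rho^-1 ^+ size v * gain Phi n c v m else 0).
Proof.
elim: v Phi n c => [|i w IH] Phi [|n] c cv; rewrite ?[active 0 _]andbF ?addr0//.
  have -> : active n.+1 [::] by [].
  rewrite /= grow_same expr0 mul1r /gain /=.
  have bel j : below [:: j] (grow c [::] m) = below [:: j] c by exact: below_grow_other.
  rewrite !(big_mkcond (fun _ => al _)) big_split_ord/=.
  under eq_bigr => j _ do rewrite bel.
  have -> : \sum_(j < m) (if al (c [::] + j)%N then
      energy (fun l => Phi l.+1) n (below [:: (c [::] + j)%N] (grow c [::] m)) else 0) =
      (if (0 < n)%N then Phi 1%N 0%N else 0) *
      (\sum_(j < m) if al (c [::] + j)%N then 1 else 0).
    rewrite mulr_sumr; apply: eq_bigr => j _; rewrite bel.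
    case: ifP => _; last by rewrite mulr0.
    have c0 : below [:: (c [::] + j)%N] c [::] = 0%N.
      by case: cv => wf _; apply: (wf [::]); rewrite leq_addr.
    by case: (n) => [|n'] /=; rewrite ?mul0r// c0 big_ord0 mulr0 addr0 mulr1.
  by rewrite [(1 < n.+1)%N]ltnS; ring.
rewrite activeS.
have cvi := good_below cv; have [_ /= /andP[ic _]] := cv.
rewrite [LHS]/= grow_other// [in RHS]/=.
have -> : \sum_(j < c [::] | al j) energy (fun l => Phi l.+1) n
      (below [:: val j] (grow c (i :: w) m)) =
    \sum_(j < c [::] | al j) energy (fun l => Phi l.+1) n (below [:: val j] c) +
    (if al i && active n w then
       rho^-1 ^+ size w * gain (fun l => Phi l.+1) n (below [:: i] c) w m else 0).
  case: (boolP (al i)) => ali /=.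
    rewrite (bigD1 (Ordinal ic))//= [in RHS](bigD1 (Ordinal ic))//=.
    rewrite (@below_grow [:: i]) IH// [RHS]addrAC; congr (_ + _).
    apply: eq_bigr => j /andP[_ ji]; rewrite below_grow_other// => z [ij _].
    by move: ji; rewrite -val_eqE/= ij eqxx.
  rewrite addr0; apply: eq_bigr => j alj; rewrite below_grow_other// => z [ij _].
  by move: ali; rewrite ij alj.
rewrite (mulrDr rho^-1) addrA; congr (_ + _).
by case: ifP => _; rewrite ?mulr0// mulrA -exprS.
Qed.

(** The increments of the energies of all the ancestors add up to the geometric
    sum [geo]. *)
Lemma potential_grow Phi n c v m : good c v ->
  potential Phi n (grow c v m) v = potential Phi n c v +
    (if active n v then geo (size v) * gain Phi n c v m else 0).
Proof.
elim: v Phi n c => [|i w IH] Phi n c cv.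
  rewrite !potential_nil energy_grow// expr0 mul1r; congr (_ + _).
  by case: ifP => //; rewrite geo0 mul1r.
case: n => [|n]; first by rewrite !potential0 /active ltn0 andbF addr0.
rewrite !potential_cons energy_grow//.
rewrite activeS (@below_grow [:: i]); case: (al i) => /=; last by rewrite !addr0.
rewrite (IH _ n)//; last exact: good_below.
case: ifP => _; rewrite ?addr0//.
have -> : gain (fun l => Phi l.+1) n (below [:: i] c) w m = gain Phi n.+1 c (i :: w) m.
  by [].
rewrite -[(size w).+1]/(size (i :: w)) geoS /=; ring.
Qed.

Lemma potential_rcons Phi n c v i :
  potential Phi n c (rcons v i) = potential Phi n c v +
    (if all al (rcons v i) then
       energy (fun l => Phi (size v + l).+1) (n - (size v).+1) (below (rcons v i) c)
     else 0).
Proof.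
elim: v Phi n c => [|j w IH] Phi n c.
  rewrite [rcons _ _]/= potential_cons !potential_nil /= andbT subn1.
  by congr (_ + _); case: ifP.
case: n => [|n]; first by rewrite !potential0 sub0n /= if_same addr0.
rewrite rcons_cons !potential_cons IH; set E := energy Phi n.+1 c.
rewrite -(addrA E); congr (_ + _).
have -> : all al (j :: rcons w i) = al j && all al (rcons w i) by [].
by case: (al j) => //; rewrite addr0.
Qed.

Lemma energy_fuel Phi n c : (forall u, (n <= size u)%N -> c u = 0%N) ->
  energy Phi n.+2 c = energy Phi n.+1 c.
Proof.
elim: n Phi c => [|n IH] Phi c c0.
  by rewrite /= c0// !big_ord0.
rewrite energyS [RHS]energyS; congr (_ + _ * _); apply: eq_bigr => i _.
by apply: IH => u nu; apply: c0.
Qed.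

Lemma potential_fuel Phi n c v : (forall u, (n <= size u)%N -> c u = 0%N) ->
  (size v <= n)%N -> potential Phi n.+2 c v = potential Phi n.+1 c v.
Proof.
elim: v Phi n c => [|i w IH] Phi n c c0 vn; first by rewrite !potential_nil energy_fuel.
rewrite !potential_cons energy_fuel//; case: n c0 vn => // n c0 vn.
by rewrite /= IH// => u nu; apply: c0.
Qed.

Lemma energy_le (M : nat) (K : R) n : 0 <= K -> (forall i, al i -> (i < M)%N) ->
  exists2 C : R, 0 <= C & forall Phi c, (forall l k, 0 <= Phi l k <= K) ->
    energy Phi n c <= C.
Proof.
move=> K0 alM; elim: n => [|n [C C0 IH]]; first by exists 0.
exists (K + rho^-1 * (M%:R * C)).
  by rewrite addr_ge0// mulr_ge0 ?mulr_ge0// invr_ge0 ltW.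
move=> Phi c PK /=; apply: lerD; first by case/andP: (PK 0%N (c [::])).
rewrite ler_wpM2l ?invr_ge0 ?(ltW rho0)//.
apply: (@le_trans _ _ (\sum_(i < c [::] | al i) C)).
  by apply: ler_sum => i _; exact: IH.
suff: \sum_(i < c [::] | al i) C <= (minn (c [::]) M)%:R * C.
  by move=> /le_trans; apply; rewrite ler_wpM2r// ler_nat geq_minr.
rewrite big_mkcond/=; elim: (c [::]) => [|k IHk]; first by rewrite big_ord0 mulr_ge0.
rewrite big_ord_recr/=; case: ifP => [/alM kM|_].
  by rewrite (minn_idPl kM) -natr1 mulrDl mul1r lerD2r (le_trans IHk)//
             (minn_idPl (ltnW kM)).
rewrite addr0; apply: le_trans IHk _; rewrite ler_wpM2r// ler_nat leq_min geq_minr.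
by rewrite andbT (leq_trans (geq_minl _ _)).
Qed.

Lemma potential_le (M : nat) (K : R) n : 0 <= K -> (forall i, al i -> (i < M)%N) ->
  exists2 C : R, 0 <= C & forall Phi c v, (forall l k, 0 <= Phi l k <= K) ->
    potential Phi n c v <= C.
Proof.
move=> K0 alM; elim: n => [|n [C C0 IH]].
  by exists 0 => // Phi c v _; rewrite potential0.
have [D D0 DE] := energy_le n.+1 K0 alM.
exists (D + C); first by rewrite addr_ge0.
move=> Phi c [|i w] PK; first by rewrite potential_nil -[leLHS]addr0 lerD// DE.
rewrite potential_cons lerD//; first exact: DE.
by case: ifP => // _; apply: IH.
Qed.

End Energy.

(** * The linear potential *)

Section Linear.
Variables (R : realType) (nu : probability nat R) (rho : R).
Hypothesis rho0 : 0 < rho.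

Lemma Ex_affine (f : nat -> R) (a b M : R) : 0 <= a -> 0 <= b ->
  (forall m, 0 <= f m) -> Ex nu (fun m => (f m)%:E) = M%:E ->
  Ex nu (fun m => (a + b * f m)%:E) = (a + b * M)%:E.
Proof.
move=> a0 b0 f0 fM; under eq_Ex do rewrite EFinD EFinM.
by rewrite ExD ?Ex_cst ?ExZ ?fM// => m; rewrite lee_fin ?mulr_ge0.
Qed.

(** With the weight [k + rho], a jump loses [rho] whatever the number of
    children, and each newborn child brings 1 to its father and 1 by itself. *)
Definition lin (n : nat) (c : counts) (v : vertex) : R :=
  potential rho predT (fun _ k => k%:R + rho) n c v.

Lemma lin_Phi_ge0 : forall l k : nat, 0 <= k%:R + rho.
Proof. by move=> _ k; rewrite addr_ge0// ltW. Qed.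

Lemma lin_ge0 n c v : 0 <= lin n c v.
Proof. exact: potential_ge0 lin_Phi_ge0. Qed.

Lemma lin_ge n c v : (size v < n)%N -> rho * (size v).+1%:R <= lin n c v.
Proof.
rewrite /lin; set Phi := (fun _ _ => _).
have E m c' : rho <= energy rho predT Phi m.+1 c'.
  rewrite energyS -[leLHS]addr0 lerD// ?lerDr// mulr_ge0 ?invr_ge0 ?(ltW rho0)//.
  by apply: sumr_ge0 => i _; apply: energy_ge0 lin_Phi_ge0.
elim: v n c => [|i w IH] [|n] c // wn; first by rewrite potential_nil mulr1.
rewrite potential_cons [_ (i :: w)]/= -natr1 mulrDr mulr1 addrC.
by apply: lerD; [exact: E|exact: IH].
Qed.

Lemma lin_gain n c v m : ((size v).+1 < n)%N ->
  gain rho predT (fun _ k => k%:R + rho) n c v m = 2 * m%:R.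
Proof.
move=> vn; rewrite /gain vn add0r mulVf ?gt_eqF// mul1r.
by rewrite sumr_const card_ord natrD; ring.
Qed.

Lemma lin_grow n c v m : good c v -> ((size v).+1 < n)%N ->
  lin n (grow c v m) v = lin n c v + geo rho (size v) * (2 * m%:R).
Proof.
move=> cv vn; rewrite /lin potential_grow// lin_gain//.
by rewrite /active all_predT (ltnW vn).
Qed.

Lemma lin_jump n c v : (size v < n)%N ->
  rho * (if v is [::] then 0 else lin n c (father v)) +
    \sum_(i < c v) lin n c (rcons v i) =
  ((c v)%:R + rho) * (lin n c v - rho).
Proof.
move=> vn; rewrite potential_jump// /active all_predT vn /=; rewrite /lin; ring.
Qed.

Variable M : R.
Hypothesis meanM : mean nu = M%:E.

Lemma Ex_affine_mean a b : 0 <= a -> 0 <= b ->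
  Ex nu (fun m => (a + b * m%:R)%:E) = (a + b * M)%:E.
Proof. by move=> a0 b0; apply: Ex_affine => //; rewrite Ex_mean. Qed.

Lemma geo_ge0 j : 0 <= geo rho j.
Proof. exact: le_trans ler01 (geo_ge1 rho0 j). Qed.

(** The loss of [rho] in a jump competes with the gain [2 * geo rho j] per child
    born at depth [j]; this is where the critical value [1 + 2 * M] comes from, as
    [geo rho j] tends to [rho / (rho - 1)] for [1 < rho]. *)
Lemma lin_drift n c v : good c v -> ((size v).+1 < n)%N -> v != [::] ->
  Kop nu rho c v (fun c' => (lin n c' (father v))%:E)
    (fun c' i => (lin n c' (rcons v i))%:E) =
  (lin n c v + 2 * geo rho (size v) * M - rho)%:E.
Proof.
move=> cv vn v0; rewrite KopE.
have lr : rho <= lin n c v.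
  apply: le_trans (lin_ge c (ltnW vn)).
  by rewrite -[leLHS]mulr1 ler_wpM2l ?ler1n// ltW.
rewrite -[_ - rho]addrAC -Ex_affine_mean; last 2 first.
- by rewrite subr_ge0.
- by rewrite mulr_ge0 ?geo_ge0.
apply: eq_Ex => m /=; congr EFin.
have := lin_jump (grow c v m) (ltnW vn).
have -> : (if v is [::] then 0 else lin n (grow c v m) (father v)) =
    lin n (grow c v m) (father v) by case: (v) v0.
move=> ->; rewrite mulrAC mulfV ?mul1r; last by rewrite gt_eqF// Kden_gt0.
by rewrite lin_grow//; ring.
Qed.

(** At the root the father step is a loop, whose contribution is missing from the
    balance of [lin_jump]; it is at most the potential itself. *)
Lemma lin_root_le n c : good c [::] -> (1 < n)%N ->
  (Kop nu rho c [::] (fun c' => (lin n c' [::])%:E)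
    (fun c' i => (lin n c' [:: i])%:E) <= (2 * (lin n c [::] + 2 * M))%:E)%E.
Proof.
move=> cv n1; rewrite KopE.
have -> : 2 * (lin n c [::] + 2 * M) = 2 * lin n c [::] + 4 * M by ring.
rewrite -Ex_affine_mean ?mulr_ge0 ?lin_ge0//; apply: Ex_le => m.
  rewrite lee_fin divr_ge0 ?(ltW (Kden_gt0 rho0 _))// addr_ge0 ?mulr_ge0 ?(ltW rho0) ?lin_ge0//.
  by apply: sumr_ge0 => i _; exact: lin_ge0.
rewrite lee_fin ler_pdivrMr ?Kden_gt0//.
have := @lin_jump n (grow c [::] m) [::] (ltnW n1); rewrite mulr0 add0r => ->.
rewrite lin_grow// geo0 mul1r.
set k := (grow c [::] m [::])%:R; set L := lin n c [::].
have k0 : 0 <= k by rewrite ler0n.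
have L0 : 0 <= L by rewrite lin_ge0.
have m0 : 0 <= m%:R :> R by rewrite ler0n.
have := rho0; nra.
Qed.

End Linear.

(** * A bounded potential *)

Lemma finite_min_gt0 (R : realType) (f : nat -> R) d :
  (forall j, (j < d)%N -> 0 < f j) ->
  exists2 e : R, 0 < e & forall j, (j < d)%N -> e <= f j.
Proof.
elim: d => [|d IH] f0; first by exists 1.
have [e e0 ef] := IH (fun j jd => f0 j (ltnW jd)).
exists (Num.min e (f d)); first by rewrite lt_min e0 f0.
move=> j; rewrite ltnS leq_eqVlt => /predU1P[->|jd].
  by rewrite ge_min lexx orbT.
by rewrite ge_min ef.
Qed.

(** The cut-off decreases from 1 to 0 like a logarithm, hence varies little in
    [m0] steps even after multiplication by [k]: the weight [(rho + k) * eta k] is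
    bounded, but its increments are nearly those of [rho + k] times [eta k]. *)
Lemma slow_cutoff (R : realType) (rho e : R) (m0 : nat) :
  0 < rho -> 0 < e -> (0 < m0)%N ->
  exists eta : nat -> R, exists M : nat,
    [/\ forall k, 0 <= eta k <= 1, eta 0%N = 1,
        forall k l, (k <= l)%N -> eta l <= eta k,
        forall k, (M <= k)%N -> eta k = 0 &
        forall k, (rho + k%:R + m0%:R) * (eta k - eta (k + m0)%N) <= e].
Proof.
move=> rho0 e0 m00.
pose h i : R := (rho + m0%:R + i%:R)^-1.
have den i : 0 < rho + m0%:R + i%:R by rewrite ltr_wpDr// ltr_wpDr.
have h0 i : 0 < h i by rewrite invr_gt0.
pose H k := \sum_(i < k) h i.
have HS k : H k.+1 = H k + h k by rewrite /H big_ord_recr.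
have Hle k l : (k <= l)%N -> H k <= H l.
  move=> /subnK <-; elim: (l - k)%N => [|n IH]; first by rewrite add0n.
  by rewrite addSn HS (le_trans IH)// lerDl ltW.
have H0 k : 0 <= H k by rewrite /H sumr_ge0// => i _; rewrite ltW.
have Hadd k n : H (k + n)%N - H k <= n%:R * h k.
  elim: n => [|n IH]; first by rewrite addn0 subrr mul0r.
  rewrite addnS HS -natr1 mulrDl mul1r addrAC lerD//.
  by rewrite lef_pV2 ?posrE ?den// lerD2l ler_nat leq_addr.
have Hdouble k : (0 < k)%N -> (rho + m0%:R + 2)^-1 <= H (k + k)%N - H k.
  move=> k0.
  have : k%:R * h (k + k)%N <= H (k + k)%N - H k.
    have : forall n, (n <= k)%N -> n%:R * h (k + k)%N <= H (k + n)%N - H k.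
      elim=> [|n IH] nk; first by rewrite mul0r addn0 subrr.
      rewrite addnS HS -natr1 mulrDl mul1r addrAC lerD ?IH ?(ltnW nk)//.
      by rewrite lef_pV2 ?posrE ?den// lerD2l ler_nat leq_add2l ltnW.
    exact.
  apply: le_trans; rewrite /h natrD.
  have k1 : 1 <= k%:R :> R by rewrite ler1n.
  have m1 : 0 <= m0%:R :> R by rewrite ler0n.
  have d1 : 0 < rho + m0%:R + 2 by rewrite ltr_wpDr// ltr_wpDr.
  have d2 : 0 < rho + m0%:R + (k%:R + k%:R) by rewrite -natrD.
  rewrite -[leLHS]mul1r ler_pdivrMr// mulrAC ler_pdivlMr// mul1r.
  by have := rho0; nra.
have Hinf X : exists k, X <= H k.
  have := archi_boundP (normr_ge0 (X * (rho + m0%:R + 2))).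
  set n := (Num.bound _) => nX.
  exists (2 ^ n)%N.
  have Hn : n%:R * (rho + m0%:R + 2)^-1 <= H (2 ^ n)%N.
    elim: n {nX} => [|n IH]; first by rewrite mul0r H0.
    rewrite -natr1 mulrDl mul1r expnS mul2n -addnn.
    have := Hdouble (2 ^ n)%N; rewrite expn_gt0 => /(_ isT).
    lra.
  apply: le_trans Hn; rewrite ler_pdivlMr; last by rewrite ltr_wpDr// ltr_wpDr.
  exact: le_trans (ler_norm _) (ltW nX).
pose eta k := Num.max 0 (1 - e / m0%:R * H k).
have m1 : 0 < m0%:R :> R by rewrite ltr0n.
have em0 : 0 < e / m0%:R by rewrite divr_gt0.
have [M HM] := Hinf (m0%:R / e).
exists eta, M; split.
- move=> k; rewrite /eta le_max lexx/= ge_max ler01/= lerBlDr lerDl.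
  by rewrite mulr_ge0// ltW.
- by rewrite /eta /H big_ord0 mulr0 subr0; apply/max_idPr.
- move=> k l kl; rewrite /eta ge_max le_max lexx/= le_max; apply/orP; right.
  by rewrite lerD2l lerN2 ler_wpM2l ?Hle// ltW.
- move=> k Mk; apply/max_idPl; rewrite subr_le0.
  rewrite [leLHS](_ : 1 = e / m0%:R * (m0%:R / e)); last by field; rewrite !gt_eqF.
  by rewrite ler_wpM2l ?(ltW em0)// (le_trans HM)// Hle.
move=> k.
have : eta k - eta (k + m0)%N <= e / m0%:R * (H (k + m0)%N - H k).
  have D0 : 0 <= e / m0%:R * (H (k + m0)%N - H k).
    by rewrite mulr_ge0 ?(ltW em0)// subr_ge0 Hle// leq_addr.
  rewrite mulrBr in D0 *; rewrite /eta /Num.max.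
  by case: ltP => ?; case: ltP => ?; lra.
move=> /(ler_wpM2l (ltW (den k))); rewrite addrAC => /le_trans; apply.
rewrite addrAC.
have := ler_wpM2l (ltW em0) (Hadd k m0) => /(ler_wpM2l (ltW (den k))) /le_trans; apply.
rewrite /h le_eqVlt; apply/orP; left; apply/eqP; field.
by rewrite !gt_eqF.
Qed.

Section Bounded.
Variables (R : realType) (nu : probability nat R) (rho : R).
Hypothesis rho0 : 0 < rho.
Variables (d : nat) (A : nat -> R) (mu b : R) (m0 : nat).
Hypothesis A0 : forall j, 0 < A j.
Hypothesis Ad : rho * geo rho d * A d <= 1.
Hypothesis m00 : (0 < m0)%N.
Hypothesis muE : Ex nu (fun m => (minn m m0)%:R%:E) = mu%:E.
Hypothesis b01 : 0 <= b <= 1.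
Hypothesis Adrift : forall j, (j < d)%N ->
  rho * A j < mu * geo rho j * (A j + A j.+1) + b.

Variables (eta : nat -> R) (M1 : nat) (e : R).
Hypothesis eta01 : forall k, 0 <= eta k <= 1.
Hypothesis eta0 : eta 0%N = 1.
Hypothesis eta_le : forall k l, (k <= l)%N -> eta l <= eta k.
Hypothesis etaM : forall k, (M1 <= k)%N -> eta k = 0.
Hypothesis eta_slow :
  forall k, (rho + k%:R + m0%:R) * (eta k - eta (k + m0)%N) <= e.
Hypothesis e0 : 0 < e.
Hypothesis e1 : forall j, (j < d)%N -> e * A j <= A j.+1.
Hypothesis e2 : forall j, (j < d)%N -> e * A j <= mu * A j.+1.
Hypothesis e3 : forall j, (j < d)%N ->
  e * (geo rho j * A j) <= mu * geo rho j * (A j + A j.+1) + b - rho * A j.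

(* The weight of a vertex vanishes once it has [M1] children, so that children of
   larger index need not be followed, except up to [m0] of those that are born in
   the step in which [M1] is reached. *)
Let al : pred nat := fun i => (i < M1 + m0)%N.

(* A vertex of depth [d] only carries weight as long as it is childless, that is,
   in the truncated walk, as long as it has not been entered. *)
Let Phi (l k : nat) : R :=
  if (l < d)%N then A l * ((rho + k%:R) * eta k)
  else if l == d then (if k == 0%N then rho * A d else 0) else 0.

Let F c v := potential rho al Phi d.+1 c v.

Let Phi0 l : (l <= d)%N -> Phi l 0 = rho * A l.
Proof.
rewrite /Phi leq_eqVlt => /predU1P[->|->]; first by rewrite ltnn !eqxx.
by rewrite eta0 addr0 mulr1 mulrC.
Qed.

Let Phi_ge0 l k : 0 <= Phi l k.
Proof.
have /andP[ek _] := eta01 k; have r0 := ltW rho0.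
rewrite /Phi; case: ifP => _; first by rewrite !mulr_ge0 ?addr_ge0 ?(ltW (A0 _)).
by case: ifP => // _; case: ifP => // _; rewrite mulr_ge0 // ltW.
Qed.

Let F_ge0 c v : 0 <= F c v.
Proof. by apply: potential_ge0. Qed.

Let gain_lt c v m : (size v < d)%N ->
  gain rho al Phi d.+1 c v m =
  Phi (size v) (c v + m)%N - Phi (size v) (c v) +
  A (size v).+1 * (\sum_(i < m | al (c v + i)%N) 1).
Proof. by move=> vd; rewrite /gain ltnS vd Phi0// mulrA mulVf ?gt_eqF// mul1r. Qed.

(** The energy of a vertex never decreases by the creation of children: what
    the cut-off removes is less than the energy of the newborn child. *)
Let gain_mono c v m n : (size v < d)%N -> (m <= n)%N ->
  gain rho al Phi d.+1 c v m <= gain rho al Phi d.+1 c v n.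
Proof.
move=> vd /subnK <-; elim: (n - m)%N => [|k IH]; first by rewrite add0n.
rewrite addSn; apply: le_trans IH _; rewrite !gain_lt//.
set j := size v in vd *; set q := (k + m)%N; set K := (c v + q)%N.
rewrite [in leRHS]big_mkcond big_ord_recr/= -big_mkcond/= addnS -/K.
set s := \sum_(_ < _ | _) _.
suff : 0 <= Phi j K.+1 - Phi j K + A j.+1 * (if al K then 1 else 0).
  by set x := Phi j K.+1; set y := Phi j K; set z := (if _ then _ else _); lra.
rewrite /Phi vd -/j; case: ifPn => [_|]; last first.
  rewrite -leqNgt => MK; have MK' : (M1 <= K)%N by apply: leq_trans MK; rewrite leq_addr.
  by rewrite (etaM MK') (etaM (leqW MK')) !mulr0 subrr addr0.
have /andP[es0 _] := eta01 K.+1.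
have esk : eta K.+1 <= eta K by exact: eta_le.
have eKm : eta (K + m0)%N <= eta K.+1 by apply: eta_le; rewrite -addn1 leq_add2l.
have slow : (rho + K%:R) * (eta K - eta K.+1) <= e.
  apply: le_trans (eta_slow K); apply: ler_pM; rewrite ?subr_ge0 ?lerD2l ?lerN2 ?lerDl//.
  by rewrite addr_ge0// ltW.
have := e1 vd; rewrite -[K.+1%:R]natr1.
have := ler_wpM2l (ltW (A0 j)) slow; have := mulr_ge0 (ltW (A0 j)) es0; nra.
Qed.

Let energy_depth_d c u : size u = d -> c u != 0%N ->
  energy rho al (fun l => Phi (d + l)%N) 1 (below u c) = 0.
Proof.
move=> ud cu; rewrite /= addn0 /Phi ltnn eqxx /below cats0 (negbTE cu) add0r.
by rewrite big1 ?mulr0.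
Qed.

(** Sending the walk back from a fresh vertex of depth [d] costs its energy and
    the share of its ancestors, at most 1 in all by the choice of [A d]. *)
Let F_mark c v i : good c (rcons v i) -> size (rcons v i) = d ->
  F c (rcons v i) <= 1 + F (grow c (rcons v i) 1) v.
Proof.
move=> cu ud; have sv : (size v).+1 = d by rewrite -ud size_rcons.
have := potential_rcons rho al Phi d.+1 (grow c (rcons v i) 1) v i.
have -> : (d.+1 - (size v).+1 = 1)%N by rewrite sv subSnn.
have -> : (fun l => Phi (size v + l).+1) = (fun l => Phi (d + l)%N).
  by apply/funext => l; rewrite -sv addSn.
rewrite energy_depth_d ?grow_same ?addn1// if_same addr0 => FE.
rewrite /F -FE potential_grow// /gain ud ltnn mulr0 mul0r addr0 /Phi ltnn eqxx.
rewrite addn1 sub0r; case: ifP => _; last by rewrite addr0 lerDr.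
set f := potential _ _ _ _ _ _; have := Ad; have := geo_ge1 rho0 d.
by case: ifP => _; nra.
Qed.

Let F_entered c v i : size (rcons v i) = d -> c (rcons v i) != 0%N ->
  F c (rcons v i) = F c v.
Proof.
move=> ud cu; have sv : (size v).+1 = d by rewrite -ud size_rcons.
rewrite /F potential_rcons.
have -> : (d.+1 - (size v).+1 = 1)%N by rewrite sv subSnn.
have -> : (fun l => Phi (size v + l).+1) = (fun l => Phi (d + l)%N).
  by apply/funext => l; rewrite -sv addSn.
by rewrite energy_depth_d// if_same addr0.
Qed.

Let next c v m : R := F c v +
  (if active al d.+1 v then
     geo rho (size v) * gain rho al Phi d.+1 c v m -
       rho * Phi (size v) (c v + m)%N / ((c v + m)%:R + rho)
   else 0).

Let F_step c v : good c v ->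
  Kop nu rho c v (fun c' => (if v is [::] then 0 else F c' (father v))%:E)
    (fun c' i => (F c' (rcons v i))%:E) = Ex nu (fun m => (next c v m)%:E).
Proof.
move=> cv; rewrite (KopE nu rho _ _ (fun c' => if v is [::] then 0 else F c' (father v))).
apply: eq_Ex => m /=; congr EFin.
rewrite /F potential_jump// mulrBl mulrAC mulfV ?mul1r; last first.
  by rewrite gt_eqF// Kden_gt0.
rewrite potential_grow// grow_same /next -addrA; congr (_ + _).
by case: ifP => _; rewrite ?mul0r ?subr0.
Qed.

Let next_ge0 c v m : good c v -> 0 <= next c v m.
Proof.
move=> cv; have -> : next c v m = (rho * (if v is [::] then 0 else F (grow c v m) (father v)) +
    \sum_(i < grow c v m v) F (grow c v m) (rcons v i)) / ((grow c v m v)%:R + rho).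
  rewrite /F potential_jump// mulrBl mulrAC mulfV ?mul1r; last first.
    by rewrite gt_eqF// Kden_gt0.
  rewrite potential_grow// grow_same /next -addrA; congr (_ + _).
  by case: ifP => _; rewrite ?mul0r ?subr0.
rewrite divr_ge0 ?(ltW (Kden_gt0 rho0 _))// addr_ge0 ?sumr_ge0//.
by rewrite mulr_ge0 ?(ltW rho0)//; case: (v).
Qed.

(** If [v] has at least [M1] children it carries no weight and there is nothing
    to lose. Otherwise a jump loses at most [rho * A j * eta], and [m] births bring
    about [geo * (A j * eta + A j.+1) * m], so that the drift interpolates between
    the assumed one, at [eta = 1], and a gain, at [eta = 0]. *)
Let F_drift c v : good c v -> (size v < d)%N ->
  ((F c v)%:E <= b%:E + Kop nu rho c v
    (fun c' => (if v is [::] then 0 else F c' (father v))%:E)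
    (fun c' i => (F c' (rcons v i))%:E))%E.
Proof.
move=> cv vd; rewrite F_step//; have /andP[b0 _] := b01.
have FEx : ((F c v)%:E <= Ex nu (fun m => (next c v m)%:E))%E ->
    ((F c v)%:E <= b%:E + Ex nu (fun m => (next c v m)%:E))%E.
  by move=> /le_trans; apply; rewrite leeDr// lee_fin.
have [|cM] := leqP M1 (c v).
  move=> Mc; apply: FEx; rewrite -[leLHS](Ex_cst nu); apply: Ex_le => m.
    by rewrite lee_fin.
  rewrite lee_fin /next lerDl; case: ifP => // _.
  have := gain_mono c vd (leq0n m); rewrite gain_lt// big_ord0 mulr0 addr0 addn0 subrr.
  rewrite /Phi vd (@etaM (c v + m)%N) ?(leq_trans Mc) ?leq_addr// !mulr0 mul0r subr0 => ?.
  by rewrite mulr_ge0// (le_trans ler01)// geo_ge1.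
case: (boolP (active al d.+1 v)) => [act|inact]; last first.
  apply: FEx; rewrite -[leLHS](Ex_cst nu); apply: Ex_le => m; rewrite ?lee_fin//.
  by rewrite /next (negbTE inact) addr0.
set j := size v in vd *; set K := c v in cM *.
have /andP[ek0 ek1] := eta01 K; have g1 := geo_ge1 rho0 j; set g := geo rho j in g1 *.
have g0 : 0 <= g by apply: le_trans g1.
pose al' := g * (A j * eta K + A j.+1); pose be := g * (A j * e) + rho * (A j * eta K).
have Aj := ltW (A0 j); have Aj1 := ltW (A0 j.+1).
have al0 : 0 <= al' by rewrite mulr_ge0// addr_ge0// mulr_ge0.
have be0 : 0 <= be by rewrite addr_ge0 ?mulr_ge0// ltW.
have bal : be - b <= al' * mu.
  have h2 := ler_wpM2l g0 (e2 vd); have h3 := e3 vd; rewrite -/g in h3.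
  have : (1 - eta K) * (g * (mu * A j.+1 - e * A j) + b) +
     eta K * (mu * g * (A j + A j.+1) + b - rho * A j - e * (g * A j)) >= 0.
    have h4 : 0 <= g * (mu * A j.+1 - e * A j) + b by lra.
    have h5 : 0 <= mu * g * (A j + A j.+1) + b - rho * A j - e * (g * A j) by lra.
    by rewrite addr_ge0// mulr_ge0// subr_ge0.
  rewrite /al' /be; lra.
have low m : F c v + al' * (minn m m0)%:R - be <= next c v m.
  rewrite /next act -/j -/g -/K -[leLHS]addrA lerD2l.
  set m' := minn m m0; have m'm : (m' <= m)%N by rewrite geq_minl.
  have m'm0 : (m' <= m0)%N by rewrite geq_minr.
  have G : A j * ((rho + (K + m')%:R) * eta (K + m')%N) - A j * ((rho + K%:R) * eta K) +
      A j.+1 * m'%:R <= gain rho al Phi d.+1 c v m.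
    apply: le_trans (gain_mono c vd m'm); rewrite gain_lt// /Phi vd -/j -/K lerD2l.
    rewrite ler_wpM2l// (eq_bigl xpredT) ?sumr_const ?card_ord//.
    move=> i; have im := ltn_ord i; rewrite /al -/K.
    by apply: (@leq_trans (M1 + m')%N); [rewrite -addnS leq_add// ltnW|rewrite leq_add2l].
  have P : rho * Phi j (K + m)%N / ((K + m)%:R + rho) <= rho * (A j * eta K).
    rewrite /Phi vd ler_pdivrMr ?Kden_gt0// -!mulrA ler_wpM2l ?(ltW rho0)// ler_wpM2l//.
    by rewrite mulrC (addrC rho) ler_wpM2r ?addr_ge0 ?(ltW rho0)// eta_le ?leq_addr.
  have S : (rho + (K + m')%:R) * eta (K + m')%N >= (rho + (K + m')%:R) * eta K - e.
    have h1 : eta (K + m0)%N <= eta (K + m')%N by apply: eta_le; rewrite leq_add2l.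
    have h2 : (rho + (K + m')%:R) * (eta K - eta (K + m')%N) <= e.
      apply: le_trans (eta_slow K); apply: ler_pM.
      - by rewrite addr_ge0// ltW.
      - by rewrite subr_ge0 eta_le ?leq_addr.
      - by rewrite natrD addrA lerD2l ler_nat.
      - by rewrite lerD2l lerN2.
    lra.
  apply: le_trans (lerB (ler_wpM2l g0 G) P).
  have := ler_wpM2l g0 (ler_wpM2l Aj S); rewrite natrD /al' /be; lra.
rewrite -(@leeD2rE _ be%:E)// -addeA.
have -> : (Ex nu (fun m => (next c v m)%:E) + be%:E =
    Ex nu (fun m => (next c v m + be)%:E))%E.
  under [RHS]eq_Ex do rewrite EFinD.
  by rewrite ExD ?Ex_cst// => m; rewrite lee_fin// next_ge0.
apply: (@le_trans _ _ (b%:E + Ex nu (fun m => (F c v + al' * (minn m m0)%:R)%:E))%E).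
  rewrite (Ex_affine _ _ _ muE)// -!EFinD lee_fin; lra.
rewrite leeD2l//; apply: Ex_le => m; rewrite lee_fin.
  exact: addr_ge0 (F_ge0 _ _) (mulr_ge0 al0 (ler0n _ _)).
by have := low m; lra.
Qed.

Let upE c v : (if v is [::] then 0%E else (F c (father v))%:E) =
  (if v is [::] then 0 else F c (father v))%:E.
Proof. by case: v. Qed.

Let F_trunc c v : good c v -> (size v < d)%N ->
  ((F c v)%:E <= b%:E + Kop nu rho c v
    (fun c' => if v is [::] then 0 else (F c' (father v))%:E)
    (fun c' i => let u := rcons v i in
       if (size u < d)%N then (F c' u)%:E
       else if c' u == 0%N then 1 + (F (grow c' u 1) v)%:E
       else (F c' v)%:E))%E.
Proof.
move=> cv vd; apply: le_trans (F_drift cv vd) _; rewrite leeD2l//.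
apply: Kop_le => //.
- by move=> c'; rewrite lee_fin; case: (v).
- by move=> c' i; rewrite lee_fin.
- by move=> m; rewrite upE.
move=> m i im /=; case: ltnP => // dv.
have ud : size (rcons v i) = d by apply/eqP; rewrite eqn_leq dv size_rcons vd.
case: eqP => [c0|/eqP c0]; last by rewrite F_entered.
rewrite -EFinD lee_fin F_mark//; apply: good_rcons; first exact: good_grow.
by rewrite grow_same.
Qed.

(** The walk that is not truncated may lose the weight of a vertex of depth [d],
    along with its share in the energies of the ancestors, at most 1 in all. *)
Let F_real c v : good c v ->
  ((F c v)%:E <= 1 + Kop nu rho c v
    (fun c' => if v is [::] then 0 else (F c' (father v))%:E)
    (fun c' i => (F c' (rcons v i))%:E))%E.
Proof.
move=> cv; have -> : (fun c' => if v is [::] then 0%E else (F c' (father v))%:E) =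
    (fun c' => (if v is [::] then 0 else F c' (father v))%:E).
  by apply/funext => c'; rewrite upE.
have [vd|dv] := ltnP (size v) d.
  apply: le_trans (F_drift cv vd) _; rewrite leeD2r// lee_fin.
  by case/andP: b01.
rewrite F_step//.
have -> : (1 + Ex nu (fun m => (next c v m)%:E) =
    Ex nu (fun m => (1 + next c v m)%:E))%E.
  under [RHS]eq_Ex do rewrite EFinD.
  by rewrite ExD ?Ex_cst// => m; rewrite lee_fin// next_ge0.
rewrite -[leLHS](Ex_cst nu); apply: Ex_le => m; first by rewrite lee_fin.
rewrite lee_fin /next addrCA lerDl; case: ifP => [/andP[_ dv']|_]; last by rewrite addr0.
have vE : size v = d by apply/eqP; rewrite eqn_leq dv -ltnS dv'.
rewrite /gain vE ltnn mulr0 mul0r addr0 /Phi ltnn eqxx addn_eq0.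
have := geo_ge1 rho0 d; have := Ad; have := A0 d; have := rho0.
set g := geo rho d => r0 ad Adm g1.
have rA0 : 0 <= rho * A d by rewrite mulr_ge0// ltW.
have rA1 : rho * A d <= 1.
  by apply: le_trans Adm; rewrite mulrAC ler_peMr.
case: eqP => [->|_] /=; last by rewrite subrr !mulr0 mul0r subrr addr0.
case: eqP => [->|_] /=.
  by rewrite add0n add0r subrr mulr0 sub0r mulrAC mulfV ?gt_eqF// mul1r subr_ge0.
by rewrite mulr0 mul0r subr0 sub0r mulrN subr_ge0 mulrCA mulrA.
Qed.

Let F_bound : exists2 C : R, 0 <= C & forall c v, F c v <= C.
Proof.
have [K K0 PK] : exists2 K, 0 <= K & forall l k, Phi l k <= K.
  have AS l : (l < d)%N -> A l <= \sum_(i < d) A i.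
    move=> ld; rewrite (bigD1 (Ordinal ld))//= lerDl sumr_ge0// => i _.
    exact: ltW.
  have S0 : 0 <= \sum_(i < d) A i by rewrite sumr_ge0// => i _; exact: ltW.
  have rM : 0 <= rho + M1%:R by rewrite addr_ge0// ltW.
  have rA : 0 <= rho * A d by rewrite mulr_ge0// ltW.
  exists ((\sum_(i < d) A i) * (rho + M1%:R) + rho * A d).
    exact: addr_ge0 (mulr_ge0 S0 rM) rA.
  move=> l k; rewrite /Phi; case: ifP => [ld|_].
    rewrite -[leLHS]addr0 lerD//; have [kM|Mk] := ltnP k M1; last first.
      by rewrite etaM// !mulr0 mulr_ge0.
    have /andP[ek0 ek1] := eta01 k.
    have rk : 0 <= rho + k%:R by rewrite addr_ge0// ltW.
    apply: ler_pM => //; rewrite ?mulr_ge0 ?(ltW (A0 _)) ?AS//.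
    by rewrite -[leRHS]mulr1 ler_pM// lerD2l ler_nat ltnW.
  have SM : 0 <= (\sum_(i < d) A i) * (rho + M1%:R) by rewrite mulr_ge0.
  case: ifP => _; last by rewrite addr_ge0.
  by case: ifP => _; rewrite ?addr_ge0// lerDr.
have [C C0 FC] := @potential_le _ _ rho0 al (M1 + m0)%N K d.+1 K0 (fun i => id).
exists C => // c v; apply: FC => l k; by rewrite Phi_ge0 PK.
Qed.

Lemma bounded_functional_aux : exists (F : counts -> vertex -> R) (C : R), [/\ 0 <= C,
  forall c v, 0 <= F c v <= C, F no_counts [::] = rho * A 0%N,
  forall c v, good c v -> (size v < d)%N ->
    ((F c v)%:E <= b%:E + Kop nu rho c v
      (fun c' => if v is [::] then 0 else (F c' (father v))%:E)
      (fun c' i => let u := rcons v i in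
         if (size u < d)%N then (F c' u)%:E
         else if c' u == 0%N then 1 + (F (grow c' u 1) v)%:E
         else (F c' v)%:E))%E &
  forall c v, good c v ->
    ((F c v)%:E <= 1 + Kop nu rho c v
      (fun c' => if v is [::] then 0 else (F c' (father v))%:E)
      (fun c' i => (F c' (rcons v i))%:E))%E].
Proof.
have [C C0 FC] := F_bound; exists F, C; split.
- exact: C0.
- by move=> c v; rewrite F_ge0 FC.
- by rewrite /F potential_nil /= big_ord0 mulr0 addr0 Phi0.
- exact: F_trunc.
- exact: F_real.
Qed.

End Bounded.

(** The potential with the weight [A l * (rho + k) * eta k] at depth [l < d] is
    bounded, and so slow a cut-off [eta] exists that it keeps the strict
    inequality assumed of [A], in which [b] is the loss tolerated per step.
    Births are counted up to [m0], so that an infinite mean is covered as well. *)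
Lemma bounded_functional (R : realType) (nu : probability nat R) (rho : R)
    (d : nat) (A : nat -> R) (mu b : R) (m0 : nat) :
  0 < rho -> (forall j, 0 < A j) -> rho * geo rho d * A d <= 1 ->
  (0 < m0)%N -> Ex nu (fun m => (minn m m0)%:R%:E) = mu%:E -> 0 < mu ->
  0 <= b <= 1 ->
  (forall j, (j < d)%N -> rho * A j < mu * geo rho j * (A j + A j.+1) + b) ->
  exists (F : counts -> vertex -> R) (C : R), [/\ 0 <= C,
    forall c v, 0 <= F c v <= C, F no_counts [::] = rho * A 0%N,
    forall c v, good c v -> (size v < d)%N ->
      ((F c v)%:E <= b%:E + Kop nu rho c v
        (fun c' => if v is [::] then 0 else (F c' (father v))%:E)
        (fun c' i => let u := rcons v i in
           if (size u < d)%N then (F c' u)%:E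
           else if c' u == 0%N then 1 + (F (grow c' u 1) v)%:E
           else (F c' v)%:E))%E &
    forall c v, good c v ->
      ((F c v)%:E <= 1 + Kop nu rho c v
        (fun c' => if v is [::] then 0 else (F c' (father v))%:E)
        (fun c' i => (F c' (rcons v i))%:E))%E].
Proof.
move=> rho0 A0 Ad m00 muE mu0 b01 drift.
have gj j : 0 < geo rho j by apply: lt_le_trans (geo_ge1 rho0 j).
pose f j := Num.min (A j.+1 / A j) (Num.min (mu * A j.+1 / A j)
  ((mu * geo rho j * (A j + A j.+1) + b - rho * A j) / (geo rho j * A j))).
have [j jd|e e0 ef] := @finite_min_gt0 _ f d.
  rewrite !lt_min !divr_gt0 ?mulr_gt0//=.
  by rewrite subr_gt0 drift.
have [eta [M [eta01 eta0 eta_le etaM slow]]] := slow_cutoff rho0 e0 m00.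
apply: (@bounded_functional_aux R nu rho rho0 d A mu b m0 A0 Ad m00 muE b01
  eta M e) => // j jd; have := ef _ jd; rewrite !le_min => /and3P[].
- by move=> h _ _; rewrite -ler_pdivlMr.
- by move=> _ h _; rewrite -ler_pdivlMr.
- by move=> _ _ h; rewrite -ler_pdivlMr ?mulr_gt0.
Qed.

(** * Choice of the weights *)

Section Weights.
Variable R : realType.

Lemma expr_small (q e : R) : 0 < q < 1 -> 0 < e ->
  exists J, forall j, (J <= j)%N -> q ^+ j <= e.
Proof.
move=> /andP[q0 q1] e0; pose h := q^-1 - 1.
have h0 : 0 < h by rewrite subr_gt0 invf_gt1.
have bern j : 1 + j%:R * h <= (1 + h) ^+ j.
  elim: j => [|j IH]; first by rewrite mul0r addr0 expr0.
  have hj : 0 <= j%:R * h by rewrite mulr_ge0// ltW.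
  have h1 : 0 <= 1 + h by rewrite addr_ge0// ltW.
  by rewrite exprS; have := ler_wpM2l h1 IH; rewrite -natr1; nra.
have := archi_boundP (normr_ge0 (e^-1 / h)); set J := Num.bound _ => JP.
exists J => j Jj.
have -> : q = (1 + h)^-1 by rewrite /h addrC subrK invrK.
have h1 : 0 < 1 + h by rewrite addr_gt0.
rewrite exprVn -[e]invrK lef_pV2 ?posrE ?invr_gt0 ?exprn_gt0//.
apply: le_trans (bern j); apply: (@le_trans _ _ (j%:R * h)); last by rewrite lerDr.
rewrite -ler_pdivrMr//; apply: le_trans (ler_norm _) _.
by apply: le_trans (ltW JP) _; rewrite ler_nat.
Qed.

Lemma geo_closed (rho : R) j : rho != 0 -> (rho - 1) * geo rho j = rho - rho^-1 ^+ j.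
Proof.
move=> r0; elim: j => [|j IH]; first by rewrite geo0 mulr1 expr0.
by rewrite geoS mulrDr IH exprS; field.
Qed.

Lemma geo_ge (rho : R) j : 0 < rho <= 1 -> j.+1%:R <= geo rho j.
Proof.
move=> /andP[r0 r1]; elim: j => [|j IH]; first by rewrite geo0.
by rewrite geoS -natr1 lerD// exprn_ege1// invf_ge1.
Qed.

(** The asymptotic ratio of consecutive weights is [(rho - 1) / mu - 1] when
    [1 < rho], and eventually negative when [rho <= 1]. *)
Lemma supercritical_ratio (rho mu : R) : 0 < rho -> 0 < mu -> rho < 1 + 2 * mu ->
  exists J, exists2 q : R, 0 < q < 1 & forall j, (J <= j)%N ->
    (rho / (mu * geo rho j) - 1) * (geo rho j.+1 / geo rho j) < q.
Proof.
move=> rho0 mu0 sup.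
have g0 j : 0 < geo rho j by apply: lt_le_trans (geo_ge1 rho0 j).
have [r1|r1] := leP rho 1.
  have := archi_boundP (normr_ge0 (rho / mu)); set J := Num.bound _ => JP.
  exists J, 2^-1; first by rewrite invr_gt0 invf_lt1// ltr0n ltr1n.
  move=> j Jj; apply: (@le_lt_trans _ _ 0); last by rewrite invr_gt0.
  rewrite mulr_le0_ge0// ?divr_ge0 ?(ltW (g0 _))// subr_le0.
  rewrite ler_pdivrMr ?mulr_gt0// mul1r mulrC -ler_pdivrMr//.
  apply: le_trans (ler_norm _) _; apply: le_trans (ltW JP) _.
  apply: le_trans (geo_ge j _); last by rewrite rho0.
  by rewrite ler_nat ltnW.
pose D := (rho - 1) / mu - 1.
have D1 : D < 1 by rewrite ltrBlDr ltr_pdivrMr//; lra.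
have Dm1 : -1 < D by rewrite ltrBDl subrr divr_gt0// subr_gt0.
pose B := 1 + 2 * (rho / mu).
have rm0 : 0 < rho / mu by rewrite divr_gt0.
have B0 : 0 < B by rewrite /B; lra.
pose e := Num.min 1 ((1 - D) / (2 * B)).
have e0 : 0 < e by rewrite lt_min ltr01 divr_gt0 ?mulr_gt0// subr_gt0.
have rq : 0 < rho^-1 < 1 by rewrite invr_gt0 rho0 invf_lt1.
have [J JP] := expr_small rq e0.
exists J, (Num.max 2^-1 ((3 + D) / 4)).
  apply/andP; split; first by rewrite lt_max invr_gt0 ltr0n.
  by rewrite gt_max invf_lt1 ?ltr0n// ltr1n /= ltr_pdivrMr//; lra.
move=> j Jj; rewrite lt_max; apply/orP; right.
have r01 : 0 < rho - 1 by rewrite subr_gt0.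
have geq := geo_closed j (lt0r_neq0 rho0).
have := JP _ Jj; set y := rho^-1 ^+ j in geq * => ye.
have y0 : 0 < y by rewrite exprn_gt0// invr_gt0.
have y1 : y <= 1 by apply: le_trans ye _; rewrite ge_min lexx.
have ry : 0 < rho - y by lra.
have gE : geo rho j = (rho - y) / (rho - 1).
  by rewrite -geq mulrC mulKf// gt_eqF.
pose x := (rho - 1) * y / (rho * (rho - y)).
have xE : (geo rho j)^-1 = 1 - rho^-1 + x.
  by rewrite gE invf_div /x; field; rewrite !gt_eqF.
have x0 : 0 <= x by rewrite divr_ge0 ?mulr_ge0// ltW.
have xe : x <= e.
  apply: le_trans ye; rewrite /x ler_pdivrMr ?mulr_gt0// mulrC ler_wpM2l ?(ltW y0)//.
  by have := rho0; nra.
have -> : (rho / (mu * geo rho j) - 1) * (geo rho j.+1 / geo rho j) =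
    (D + rho / mu * x) * (1 + x).
  rewrite geoS1 [(1 + _) / _]mulrDl mulfK ?gt_eqF// mul1r invfM mulrA xE /D.
  by congr (_ * _); [field; rewrite !gt_eqF|ring].
have e1 : e <= 1 by rewrite ge_min lexx.
have eB : e * B <= (1 - D) / 2.
  rewrite -ler_pdivlMr// ge_min; apply/orP; right.
  by rewrite invfM mulrA.
have xB : x * B <= (1 - D) / 2 by apply: le_trans eB; rewrite ler_wpM2r// ltW.
have : (D + rho / mu * x) * (1 + x) <= D + x * B.
  have -> : (D + rho / mu * x) * (1 + x) = D + x * (D + rho / mu + rho / mu * x) by ring.
  rewrite lerD2l ler_wpM2l// /B.
  have : rho / mu * x <= rho / mu by rewrite -[leRHS]mulr1 ler_wpM2l ?(ltW rm0)// (le_trans xe).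
  lra.
lra.
Qed.

(** In the limiting case of equality, the drift inequality is a recursion whose
    factors are those of [supercritical_ratio], up to the factors [geo]: hence
    [A j * geo rho j] may decrease like a geometric sequence, and the condition on
    [A d] is met at a large depth [d] after normalisation. *)
Lemma supercritical_weights (rho mu : R) : 0 < rho -> 0 < mu -> rho < 1 + 2 * mu ->
  exists2 d, (0 < d)%N & exists A : nat -> R,
    [/\ forall j, 0 < A j, rho * geo rho d * A d <= 1, 1 < rho * A 0%N &
        forall j, (j < d)%N -> rho * A j < mu * geo rho j * (A j + A j.+1)].
Proof.
move=> rho0 mu0 sup.
have g0 j : 0 < geo rho j by apply: lt_le_trans (geo_ge1 rho0 j).
have [J [q /andP[q0 q1] Hq]] := supercritical_ratio rho0 mu0 sup.
pose th j := rho / (mu * geo rho j) - 1.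
pose t j := if (j < J)%N then `|th j| + 1 else q * (geo rho j / geo rho j.+1).
have t0 j : 0 < t j.
  by rewrite /t; case: ifP => _; rewrite ?ltr_wpDl// mulr_gt0// divr_gt0.
have tth j : th j < t j.
  rewrite /t; case: ltnP => [_|Jj]; first by rewrite (le_lt_trans (ler_norm _))// ltrDl.
  have := Hq _ Jj; rewrite -/(th j) -(ltr_pM2r (divr_gt0 (g0 j) (g0 j.+1))).
  by rewrite -mulrA (_ : _ / _ * (_ / _) = 1) ?mulr1//; field; rewrite !gt_eqF.
pose a j := \prod_(i < j) t i.
have aS j : a j.+1 = a j * t j by rewrite /a big_ord_recr.
have a0 j : 0 < a j by rewrite /a prodr_gt0// => i _.
have aJ n : a (J + n)%N * geo rho (J + n) = a J * geo rho J * q ^+ n.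
  elim: n => [|n IH]; first by rewrite addn0 expr0 mulr1.
  rewrite addnS aS /t ltnNge leq_addr/= exprSr [RHS]mulrA -IH.
  by field; rewrite gt_eqF.
have e0 : 0 < (a J * geo rho J * 2)^-1 by rewrite invr_gt0 !mulr_gt0.
have q01 : 0 < q < 1 by rewrite q0.
have [n nP] := expr_small q01 e0.
pose d := (J + n.+1)%N.
have ad : a d * geo rho d < 1.
  rewrite aJ; have := nP n.+1 (leqnSn _).
  rewrite -(ler_pM2l (mulr_gt0 (a0 J) (g0 J))) => /le_lt_trans; apply.
  by rewrite invfM mulrA mulfV ?gt_eqF ?mulr_gt0// mul1r invf_lt1 ?ltr1n.
exists d; first by rewrite /d addnS.
exists (fun j => a j / (rho * (geo rho d * a d))); split.
- by move=> j; rewrite divr_gt0 ?mulr_gt0.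
- by rewrite le_eqVlt; apply/orP; left; apply/eqP; field; rewrite !gt_eqF.
- rewrite /a big_ord0 -/(a d) mul1r invfM mulrA mulfV ?gt_eqF// mul1r.
  by rewrite invf_gt1 ?mulr_gt0// mulrC.
move=> j jd; rewrite -mulrDl !mulrA ltr_pM2r ?invr_gt0 ?mulr_gt0//.
rewrite aS -[X in _ < _ * (X + _)]mulr1 -mulrDr mulrCA mulrC ltr_pM2l//.
rewrite mulrC -ltr_pdivrMr ?mulr_gt0// -ltrBlDl; exact: tth.
Qed.

(** At criticality the solutions of the recursion are nearly stationary; thanks
    to the term 1 they may be multiplied by a linear function of small slope, and
    so descend from any height over a long enough range of depths. *)
Lemma critical_weights (M L : R) : 0 < M -> let rho := 1 + 2 * M in
  exists d, exists A : nat -> R,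
    [/\ forall j, 0 < A j, rho * geo rho d * A d <= 1, L < rho * A 0%N &
        forall j, (j < d)%N -> rho * A j < M * geo rho j * (A j + A j.+1) + 1].
Proof.
move=> M0 rho; have rho1 : 1 < rho by rewrite ltrDl mulr_gt0.
have rho0 : 0 < rho by apply: lt_trans rho1.
have M2 : 2 * M = rho - 1 by rewrite /rho addrC addKr.
have g1 j := geo_ge1 rho0 j.
have g0 j : 0 < geo rho j by apply: lt_le_trans (g1 j).
pose q := rho^-1.
have q0 : 0 < q by rewrite invr_gt0.
have q1 : q < 1 by rewrite invf_lt1.
have geq j : 2 * (M * geo rho j) = rho - q ^+ j.
  by rewrite mulrA M2 geo_closed// gt_eqF.
have qj j : 0 < q ^+ j <= 1.
  by rewrite exprn_gt0//= exprn_ile1// ltW.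
pose th j := rho / (M * geo rho j) - 1.
have thE j : M * geo rho j * th j = rho - M * geo rho j.
  by rewrite /th mulrBr mulr1 mulrCA mulfV ?mulr1// gt_eqF// mulr_gt0.
pose be := 2 / (rho - 1).
have be0 : 0 < be by rewrite divr_gt0// subr_gt0.
have th1 j : 0 < th j <= 1 + be * q ^+ j.
  have /andP[a0 a1] := qj j; have := geq j; have := thE j.
  set g := M * geo rho j; set y := q ^+ j in a0 a1 *; set t := th j => tE gE.
  have gy : 2 * g * t = rho + y by rewrite -mulrA tE; lra.
  have ry : 0 < rho - y by lra.
  have -> : t = (rho + y) / (rho - y) by rewrite -gy gE mulrAC mulfV ?mul1r// gt_eqF.
  rewrite divr_gt0//=; last by lra.
  rewrite ler_pdivrMr// /be mulrDl mul1r.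
  have : 2 * y <= 2 / (rho - 1) * y * (rho - y).
    have h : 1 <= (rho - y) / (rho - 1) by rewrite ler_pdivlMr ?subr_gt0// mul1r; lra.
    have y2 : 0 <= 2 * y by rewrite mulr_ge0// ltW.
    have := ler_wpM2l y2 h; lra.
  lra.
pose a j := \prod_(i < j) th i.
have aS j : a j.+1 = a j * th j by rewrite /a big_ord_recr.
have a0 j : 0 < a j.
  by rewrite /a prodr_gt0// => i _; case/andP: (th1 i).
pose ainf := expR (be / (1 - q)).
have aj j : a j <= ainf.
  have -> : a j <= ainf = (a j <= expR (be / (1 - q))) by [].
  have : a j <= expR (be * \sum_(i < j) q ^+ i).
    elim: j => [|j IH]; first by rewrite /a !big_ord0 mulr0 expR0.
    rewrite aS big_ord_recr/= (mulrDr be) expRD; apply: ler_pM => //; first exact: ltW.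
      by case/andP: (th1 j) => /ltW.
    by case/andP: (th1 j) => _ /le_trans; apply; exact: expR_ge1Dx.
  move=> /le_trans; apply; rewrite ler_expR ler_wpM2l ?(ltW be0)//.
  rewrite -[leRHS]mul1r ler_pdivlMr ?subr_gt0// mulrC -opprB mulNr -subrX1 opprB gerBl.
  by case/andP: (qj j) => /ltW.
have ai0 : 0 < ainf by exact: expR_gt0.
have gle j : geo rho j <= rho / (rho - 1).
  rewrite ler_pdivlMr ?subr_gt0// mulrC geo_closed ?gt_eqF// gerBl.
  by case/andP: (qj j) => /ltW.
pose k := (rho * ainf * (2 + rho / (rho - 1)))^-1.
have rr0 : 0 < rho / (rho - 1) by rewrite divr_gt0// subr_gt0.
have k0 : 0 < k by rewrite invr_gt0 !mulr_gt0// addr_gt0.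
have kE : k * (rho * ainf * (2 + rho / (rho - 1))) = 1.
  by rewrite mulVf// gt_eqF// !mulr_gt0// addr_gt0.
have rk0 : 0 < rho * k by rewrite mulr_gt0.
have := archi_boundP (normr_ge0 (L / (rho * k))); set d := Num.bound _ => dP.
exists d, (fun j => a j * (k * (d - j).+1%:R)); split.
- by move=> j; rewrite !mulr_gt0.
- rewrite subnn mulr1 -kE.
  have -> : rho * geo rho d * (a d * k) = k * (rho * a d * geo rho d) by ring.
  rewrite ler_wpM2l ?(ltW k0)// ler_pM ?mulr_ge0 ?(ltW (g0 _)) ?(ltW (a0 _)) ?(ltW rho0)//.
    by rewrite ler_wpM2l// ltW.
  by rewrite (le_trans (gle d))// lerDr.
- rewrite /a big_ord0 mul1r subn0 mulrA -ltr_pdivrMl// mulrC.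
  by apply: le_lt_trans (ler_norm _) _; apply: lt_trans dP _; rewrite ltr_nat.
move=> j jd.
have -> : (d - j).+1 = (d - j.+1).+2 by rewrite subnSK.
set l := (d - j.+1)%N; rewrite aS -[l.+2%:R]natr1.
have -> : M * geo rho j * (a j * (k * (l.+1%:R + 1)) + a j * th j * (k * l.+1%:R)) =
  M * geo rho j * a j * (k * (l.+1%:R + 1)) + a j * (M * geo rho j * th j) * (k * l.+1%:R) by ring.
rewrite thE.
suff : (rho - M * geo rho j) * a j * k < 1 by lra.
have : rho * ainf * k < 1.
  have Xk : 0 < rho * ainf * k by rewrite !mulr_gt0.
  have := mulr_gt0 Xk rr0; have := kE; set r := rho / (rho - 1); lra.
apply: le_lt_trans; rewrite ler_wpM2r ?(ltW k0)//.
apply: ler_pM => //; [|exact: ltW|by rewrite gerBl mulr_ge0 ?(ltW M0) ?(ltW (g0 _))].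
by have := geq j; have /andP[] := qj j; lra.
Qed.

End Weights.

(** The mean of a truncation is a real number even when the mean is infinite, and
    preserves the strict inequalities in which it replaces the mean. *)
Lemma truncated_mean (R : realType) (nu : probability nat R) (x : R) :
  0 <= x -> (x%:E < mean nu)%E ->
  exists2 m0, (0 < m0)%N & exists2 mu : R, x < mu &
    Ex nu (fun m => (minn m m0)%:R%:E) = mu%:E.
Proof.
move=> x0 xM.
have [n nx] : exists n, (x%:E < \sum_(0 <= k < n) k%:R%:E * nu [set k])%E.
  apply: contrapT => /forallNP H; move: xM; apply/negP; rewrite -leNgt.
  apply: lime_le; first by apply: is_cvg_nneseries => k _ _; rewrite mule_ge0// lee_fin.
  by near=> k; rewrite leNgt; apply/negP; exact: H.
have n0 : (0 < n)%N.
  by case: n nx => //; rewrite big_geq// lte_fin ltNge x0.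
exists n => //.
have Ege : (x%:E < Ex nu (fun m => (minn m n)%:R%:E))%E.
  apply: lt_le_trans nx _.
  rewrite /Ex; apply: le_trans (nneseries_lim_ge n _); last first.
    by move=> k _ _; rewrite mule_ge0// lee_fin.
  rewrite !big_mkord; apply: lee_sum => k _; rewrite muleC.
  by rewrite (minn_idPl (ltnW (ltn_ord k))).
have Ele : (Ex nu (fun m => (minn m n)%:R%:E) <= n%:R%:E)%E.
  rewrite -(Ex_cst nu); apply: Ex_le => m; first by rewrite lee_fin.
  by rewrite lee_fin ler_nat geq_minr.
have E0 : (0 <= Ex nu (fun m => (minn m n)%:R%:E))%E by apply: ltW; apply: le_lt_trans Ege; rewrite lee_fin.
have [mu _ muE] := between_EFin E0 Ele.
by exists mu => //; rewrite -lte_fin -muE.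
Unshelve. all: by end_near.
Qed.

(** * Escape probability and critical functional *)

Section Corollaries.
Variables (R : realType) (nu : probability nat R) (rho : R).
Hypothesis rho0 : 0 < rho.
Hypothesis hnu : (nu [set 0%N] < 1)%E.

Definition birth_prob : R := fine (Ex nu (fun m => (0 < m)%N%:R%:E)).

Lemma birth_probE : Ex nu (fun m => (0 < m)%N%:R%:E) = birth_prob%:E.
Proof.
rewrite /birth_prob fineK// fin_real//.
have E0 : (0 <= Ex nu (fun m => (0 < m)%N%:R%:E))%E.
  by apply: Ex_ge0 => m; rewrite lee_fin.
rewrite (lt_le_trans (ltNyr 0) E0) (@le_lt_trans _ _ 1%E) ?ltry//.
by apply: Ex_le1 => m; rewrite lee_fin//; case: (0 < m)%N.
Qed.

Lemma birth_prob_gt0 : 0 < birth_prob.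
Proof.
have : (1 = nu [set 0%N] + birth_prob%:E)%E.
  rewrite -(Ex1 nu) -birth_probE.
  have -> : nu [set 0%N] = Ex nu (fun m => (m == 0)%N%:R%:E).
    rewrite /Ex (nneseriesD1 (n := 0%N))//=; last first.
      by move=> k _; rewrite mule_ge0// lee_fin.
    by rewrite mule1 eseries0 ?adde0// => k _ /negbTE /= ->; rewrite mule0.
  rewrite -ExD; last 2 first.
  - by move=> m; rewrite lee_fin.
  - by move=> m; rewrite lee_fin.
  by apply: eq_Ex => -[|m] /=; rewrite ?adde0 ?add0e.
move=> e; rewrite -lte_fin; move: hnu; rewrite {1}e -[X in (X < _)%E -> _]adde0.
by rewrite lteD2lE// ge0_fin_numE// (lt_trans hnu) ?ltry.
Qed.

Lemma birth_prob_le_mean : (birth_prob%:E <= mean nu)%E.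
Proof.
rewrite -birth_probE -Ex_mean; apply: Ex_le => m; rewrite lee_fin//.
by rewrite ler_nat; case: m.
Qed.

Lemma mean_gt0 : (0 < mean nu)%E.
Proof. by apply: lt_le_trans birth_prob_le_mean; rewrite lte_fin birth_prob_gt0. Qed.

(** The truncated walk makes more than one fresh passage on average, up to the
    event of no exit, as its potential starts from [rho * A 0 > 1]. *)
Lemma transient_escape : (rho%:E < 1 + 2%:E * mean nu)%E ->
  exists2 s : R, 0 <= s < 1 &
    forall n, (exit_prob nu rho n no_counts [::] <= s%:E)%E.
Proof.
move=> sup; pose x := Num.max 0 ((rho - 1) / 2).
have x0 : 0 <= x by rewrite le_max lexx.
have xM : (x%:E < mean nu)%E.
  have [h|h] := leP ((rho - 1) / 2) 0; first by rewrite /x (max_idPl h) mean_gt0.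
  rewrite /x (max_idPr (ltW h)).
  have := mean_gt0; case: (mean nu) sup => [M| |] sup // _; last by rewrite ltry.
  by move: sup; rewrite -EFinM -EFinD !lte_fin => ?; lra.
have [m0 m00 [mu xmu muE]] := truncated_mean x0 xM.
have mu0 : 0 < mu by apply: le_lt_trans xmu.
have sup' : rho < 1 + 2 * mu.
  have h : (rho - 1) / 2 < mu by apply: le_lt_trans xmu; rewrite le_max lexx orbT.
  lra.
have [d d0 [A [A0 Ad rA drift]]] := supercritical_weights rho0 mu0 sup'.
have b01 : 0 <= (0 : R) <= 1 by rewrite lexx ler01.
have [j jd|F [C [C0 FC Fo FT _]]] := bounded_functional rho0 A0 Ad m00 muE mu0 b01.
  by rewrite addr0 drift.
apply: (@escape R nu rho rho0 d F C) => //; last by rewrite Fo.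
by move=> c v cv vd; have := FT c v cv vd; rewrite add0e.
Qed.

(** A potential that starts above [L], loses at most 1 per step and vanishes at
    the exit shows that the mean exit time is larger than [L], provided that it is
    bounded. *)
Lemma null_functional (M L : R) : mean nu = M%:E -> rho = 1 + 2 * M ->
  exists (F : counts -> vertex -> R) (C : R), [/\ 0 <= C,
    forall c v, 0 <= F c v <= C, L < F no_counts [::] &
    forall c v, good c v ->
      ((F c v)%:E <= 1 + Kop nu rho c v
        (fun c' => if v is [::] then 0 else (F c' (father v))%:E)
        (fun c' i => (F c' (rcons v i))%:E))%E].
Proof.
move=> ME rE; have M0 : 0 < M by rewrite -lte_fin -ME mean_gt0.
have [d [A]] := critical_weights L M0; rewrite /= -rE => -[A0 Ad LA drift].
have g0 j : 0 < geo rho j by apply: lt_le_trans (geo_ge1 rho0 j).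
pose f j := (M * geo rho j * (A j + A j.+1) + 1 - rho * A j) / (geo rho j * (A j + A j.+1)).
have gA j : 0 < geo rho j * (A j + A j.+1) by rewrite mulr_gt0// addr_gt0.
have [j jd|e e0 ef] := @finite_min_gt0 _ f d.
  by rewrite divr_gt0// subr_gt0 drift.
pose x := Num.max 0 (M - e / 2).
have x0 : 0 <= x by rewrite le_max lexx.
have xM : (x%:E < mean nu)%E.
  by rewrite ME lte_fin gt_max M0 ltrBlDr ltrDl divr_gt0.
have [m0 m00 [mu xmu muE]] := truncated_mean x0 xM.
have mu0 : 0 < mu by apply: le_lt_trans xmu.
have muM : M - e / 2 < mu by apply: le_lt_trans xmu; rewrite le_max lexx orbT.
have b01 : 0 <= (1 : R) <= 1 by rewrite lexx ler01.
have [j jd|F [C [C0 FC Fo _ FR]]] := bounded_functional rho0 A0 Ad m00 muE mu0 b01.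
  have := ef j jd; rewrite ler_pdivlMr// => h.
  have : (M - e / 2) * (geo rho j * (A j + A j.+1)) < mu * (geo rho j * (A j + A j.+1)).
    by rewrite ltr_pM2r.
  have := mulr_gt0 e0 (gA j).
  by set G := geo rho j * (A j + A j.+1) in h *; rewrite -!mulrA -/G in h *; lra.
by exists F, C; split => //; rewrite Fo.
Qed.

End Corollaries.

(** * The trees of the process *)

Section Trees.

Definition counted (t : tree) (k : counts) : Prop :=
  forall u i, (rcons u i \in t) = (i < k u)%N.

Lemma card_children t k u : counted t k -> #|` children t u| = k u.
Proof.
move=> tk; have -> : children t u = [fset rcons u i | i in iota 0 (k u)]%fset.
  apply/fsetP => z; rewrite !inE /=; apply/idP/imfsetP => /=.
    move=> /and3P[zt z0 /eqP zu]; case/lastP: z zt z0 zu => // z i zt _.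
    rewrite father_rcons => zu; exists i; last by rewrite zu.
    by rewrite mem_iota add0n /= -zu -tk.
  move=> [i]; rewrite mem_iota add0n /= => ik ->.
  by rewrite tk ik rcons_neq_nil father_rcons eqxx.
rewrite card_imfset/=; last by move=> i j /rcons_inj[].
by rewrite /= undup_id ?iota_uniq// size_iota.
Qed.

Lemma counted_attach t k v m : counted t k ->
  counted (attach t v m) (grow k v m).
Proof.
move=> tk u i; rewrite /attach !inE (card_children _ tk) tk.
apply/orP/idP => [[iu|/imfsetP[j /=]]|].
- exact: leq_trans (grow_ge _ _ _ _).
- rewrite mem_iota add0n /= => jm /rcons_inj[-> ->].
  by rewrite grow_same ltn_add2l.
rewrite /grow; case: eqP => [->|_]; last by left.
have [iv _|vi ivm] := ltnP i (k v); first by left.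
right; apply/imfsetP; exists (i - k v)%N; last by rewrite subnKC.
by rewrite /= mem_iota add0n /= ltn_subLR.
Qed.

Lemma counted_init : counted [fset tree_root]%fset no_counts.
Proof. by move=> u i; rewrite !inE ltn0; apply/negbTE/rcons_neq_nil. Qed.

End Trees.

(** * The walk as a Markov chain on states *)

Section Fibers.
Context d (Omega : measurableType d) (R : realType).
Variable P : probability Omega R.
Variable N : Omega -> nat.
Hypothesis mN : forall k, measurable (N @^-1` [set k]).

Lemma fibers_measurable (A : set Omega) :
  (forall w w', N w = N w' -> A w -> A w') -> measurable A.
Proof.
move=> AN; have -> : A = \bigcup_(k in [set k | exists2 w, A w & N w = k]) (N @^-1` [set k]).
  apply/seteqP; split => [w Aw|w [k [w' Aw' <-] /= Nw]]; last exact: (AN w').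
  by exists (N w) => //; exists w.
exact: bigcup_measurable.
Qed.

Lemma fibers_measurable_fun d' (U : measurableType d') (f : Omega -> U) D :
  measurable D ->
  (forall w w', N w = N w' -> f w = f w') -> measurable_fun D f.
Proof.
move=> mD fN _ B mB; apply: measurableI => //; apply: fibers_measurable => w w' ww'.
by rewrite /preimage /= (fN w w').
Qed.

Lemma integral_fibers D (f : Omega -> \bar R) : measurable D ->
  measurable_fun D f -> (forall w, 0 <= f w)%E ->
  (\int[P]_(w in D) f w = \sum_(0 <= k <oo) \int[P]_(w in D `&` N @^-1` [set k]) f w)%E.
Proof.
move=> mD mf f0.
have DE : \bigcup_k (D `&` N @^-1` [set k]) = D.
  by apply/seteqP; split => [w [k _ []]//|w Dw]; exists (N w).
rewrite -[in LHS]DE ge0_integral_bigcup//.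
- by move=> k; apply: measurableI.
- by rewrite DE.
- apply/trivIsetP => i j _ _ ij; apply/seteqP; split => // w [[_ /= wi] [_ /= wj]].
  by move: ij; rewrite -wi -wj eqxx.
Qed.

End Fibers.

Section Process.
Context d (Omega : measurableType d) (R : realType).
Variables (P : probability Omega R) (rho : R) (nu : probability nat R).
Variables (xi : nat -> Omega -> nat) (T : nat -> Omega -> tree).
Variables (S : nat -> Omega -> vertex).
Hypothesis rho0 : 0 < rho.
Hypothesis hTBRW : is_TBRW P rho nu xi T S.

Definition cnt (n : nat) (w : Omega) : counts := fun u => #|` children (T n w) u|.

Lemma counted_T n w : counted (T n w) (cnt n w).
Proof.
suff [k kT] : exists k, counted (T n w) k.
  move=> u i; rewrite /cnt (card_children _ kT); exact: kT.
elim: n => [|n [k IH]].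
  by exists no_counts; rewrite (T_init hTBRW); exact: counted_init.
by exists (grow k (S n w) (xi n w)); rewrite (T_next hTBRW); exact: counted_attach.
Qed.

Lemma cnt_init w : cnt 0 w = no_counts.
Proof.
apply/funext => u; rewrite /cnt (T_init hTBRW).
by rewrite (card_children _ counted_init).
Qed.

Lemma cnt_next n w : cnt n.+1 w = grow (cnt n w) (S n w) (xi n w).
Proof.
apply/funext => u; rewrite /cnt (T_next hTBRW).
by rewrite (card_children u (counted_attach _ _ (counted_T n w))).
Qed.

Lemma cnt_mono m n w u : (m <= n)%N -> (cnt m w u <= cnt n w u)%N.
Proof.
move=> /subnK <-; elim: (n - m)%N => [|k IH]; first by rewrite add0n.
apply: leq_trans IH _; rewrite addSn cnt_next; exact: grow_ge.
Qed.

(** The past takes countably many values, so that being known at time [n] can be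
    expressed pointwise; measurability then comes for free. *)
Definition same_past n (w w' : Omega) : Prop :=
  forall i, (i <= n)%N -> T i w = T i w' /\ S i w = S i w'.

Definition adapted (U : Type) n (f : Omega -> U) : Prop :=
  forall w w', same_past n w w' -> f w = f w'.

Lemma same_pastS n w w' : same_past n.+1 w w' -> same_past n w w'.
Proof. by move=> h i ni; apply: h; apply: leqW. Qed.

Lemma same_past_sym n w w' : same_past n w w' -> same_past n w' w.
Proof. by move=> h i ni; have [-> ->] := h i ni. Qed.

Lemma adaptedS U n (f : Omega -> U) : adapted n f -> adapted n.+1 f.
Proof. by move=> h w w' /same_pastS; apply: h. Qed.

Lemma adapted_le U m n (f : Omega -> U) : (m <= n)%N -> adapted m f -> adapted n f.
Proof. by move=> mn h w w' ww'; apply: h => i im; apply: ww'; apply: leq_trans mn. Qed.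

Lemma adapted_S n : adapted n (S n).
Proof. by move=> w w' /(_ n (leqnn n))[]. Qed.

Lemma adapted_cnt n : adapted n (cnt n).
Proof. by move=> w w' /(_ n (leqnn n))[TE _]; apply/funext => u; rewrite /cnt TE. Qed.

Definition trajectory : countType := seq (tree * vertex).

Definition history n (w : Omega) : nat :=
  choice.pickle ([seq (T i w, S i w) | i <- iota 0 n.+1] : trajectory).

Lemma history_same_past n w w' : history n w = history n w' <-> same_past n w w'.
Proof.
split => [/(pcan_inj choice.pickleK) h i ni|h]; last first.
  rewrite /history; congr choice.pickle; apply/eq_in_map => i.
  by rewrite mem_iota ltnS => /= /h[-> ->].
have /eq_in_map : [seq (T i w, S i w) | i <- iota 0 n.+1] =
  [seq (T i w', S i w') | i <- iota 0 n.+1] by [].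
by move=> /(_ i); rewrite mem_iota add0n /= ltnS => /(_ ni) [-> ->].
Qed.

Lemma measurable_past n t s : measurable (past T S n t s).
Proof.
have -> : past T S n t s =
    \bigcap_i (if (i <= n)%N then T i @^-1` [set t i] `&` S i @^-1` [set s i] else setT).
  apply/seteqP; split => [w h i _|w h i ni].
    by case: ifP => // /h[].
  by have := h i I; rewrite ni => -[].
apply: bigcapT_measurable => i; case: ifP => // _; apply: measurableI.
  exact: measurable_T hTBRW _ _.
exact: measurable_S hTBRW _ _.
Qed.

Lemma history_fiber n w0 :
  history n @^-1` [set history n w0] = past T S n (T^~ w0) (S^~ w0).
Proof.
apply/seteqP; split => [w /= /history_same_past h i ni|w h].
  exact: h.
by apply/history_same_past => i ni; exact: h.
Qed.

Lemma measurable_history n k : measurable (history n @^-1` [set k]).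
Proof.
have [[w0 <-]|nk] := pselect (exists w0, history n w0 = k).
  by rewrite history_fiber; exact: measurable_past.
have -> : history n @^-1` [set k] = set0 by apply/seteqP; split => // w /= wk; apply: nk; exists w.
exact: measurable0.
Qed.

Lemma adapted_measurable n (A : set Omega) : adapted n A -> measurable A.
Proof.
move=> hA; apply: (fibers_measurable (measurable_history n)) => w w'.
by move=> /history_same_past /hA ->.
Qed.

Lemma adapted_measurable_fun n (f : Omega -> \bar R) D : measurable D ->
  adapted n f -> measurable_fun D f.
Proof.
move=> mD hf; apply: (fibers_measurable_fun (measurable_history n)) => // w w'.
by move=> /history_same_past /hf ->.
Qed.

Definition neighbours (c : counts) (v : vertex) : seq vertex :=
  father v :: [seq rcons v i | i <- iota 0 (c v)].

Lemma neighbours_uniq c v : uniq (neighbours c v).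
Proof.
rewrite /= map_inj_uniq ?iota_uniq ?andbT; last by move=> i j /rcons_inj[].
apply/negP => /mapP[i _ /(congr1 size)]; rewrite size_rcons size_father => e.
by have := leq_pred (size v); rewrite e ltnn.
Qed.

Lemma step_prob_father t k v : counted t k ->
  step_prob rho t v (father v) = rho / ((k v)%:R + rho).
Proof. by move=> tk; rewrite /step_prob eqxx (card_children _ tk). Qed.

Lemma step_prob_child t k v i : counted t k -> (i < k v)%N ->
  step_prob rho t v (rcons v i) = 1 / ((k v)%:R + rho).
Proof.
move=> tk ik; rewrite /step_prob (card_children _ tk) ifF; last first.
  apply/negbTE/eqP => /(congr1 size); rewrite size_rcons size_father => e.
  by have := leq_pred (size v); rewrite -e ltnn.
by rewrite !inE /= tk ik rcons_neq_nil father_rcons eqxx.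
Qed.

(** The kernel of the walk, acting on functions of the state: at the root the
    father step is the loop. *)
Definition walk_step (g : counts -> vertex -> \bar R) (c : counts) (v : vertex) : \bar R :=
  Kop nu rho c v (fun c' => g c' (father v)) (fun c' i => g c' (rcons v i)).

(** The candidates for [S n.+1] have total conditional probability 1, so that the
    integral over [B] is the sum over the neighbours. *)
Lemma integral_move (B : set Omega) (n : nat) (t : tree) (k : counts) (v : vertex)
    (g : vertex -> \bar R) : measurable B -> counted t k -> (forall u, 0 <= g u)%E ->
  (forall u, P (B `&` S n.+1 @^-1` [set u]) = (P B * (step_prob rho t v u)%:E))%E ->
  (\int[P]_(w in B) g (S n.+1 w) =
   P B * (((k v)%:R + rho)^-1%:E *
     (rho%:E * g (father v) + \sum_(i < k v) g (rcons v i))))%E.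
Proof.
move=> mB tk g0 hB.
have mS u : measurable (S n.+1 @^-1` [set u]) by exact: measurable_S hTBRW _ _.
have mBS u : measurable (B `&` S n.+1 @^-1` [set u]) by exact: measurableI.
pose L := neighbours k v.
pose D := \big[setU/set0]_(u <- L) (B `&` S n.+1 @^-1` [set u]).
have mD : measurable D by apply: bigsetU_measurable => u _; exact: mBS.
have DB : D `<=` B by rewrite /D -bigcup_seq => w [u _ []].
have tL : trivIset [set` L] (fun u => B `&` S n.+1 @^-1` [set u]).
  apply/trivIsetP => u u' _ _ uu'; apply/seteqP; split => // w [[_ /= wu] [_ /= wu']].
  by move: uu'; rewrite -wu -wu' eqxx.
have mgS E : measurable E -> measurable_fun E (fun w => g (S n.+1 w)).
  move=> mE; apply: (fibers_measurable_fun (N := fun w => choice.pickle (S n.+1 w))) => //.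
    move=> j; have [[u uj]|nj] := pselect (exists u : vertex, choice.pickle u = j).
      rewrite (_ : _ @^-1` _ = S n.+1 @^-1` [set u])//.
      apply/seteqP; split => w /=; last by move=> ->.
      by rewrite -uj => /(pcan_inj choice.pickleK).
    rewrite (_ : _ @^-1` _ = set0)//; apply/seteqP; split => // w /= e.
    by apply: nj; exists (S n.+1 w).
  by move=> w w' /(pcan_inj choice.pickleK) ->.
have PBfin : P B \is a fin_num by exact: fin_num_measure.
have PD : P D = P B.
  rewrite -[LHS]mul1e -integral_cst// ge0_integral_bigsetU//; last exact: neighbours_uniq.
  have h1 u : (\int[P]_(w in B `&` S n.+1 @^-1` [set u]) cst 1 w =
      P B * (step_prob rho t v u)%:E)%E.
    by rewrite integral_cst// mul1e; exact: hB.
  rewrite (eq_bigr (fun u => P B * (step_prob rho t v u)%:E))%E; last by move=> u _; exact: h1.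
  rewrite -ge0_sume_distrr; last first.
    move=> u _; rewrite lee_fin /step_prob; case: ifP => _.
      by rewrite divr_ge0 ?(ltW rho0)// addr_ge0// ltW.
    by case: ifP => _ //; rewrite divr_ge0// addr_ge0// ltW.
  rewrite sumEFin /L /neighbours big_cons (step_prob_father _ tk) big_map.
  rewrite (eq_big_seq (fun=> 1 / ((k v)%:R + rho))); last first.
    by move=> i; rewrite mem_iota add0n => /= ik; rewrite (step_prob_child tk).
  rewrite big_const_seq count_predT size_iota iter_addr_0 -[_ *+ _]mulr_natl.
  rewrite (_ : _ + _ = 1) ?mule1//.
  by field; rewrite gt_eqF// Kden_gt0.
have PBD : P (B `\` D) = 0%E.
  have -> : P (B `\` D) = (P B - P (B `&` D))%E.
    by apply: measureD => //; rewrite ltey_eq PBfin.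
  by rewrite (setIidr DB) PD subee.
rewrite (@ge0_negligible_integral _ _ _ _ B (B `\` D))//; last 2 first.
- exact: measurableD.
- exact: mgS.
rewrite setDD (setIidr DB) ge0_integral_bigsetU//; last 2 first.
- exact: neighbours_uniq.
- exact: mgS.
have iu u : (\int[P]_(w in B `&` S n.+1 @^-1` [set u]) g (S n.+1 w) =
    P B * ((step_prob rho t v u)%:E * g u))%E.
  rewrite (eq_integral (cst (g u))); last by move=> w; rewrite inE => -[_ /= ->].
  by rewrite integral_cst// [X in (_ * X)%E]hB muleC muleA.
under eq_bigr do rewrite iu.
rewrite /L /neighbours big_cons big_map (step_prob_father _ tk).
rewrite (eq_big_seq (fun i => P B * (((k v)%:R + rho)^-1%:E * g (rcons v i))))%E; last first.
  by move=> i; rewrite mem_iota add0n => /= ik; rewrite (step_prob_child tk)// mul1r.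
have s0 i : (0 <= ((k v)%:R + rho)^-1%:E * g (rcons v i))%E.
  by rewrite mule_ge0// Kinv_ge0.
rewrite -ge0_sume_distrr// -ge0_muleDr//; last 2 first.
- by rewrite mule_ge0// lee_fin divr_ge0 ?(ltW rho0)// ltW// Kden_gt0.
- by rewrite sume_ge0.
congr (_ * _)%E; rewrite -ge0_sume_distrr//.
rewrite -[iota 0 _]/(iota 0 (k v)) -[X in iota 0 X](subn0 (k v)) -/(index_iota 0 (k v)) big_mkord.
rewrite mulrC EFinM -muleA -ge0_muleDr ?sume_ge0//.
by rewrite mule_ge0 ?rhoE_ge0.
Qed.

Lemma walk_step_ge0 g c v : (forall c v, 0 <= g c v)%E -> (0 <= walk_step g c v)%E.
Proof. by move=> g0; apply: Kop_ge0. Qed.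

Lemma adapted_state n (U : Type) (phi : Omega -> counts -> vertex -> U) :
  adapted n phi -> adapted n (fun w => phi w (cnt n w) (S n w)).
Proof.
by move=> hphi w w' ww'; rewrite (hphi _ _ ww') (adapted_cnt ww') (adapted_S ww').
Qed.

Lemma adapted_step n (phi : Omega -> counts -> vertex -> \bar R) :
  adapted n phi -> adapted n (fun w => walk_step (phi w) (cnt n w) (S n w)).
Proof.
by move=> hphi w w' ww'; rewrite (hphi _ _ ww') (adapted_cnt ww') (adapted_S ww').
Qed.

(** On each fiber of the history up to time [n], only the births and the jump
    are random, and their conditional laws are those of [walk_step]. The function
    [phi] of the next state may depend on the past. *)
Lemma markov n (phi : Omega -> counts -> vertex -> \bar R) :
  adapted n phi -> (forall w c v, 0 <= phi w c v)%E ->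
  (\int[P]_w phi w (cnt n.+1 w) (S n.+1 w) =
   \int[P]_w walk_step (phi w) (cnt n w) (S n w))%E.
Proof.
move=> hphi phi0.
have mf1 D : measurable D -> measurable_fun D (fun w => phi w (cnt n.+1 w) (S n.+1 w)).
  move=> mD; apply: (@adapted_measurable_fun n.+1) => //.
  by apply: adapted_state; exact: adaptedS.
have mf2 D : measurable D -> measurable_fun D (fun w => walk_step (phi w) (cnt n w) (S n w)).
  by move=> mD; apply: (@adapted_measurable_fun n) => //; exact: adapted_step.
have w0 w : (0 <= walk_step (phi w) (cnt n w) (S n w))%E by apply: walk_step_ge0.
rewrite (integral_fibers P (measurable_history n))//; last exact: mf1.
rewrite [RHS](integral_fibers P (measurable_history n))//; last exact: mf2.
apply: eq_eseriesr => k _; rewrite setTI.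
have [[w1 <-]|nk] := pselect (exists w, history n w = k); last first.
  rewrite (_ : history n @^-1` [set k] = set0) ?integral_set0//.
  by apply/seteqP; split => // w /= wk; apply: nk; exists w.
have mA := measurable_history n (history n w1).
have AE := history_fiber n w1.
set A := history n @^-1` [set history n w1] in mA AE *.
have Aw w : A w -> same_past n w w1 by move=> /history_same_past.
rewrite [RHS](eq_integral (cst (walk_step (phi w1) (cnt n w1) (S n w1)))); last first.
  by move=> w; rewrite inE => /Aw; exact: adapted_step.
rewrite [RHS]integral_cst// muleC.
have mxi k' : measurable (xi n @^-1` [set k']) by exact: measurable_xi hTBRW _ _.
rewrite (integral_fibers P mxi)//; last exact: mf1.
rewrite /walk_step /Kop /Ex.
have PAfin : P A \is a fin_num by exact: fin_num_measure.
have PAE : P A = (fine (P A))%:E by rewrite fineK.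
rewrite [X in _ = (X * _)%E]PAE -nneseriesZl; last first.
  move=> m _; apply: mule_ge0 => //=; apply: mule_ge0; first exact: Kinv_ge0.
  by apply: adde_ge0; [rewrite mule_ge0 ?rhoE_ge0|exact: sume_ge0].
apply: eq_eseriesr => m _; rewrite -PAE.
set c' := grow _ _ _.
have mB : measurable (A `&` xi n @^-1` [set m]) by exact: measurableI.
rewrite (eq_integral (fun w => phi w1 c' (S n.+1 w))); last first.
  move=> w; rewrite inE => -[/Aw ww1 /= xm].
  by rewrite (hphi _ _ ww1) cnt_next (adapted_cnt ww1) (adapted_S ww1) xm.
have PB : (P (A `&` xi n @^-1` [set m]) = P A * nu [set m])%E.
  by rewrite AE; exact: (xi_law hTBRW).
rewrite (@integral_move _ n (attach (T n w1) (S n w1) m) c' (S n w1))//; first last.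
- by move=> u; rewrite AE; exact: (S_law hTBRW).
- by apply: counted_attach; exact: counted_T.
by rewrite [X in (X * _)%E]PB -muleA.
Qed.

Lemma markov_on n (H : set Omega) (phi : Omega -> counts -> vertex -> \bar R) :
  adapted n H -> adapted n phi -> (forall w c v, 0 <= phi w c v)%E ->
  (\int[P]_(w in H) phi w (cnt n.+1 w) (S n.+1 w) =
   \int[P]_(w in H) walk_step (phi w) (cnt n w) (S n w))%E.
Proof.
move=> hH hphi phi0; rewrite integral_mkcond [RHS]integral_mkcond.
pose phi' w := if w \in H then phi w else (fun _ _ => 0%E).
have -> : (fun w => phi w (cnt n.+1 w) (S n.+1 w)) \_ H =
    fun w => phi' w (cnt n.+1 w) (S n.+1 w).
  by apply/funext => w; rewrite /phi' patchE; case: ifP.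
rewrite markov; last 2 first.
- move=> w w' ww'; rewrite /phi' (hphi _ _ ww').
  have HE : (w \in H) = (w' \in H) by apply/idP/idP; rewrite !inE (hH _ _ ww').
  by rewrite HE.
- by move=> w c v; rewrite /phi'; case: ifP.
apply: eq_integral => w _; rewrite /phi' patchE; case: ifP => // _.
apply/eqP; rewrite eq_le; apply/andP; split; last by apply: walk_step_ge0.
rewrite -[leRHS](Kop_cst nu rho0 (cnt n w) (S n w)).
by apply: Kop_le => //.
Qed.

(** A jump to a vertex that is not a neighbour has probability 0; outside of
    these events, statements on the states hold along every path. *)
Definition proper : set Omega :=
  [set w | forall n, S n.+1 w \in neighbours (cnt n.+1 w) (S n w)].

Let misstep n : set Omega :=
  [set w | S n.+1 w \notin neighbours (cnt n.+1 w) (S n w)].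

Let adapted_misstep n : adapted n.+1 (misstep n).
Proof.
move=> w w' ww'; rewrite /misstep /=.
by rewrite (adapted_cnt ww') (adapted_S ww') (adapted_S (same_pastS ww')).
Qed.

Let misstep0 n : P (misstep n) = 0%E.
Proof.
have mM : measurable (misstep n) by exact: adapted_measurable (@adapted_misstep n).
have := @markov n (fun w c v => (v \notin neighbours c (S n w))%:R%:E).
have -> : (fun w => (S n.+1 w \notin neighbours (cnt n.+1 w) (S n w))%:R%:E) =
    (fun w => (\1_(misstep n) w)%:E) :> (Omega -> \bar R).
  apply/funext => w; rewrite indicE; congr (_%:R%:E); congr nat_of_bool.
  by apply/idP/idP; rewrite inE.
rewrite integral_indic// setIT => ->; last 2 first.
- by move=> w w' ww'; apply/funext => c; apply/funext => v; rewrite (adapted_S ww').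
- by move=> w c v; rewrite lee_fin.
rewrite integral0_eq// => w _.
apply/eqP; rewrite eq_le; apply/andP; split; last first.
  by apply: walk_step_ge0 => c v; rewrite lee_fin.
rewrite -[leRHS](Kop_cst nu rho0 (cnt n w) (S n w)); apply: Kop_le => //.
- by move=> m; rewrite /neighbours mem_head.
- move=> m i im; rewrite /neighbours in_cons map_f ?orbT//.
  by rewrite mem_iota add0n grow_same.
Qed.

Lemma proper_compl : ~` proper = \bigcup_n misstep n.
Proof.
apply/seteqP; split => [w /= /existsNP[n /negP nw]|w [n _ nw] /= h].
  by exists n.
by move: nw; rewrite /misstep /= h.
Qed.

Lemma measurable_proper : measurable proper.
Proof.
rewrite -(setCK proper) proper_compl; apply: measurableC.
apply: bigcup_measurable => n _; exact: adapted_measurable (@adapted_misstep n).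
Qed.

Lemma proper_ae : P (~` proper) = 0%E.
Proof.
apply: measure_negligible; first by apply: measurableC; exact: measurable_proper.
rewrite proper_compl; apply: negligible_bigcup => n; apply/negligibleP; last exact: misstep0.
exact: adapted_measurable (@adapted_misstep n).
Qed.

Lemma proper_good n w : proper w -> good (cnt n w) (S n w).
Proof.
move=> pw; elim: n => [|n IH].
  by rewrite cnt_init (S_init hTBRW); split.
have g : good (cnt n.+1 w) (S n w) by rewrite cnt_next; exact: good_grow.
have := pw n; rewrite /neighbours in_cons => /predU1P[->|/mapP[i ii ->]]; first exact: good_father.
by apply: good_rcons => //; move: ii; rewrite mem_iota add0n.
Qed.

Lemma proper_size n w : proper w -> (size (S n w) <= n)%N.
Proof.
move=> pw; elim: n => [|n IH]; first by rewrite (S_init hTBRW).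
have := pw n; rewrite /neighbours in_cons => /predU1P[->|/mapP[i _ ->]].
  by rewrite size_father (leq_trans (leq_pred _))// leqW.
by rewrite size_rcons.
Qed.

Lemma proper_depth n w u : proper w -> (n <= size u)%N -> cnt n w u = 0%N.
Proof.
move=> pw; elim: n => [|n IH] nu'; first by rewrite cnt_init.
rewrite cnt_next grow_other ?IH//; first exact: ltnW.
by apply: contraTneq nu' => ->; rewrite -leqNgt proper_size.
Qed.

Lemma le_integral_proper (Q : set Omega) (f g : Omega -> \bar R) n :
  measurable Q -> adapted n f -> adapted n g ->
  (forall w, 0 <= f w)%E -> (forall w, 0 <= g w)%E ->
  (forall w, proper w -> Q w -> f w <= g w)%E ->
  (\int[P]_(w in Q) f w <= \int[P]_(w in Q) g w)%E.
Proof.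
move=> mQ hf hg f0 g0 fg.
have mp := measurableC measurable_proper.
rewrite (@ge0_negligible_integral _ _ _ _ Q (~` proper))//; last 2 first.
- exact: adapted_measurable_fun hf.
- exact: proper_ae.
rewrite [leRHS](@ge0_negligible_integral _ _ _ _ Q (~` proper))//; last 2 first.
- exact: adapted_measurable_fun hg.
- exact: proper_ae.
have mD : measurable (Q `\` ~` proper) by exact: measurableD.
apply: ge0_le_integral => //.
- exact: adapted_measurable_fun hf.
- exact: adapted_measurable_fun hg.
- by move=> w [Qw /contrapT pw]; exact: fg.
Qed.

(** Optional stopping for a supermartingale with drift [- delta]: [Q n] is the
    event that the walk has not been stopped before time [n]. *)
Lemma super_drift (Q : nat -> set Omega)
    (f : nat -> Omega -> counts -> vertex -> \bar R) (delta : nat -> Omega -> \bar R)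
    (n0 : nat) :
  (forall n, adapted n (Q n)) -> (forall n, Q n.+1 `<=` Q n) ->
  (forall n, adapted n.-1 (f n)) -> (forall n, adapted n (delta n)) ->
  (forall n w c v, 0 <= f n w c v)%E -> (forall n w, 0 <= delta n w)%E ->
  (forall n w, (n0 <= n)%N -> proper w -> Q n w ->
     walk_step (f n.+1 w) (cnt n w) (S n w) + delta n w <= f n w (cnt n w) (S n w))%E ->
  forall m,
  (\sum_(i < m) \int[P]_(w in Q (n0 + i)%N) delta (n0 + i)%N w +
     \int[P]_(w in Q (n0 + m)%N) f (n0 + m)%N w (cnt (n0 + m) w) (S (n0 + m) w) <=
   \int[P]_(w in Q n0) f n0 w (cnt n0 w) (S n0 w))%E.
Proof.
move=> hQ QS hf hd f0 d0 step.
have mQ n : measurable (Q n) by exact: adapted_measurable (hQ n).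
have hf' n : adapted n (f n) by apply: adapted_le (hf n); exact: leq_pred.
have hfs n := adapted_state (hf' n).
elim=> [|m IH]; first by rewrite big_ord0 add0e addn0.
apply: le_trans IH; rewrite big_ord_recr/= -addeA leeD2l//.
set n := (n0 + m)%N; rewrite addnS -/n.
apply: (@le_trans _ _ (\int[P]_(w in Q n) delta n w +
    \int[P]_(w in Q n) f n.+1 w (cnt n.+1 w) (S n.+1 w))%E).
  rewrite leeD2l//; apply: ge0_subset_integral => //.
  exact: adapted_measurable_fun (hfs n.+1).
rewrite (markov_on (hQ n) (hf n.+1))// -ge0_integralD//; last 3 first.
- exact: adapted_measurable_fun (hd n).
- by move=> w _; exact: walk_step_ge0.
- apply: (@adapted_measurable_fun n) => //; exact: adapted_step (hf n.+1).
apply: (@le_integral_proper _ _ _ n) => //.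
- move=> w w' ww'; rewrite (hd n _ _ ww').
  by rewrite (adapted_step (hf n.+1) ww').
- by move=> w; rewrite adde_ge0// walk_step_ge0.
- by move=> w pw Qw; rewrite addeC step// leq_addr.
Qed.

End Process.

(** * Recurrence *)

Section Recurrence.
Context d (Omega : measurableType d) (R : realType).
Variables (P : probability Omega R) (rho : R) (nu : probability nat R).
Variables (xi : nat -> Omega -> nat) (T : nat -> Omega -> tree).
Variables (S : nat -> Omega -> vertex).
Hypothesis rho0 : 0 < rho.
Hypothesis hnu : (nu [set 0%N] < 1)%E.
Hypothesis hTBRW : is_TBRW P rho nu xi T S.

Notation cnt := (cnt T).
Notation adapted := (adapted T S).
Notation proper := (proper T S).

Lemma markov_bound (Q E : set Omega) (f : Omega -> \bar R) (a B : R) n :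
  adapted n Q -> adapted n E -> adapted n f -> (forall w, 0 <= f w)%E -> 0 < a ->
  E `<=` Q -> (forall w, proper w -> E w -> a%:E <= f w)%E ->
  (\int[P]_(w in Q) f w <= B%:E)%E -> (P E <= (B / a)%:E)%E.
Proof.
move=> hQ hE hf f0 a0 EQ af fB.
have mQ : measurable Q by exact: (adapted_measurable hTBRW hQ).
have mE : measurable E by exact: (adapted_measurable hTBRW hE).
have : (a%:E * P E <= B%:E)%E.
  apply: le_trans fB.
  rewrite -integral_cst//.
  apply: (@le_trans _ _ (\int[P]_(w in E) f w)%E).
    apply: (le_integral_proper rho0 hTBRW (n := n)) => //.
    by move=> w; rewrite lee_fin ltW.
  by apply: ge0_subset_integral => //; exact: (adapted_measurable_fun hTBRW _ hf).
have -> : P E = (fine (P E))%:E by rewrite fineK// fin_num_measure.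
by rewrite -EFinM !lee_fin ler_pdivlMr// mulrC.
Qed.

Notation same_past := (same_past T S).

Lemma adapted_set n (A : set Omega) :
  (forall w w', same_past n w w' -> A w -> A w') -> adapted n A.
Proof.
move=> h w w' ww'; apply/propext; split; first exact: h.
by apply: h; exact: same_past_sym.
Qed.

Lemma same_past_le m n w w' : (m <= n)%N -> same_past n w w' -> same_past m w w'.
Proof. by move=> mn h i im; apply: h; exact: leq_trans mn. Qed.

Lemma same_past_state n w w' : same_past n w w' -> cnt n w = cnt n w' /\ S n w = S n w'.
Proof. by move=> h; split; [exact: adapted_cnt h|exact: adapted_S h]. Qed.

Variable M : R.
Hypothesis meanM : mean nu = M%:E.
Hypothesis rec : 1 + 2 * M <= rho.

Let M0 : 0 < M.
Proof. by rewrite -lte_fin -meanM mean_gt0. Qed.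

Let rho1 : 1 < rho.
Proof. by apply: lt_le_trans rec; rewrite ltrDl mulr_gt0. Qed.

(** At the critical value [(rho - 1) * geo rho j = rho - rho^-j] leaves a drift of
    [- rho^-j]. The second argument of [lin] exceeds the depth of the tree at time
    [n] by enough for the values at times [n] and [n.+1] to be comparable. *)
Lemma lin_drift_rec n w : proper w -> S n w != [::] ->
  (walk_step rho nu (fun c v => (lin rho n.+3 c v)%:E) (cnt n w) (S n w) +
   (rho^-1 ^+ size (S n w))%:E <= (lin rho n.+2 (cnt n w) (S n w))%:E)%E.
Proof.
move=> pw S0; have sz := proper_size hTBRW n pw.
rewrite /walk_step (lin_drift rho0 meanM)//; last 2 first.
- exact: (proper_good hTBRW).
- by rewrite !ltnS ltnW.
rewrite -EFinD lee_fin /lin potential_fuel; last 2 first.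
- by move=> u nu'; apply: (proper_depth hTBRW pw); exact: ltnW.
- exact: leqW.
rewrite -addrA -addrA gerDl.
have := geo_closed (size (S n w)) (lt0r_neq0 rho0).
have := geo_ge0 rho0 (size (S n w)).
set g := geo _ _; set y := _ ^+ _ => g0 gE.
have : 2 * M * g <= (rho - 1) * g by rewrite ler_wpM2r//; have := rec; lra.
lra.
Qed.

Lemma summable_small (a : nat -> \bar R) (B e : R) : (forall n, 0 <= a n)%E ->
  (forall m, \sum_(i < m) a i <= B%:E)%E -> 0 < e -> exists n, (a n <= e%:E)%E.
Proof.
move=> a0 aB e0; apply: contrapT => /forallNP H.
have ea n : (e%:E <= a n)%E by rewrite ltW// ltNge; apply/negP/H.
have eB m : m%:R * e <= B.
  rewrite -lee_fin; apply: le_trans (aB m).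
  rewrite -[leLHS]/((m%:R * e)%:E) mulr_natl.
  have -> : (e *+ m)%:E = (\sum_(i < m) e%:E)%E.
    by rewrite sumEFin sumr_const card_ord.
  by apply: lee_sum => i _; exact: ea.
have := archi_boundP (normr_ge0 (B / e)); apply/negP; rewrite -leNgt.
by apply: le_trans (ler_norm _); rewrite ler_pdivlMr.
Qed.

(** The drift [- rho^-|v|] forces every bounded range of depths to be left,
    while the functional, which dominates the depth, stays bounded on average. *)
Lemma root_hit n0 : P [set w | forall j, (n0 <= j)%N -> S j w != [::]] = 0%E.
Proof.
set Never := [set w | _].
pose H (B : nat) := [set w | lin rho n0.+2 (cnt n0 w) (S n0 w) <= B%:R].
pose Q B n := [set w | (n0 <= n)%N ->
  H B w /\ forall j, (n0 <= j <= n)%N -> S j w != [::]].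
have hQ B n : adapted n (Q B n).
  apply: adapted_set => w w' ww' Qw nn; have [Hw Sw] := Qw nn; split.
    by rewrite /H /=; have [-> ->] := same_past_state (same_past_le nn (same_past_sym ww')).
  move=> j /[dup] jn /andP[_ /ww'[_ <-]]; exact: Sw.
have mQ B n : measurable (Q B n) by exact: (adapted_measurable hTBRW (hQ B n)).
pose f n (w : Omega) c v : \bar R := (lin rho n.+2 c v)%:E.
pose delta n w : \bar R := (rho^-1 ^+ size (S n w))%:E.
have f0 n w c v : (0 <= f n w c v)%E by rewrite lee_fin lin_ge0.
have d0 n w : (0 <= delta n w)%E by rewrite lee_fin exprn_ge0// invr_ge0 ltW.
have hd n : adapted n (delta n).
  by move=> w w' ww'; rewrite /delta (adapted_S ww').
have fB B : (\int[P]_(w in Q B n0) f n0 w (cnt n0 w) (S n0 w) <= B%:R%:E)%E.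
  apply: (@le_trans _ _ (\int[P]_(w in Q B n0) B%:R%:E)%E).
    apply: (le_integral_proper rho0 hTBRW (n := n0)) => //.
    - exact: (adapted_state (phi := f n0)).
    - by move=> w _ Qw; rewrite lee_fin; have [] := Qw (leqnn _).
  rewrite integral_cst// -[leRHS]mule1 lee_wpmul2l ?lee_fin//.
  exact: probability_le1.
have sum_le B m : (\sum_(i < m) \int[P]_(w in Q B (n0 + i)%N) delta (n0 + i)%N w +
     \int[P]_(w in Q B (n0 + m)%N) f (n0 + m)%N w (cnt (n0 + m) w) (S (n0 + m) w) <=
     B%:R%:E)%E.
  apply: le_trans (fB B).
  apply: (super_drift rho0 hTBRW (Q := Q B) (f := f) (delta := delta)) => //.
  - move=> n w Qw nn; have [Hw Sw] := Qw (leqW nn); split => // j /andP[j0 jn].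
    by apply: Sw; rewrite j0 leqW.
  - move=> n w nn pw Qw; apply: lin_drift_rec => //.
    by have [_] := Qw nn; apply; rewrite nn leqnn.
have mN : measurable Never.
  rewrite (_ : Never = \bigcap_(j in [set j | (n0 <= j)%N]) ~` (S j @^-1` [set [::]])).
    by apply: bigcap_measurableType => j _; apply: measurableC; exact: measurable_S hTBRW _ _.
  by apply/seteqP; split => w h j jn; apply/eqP/h.
have PB B L : (P (Never `&` H B) <= (B%:R / (rho * L.+1%:R))%:E)%E.
  apply/lee_addgt0Pr => e e0.
  pose E n := Q B n `&` [set w | (n0 <= n)%N /\ (size (S n w) <= L)%N].
  have hE n : adapted n (E n).
    by move=> w w' ww'; rewrite /E /setI /= (hQ B n _ _ ww') (adapted_S ww').
  have rL : 0 < rho^-1 ^+ L by rewrite exprn_gt0// invr_gt0.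
  have [n nE] : exists n, (P (E (n0 + n)%N) <= e%:E)%E.
    apply: (@summable_small (fun n => P (E (n0 + n)%N)) (B%:R / rho^-1 ^+ L) e) => // m.
    have h : (\sum_(i < m) (rho^-1 ^+ L)%:E * P (E (n0 + i)%N) <= B%:R%:E)%E.
      apply: le_trans (sum_le B m); rewrite -[leLHS]adde0; apply: leeD; last first.
        by apply: integral_ge0.
      apply: lee_sum => i _; have mE : measurable (E (n0 + i)%N).
        exact: (adapted_measurable hTBRW (hE _)).
      rewrite -integral_cst//.
      apply: (@le_trans _ _ (\int[P]_(w in E (n0 + i)%N) delta (n0 + i)%N w)%E).
        apply: (le_integral_proper rho0 hTBRW (n := (n0 + i)%N)) => //.
        + by move=> w; rewrite lee_fin ltW.
        + move=> w _ [_ [_ sL]]; rewrite lee_fin.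
          by rewrite ler_wiXn2l// ?invr_ge0 ?(ltW rho0)// invf_le1// ltW.
      apply: ge0_subset_integral => //; last by move=> w [].
      exact: (adapted_measurable_fun hTBRW _ (hd _)).
    rewrite -(@lee_pmul2l _ (rho^-1 ^+ L)%:E)// ?lte_fin//.
    rewrite ge0_sume_distrr// -EFinM mulrCA mulfV ?mulr1 ?gt_eqF//.
  pose E' := Q B (n0 + n)%N `&` [set w | (L < size (S (n0 + n)%N w))%N].
  have hE' : adapted (n0 + n) E'.
    by move=> w w' ww'; rewrite /E' /setI /= (hQ B _ _ _ ww') (adapted_S ww').
  have mE' : measurable E' by exact: (adapted_measurable hTBRW hE').
  have mE : measurable (E (n0 + n)%N) by exact: (adapted_measurable hTBRW (hE _)).
  have PE' : (P E' <= (B%:R / (rho * L.+1%:R))%:E)%E.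
    apply: (@markov_bound (Q B (n0 + n)%N) E'
      (fun w => f (n0 + n)%N w (cnt (n0 + n) w) (S (n0 + n) w)) _ _ (n0 + n)) => //.
    - exact: (adapted_state (phi := f (n0 + n)%N)).
    - by rewrite mulr_gt0.
    - by move=> w [].
    - move=> w pw [_ /= Lw]; rewrite lee_fin.
      apply: (@le_trans _ _ (rho * (size (S (n0 + n) w)).+1%:R)).
        by rewrite ler_wpM2l ?(ltW rho0)// ler_nat ltnS ltnW.
      apply: lin_ge => //; have := proper_size hTBRW (n0 + n) pw.
      by move=> /leq_ltn_trans; apply; exact: leqnSn.
    - apply: le_trans (sum_le B n); rewrite -[leLHS]add0e; apply: leeD => //.
      by apply: sume_ge0 => i _; apply: integral_ge0.
  apply: (@le_trans _ _ (P (E' `|` E (n0 + n)%N))).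
    apply: le_measure; rewrite ?inE.
    - apply: measurableI => //; apply: (adapted_measurable hTBRW (n := n0)) => w w' ww'.
      by rewrite /H /= (adapted_cnt ww') (adapted_S ww').
    - exact: measurableU.
    - move=> w [Nw Hw]; have Qw : Q B (n0 + n)%N w.
        by move=> _; split => // j /andP[j0 _]; exact: Nw.
      have [sL|Ls] := leqP (size (S (n0 + n) w)) L; [right|left]; split => //.
      by split => //; exact: leq_addr.
  apply: le_trans (measureU2 _ _ _) _ => //.
  by apply: leeD.
have PB0 B : P (Never `&` H B) = 0%E.
  apply/eqP; rewrite eq_le measure_ge0 andbT; apply/lee_addgt0Pr => e e0; rewrite add0e.
  have := archi_boundP (normr_ge0 (B%:R / (rho * e))); set L := Num.bound _ => hL.
  apply: le_trans (PB B L) _; rewrite lee_fin ler_pdivrMr ?mulr_gt0//.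
  rewrite mulrCA mulrA -ler_pdivrMl ?mulr_gt0// mulrC.
  apply: le_trans (ler_norm _) _; apply: le_trans (ltW hL) _.
  by rewrite ler_nat.
have NE : Never = \bigcup_B (Never `&` H B).
  apply/seteqP; split => [w Nw|w [B _ []]//].
  exists (Num.bound (lin rho n0.+2 (cnt n0 w) (S n0 w))) => //; split => //.
  by rewrite /H /=; apply/ltW/archi_boundP/lin_ge0.
apply: measure_negligible => //; rewrite NE; apply: negligible_bigcup => B.
apply/negligibleP; last exact: PB0.
apply: measurableI => //; apply: (adapted_measurable hTBRW (n := n0)) => w w' ww'.
by rewrite /H /= (adapted_cnt ww') (adapted_S ww').
Qed.

Lemma increasing_bound (F : nat -> set Omega) (c : \bar R) :
  (forall j, measurable (F j)) -> (forall j, F j `<=` F j.+1) ->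
  (forall j, P (F j) <= c)%E -> (P (\bigcup_j F j) <= c)%E.
Proof.
move=> mF FS Fc.
have Fm : {homo F : n m / (n <= m)%N >-> (n <= m)%O}.
  move=> n m /subnK <-; apply/subsetPset; elim: (m - n)%N => [|k IH]; first by rewrite add0n.
  by apply: subset_trans IH _; rewrite addSn; exact: FS.
have := nondecreasing_cvg_mu (mu := P) mF (bigcupT_measurable _ mF) Fm.
move=> /cvg_lim <- //; apply: lime_le.
  apply: ereal_nondecreasing_is_cvgn => n m nm; apply: le_measure; rewrite ?inE//.
  by apply/subsetPset; exact: Fm.
by apply: nearW => j; exact: Fc.
Qed.

Section Child.
Variables (u : vertex) (i : nat).
Let v := rcons u i.
Let b : R := (1 + M) ^+ 2.
Let g (c : counts) : R := b + ln ((c u)%:R + rho).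
Let f (c : counts) (x : vertex) : \bar R := if x == v then 0%E else (g c)%:E.
Let delta (c : counts) (x : vertex) : \bar R :=
  if x == u then (((c u)%:R + rho)^-1)%:E else 0%E.

Let b0 : 0 < b. Proof. by rewrite exprn_gt0// addr_gt0. Qed.

Let one_le k : (1 <= k%:R + rho :> R).
Proof. by rewrite (le_trans (ltW rho1))// lerDr. Qed.

Let g_ge0 c : 0 <= g c.
Proof. by rewrite addr_ge0 ?(ltW b0)// ln_ge0. Qed.

(** A given child of a vertex with [k] children is missed with probability
    [1 - 1 / (k + rho)]. With [Y = k + rho], the births raise the logarithm by at
    most [M / Y] on average, by concavity; for [b = (1 + M) ^ 2] the factor
    [1 - 1 / (Y + m)] takes away that much, and [1 / Y] more. *)
Let log_drift (Y : R) : 1 <= Y ->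
  (Ex nu (fun m => ((b + ln (Y + m%:R)) * (1 - (Y + m%:R)^-1))%:E) + (Y^-1)%:E
    <= (b + ln Y)%:E)%E.
Proof.
move=> Y1; have Y0 : 0 < Y by apply: lt_le_trans Y1.
have YM : 0 < Y + M by rewrite addr_gt0.
have lnY : 0 <= ln Y by exact: ln_ge0.
pose be := Y^-1 + b * ((Y + M)^-1) ^+ 2.
pose al := b + ln Y - b * ((Y + M)^-1 + M * ((Y + M)^-1) ^+ 2).
have be0 : 0 <= be.
  rewrite addr_ge0 ?invr_ge0 ?(ltW Y0)//.
  exact: mulr_ge0 (ltW b0) (sqr_ge0 _).
set z := (Y + M)^-1 in be al be0 *.
have z0 : 0 < z by rewrite invr_gt0.
have zE : z * (Y + M) = 1 by rewrite mulVf// gt_eqF.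
have al0 : 0 <= al.
  have : z + M * z ^+ 2 <= 1.
    have -> : z + M * z ^+ 2 = z ^+ 2 * (Y + 2 * M).
      have zz : z = z * (z * (Y + M)) by rewrite zE mulr1.
      by rewrite {1}zz; ring.
    rewrite [leRHS](_ : 1 = z ^+ 2 * (Y + M) ^+ 2); last by rewrite -exprMn zE expr1n.
    have Y1' : 0 <= Y - 1 by rewrite subr_ge0.
    rewrite ler_wpM2l ?sqr_ge0//.
    have := mulr_ge0 Y1' (ltW Y0); have := mulr_ge0 Y1' (ltW M0); have := sqr_ge0 M; lra.
  move=> h; have := ler_wpM2l (ltW b0) h; rewrite /al. lra.
apply: (@le_trans _ _ (Ex nu (fun m => (al + be * m%:R)%:E) + (Y^-1)%:E)%E).
  apply: leeD => //; apply: Ex_le => m.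
    have Ym1 : 1 <= Y + m%:R by rewrite ler_wpDr.
    rewrite lee_fin; apply: mulr_ge0; first by rewrite addr_ge0 ?(ltW b0) ?ln_ge0.
    by rewrite subr_ge0 invf_le1// (lt_le_trans _ Ym1).
  rewrite lee_fin; set m' : R := m%:R; have m0 : 0 <= m' by rewrite ler0n.
  have Ym : 0 < Y + m' by rewrite ltr_wpDr.
  have lnm : ln (Y + m') <= ln Y + m' * Y^-1.
    have -> : Y + m' = Y * (1 + m' * Y^-1) by rewrite mulrDr mulr1 mulrCA mulfV ?mulr1// gt_eqF.
    have my : 0 <= m' * Y^-1 by rewrite mulr_ge0// invr_ge0 ltW.
    by rewrite lnM ?posrE ?ltr_wpDr// lerD2l le_ln1Dx// (lt_le_trans _ my)// ltrN10.
  set x := (Y + m')^-1.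
  have x0 : 0 < x by rewrite invr_gt0.
  have xE : x * (Y + m') = 1 by rewrite mulVf// gt_eqF.
  have tang : z - (m' - M) * z ^+ 2 <= x.
    have : 0 <= x * ((Y + m') * z - 1) ^+ 2 by rewrite mulr_ge0 ?sqr_ge0// ltW.
    have -> : x * ((Y + m') * z - 1) ^+ 2 =
       (x * (Y + m')) * ((Y + m') * z ^+ 2 - 2 * z) + x by ring.
    rewrite xE mul1r => h.
    have -> : z - (m' - M) * z ^+ 2 = 2 * z - (Y + m') * z ^+ 2 + z * (z * (Y + M) - 1) by ring.
    rewrite zE subrr mulr0 addr0; lra.
  have lnx : 0 <= ln (Y + m') * x by rewrite mulr_ge0 ?(ltW x0)// ln_ge0// ler_wpDr.
  have := ler_wpM2l (ltW b0) tang; rewrite /al /be; lra.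
rewrite (Ex_affine_mean meanM)// -EFinD lee_fin.
have zY : (1 + M) * Y^-1 <= b * z.
  rewrite /b expr2 -mulrA ler_wpM2l ?addr_ge0 ?(ltW M0)//.
  rewrite ler_pdivlMr// mulrDr mulVf ?gt_eqF// lerD2l ler_piMl ?(ltW M0)//.
  by rewrite invf_le1.
rewrite /al /be; lra.
Qed.

Let child_drift c x : x != v -> (i < c u)%N ->
  (walk_step rho nu f c x + delta c x <= f c x)%E.
Proof.
move=> xv iu; rewrite /f (negbTE xv) /delta /walk_step.
have [->|xu] := eqVneq x u; last first.
  rewrite adde0 -[leRHS](Kop_cst nu rho0 c x); apply: Kop_le => //.
  - by move=> c'; case: ifP => // _; rewrite lee_fin.
  - by move=> c' j; case: ifP => // _; rewrite lee_fin.
  - move=> m; rewrite /g grow_other; last by rewrite eq_sym.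
    by case: ifP => // _; rewrite lee_fin; exact: g_ge0.
  - move=> m j _; rewrite /g grow_other; last by rewrite eq_sym.
    by case: ifP => // _; rewrite lee_fin; exact: g_ge0.
rewrite /g; apply: le_trans (log_drift (one_le (c u))); apply: leeD => //.
apply: Ex_le => m /=.
  have if_ge0 (t : bool) c' : (0 <= if t then 0 else (b + ln ((c' u)%:R + rho))%:E)%E.
    by case: t => //; rewrite lee_fin; exact: g_ge0.
  apply: mule_ge0; first exact: Kinv_ge0.
  apply: adde_ge0; last by apply: sume_ge0 => j _; exact: if_ge0.
  by apply: mule_ge0; [exact: rhoE_ge0|exact: if_ge0].
rewrite grow_same ifF; last first.
  apply/negbTE/eqP => /(congr1 size); rewrite size_rcons size_father => e.
  by have := leq_pred (size u); rewrite e ltnn.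
set G := b + _; have iK : (i < c u + m)%N by rewrite ltn_addr.
have -> : (\sum_(j < c u + m) (if rcons u j == v then 0 else G%:E) =
    (((c u + m)%:R - 1) * G)%:E)%E.
  rewrite (bigD1 (Ordinal iK))//= eqxx add0e.
  rewrite (eq_bigr (fun=> G%:E)); last first.
    move=> j ji; rewrite ifF//; apply/negbTE; apply: contra ji.
    by move=> /eqP/rcons_inj[ij]; apply/eqP/val_inj.
  rewrite sumEFin sumr_const cardC1 card_ord -[_ *+ _.-1]mulr_natl.
  congr EFin; congr (_ * _).
  by rewrite -subn1 natrB//; case: (c u + m)%N iK.
rewrite -EFinM lee_fin /G natrD addrAC.
have D : 0 < (c u)%:R + rho + m%:R by rewrite ltr_wpDr// Kden_gt0.
rewrite le_eqVlt; apply/orP; left; apply/eqP; field.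
by rewrite gt_eqF.
Qed.

(** Suppose that [u] is visited infinitely often and [v] never after [n0]. If the
    number of children of [u] is bounded, the drift [- 1 / (k + rho)] occurs
    infinitely often, which a nonnegative functional excludes; if it is unbounded,
    so is its logarithm, which however is bounded on average. *)
Lemma child_hit n0 : P [set w | [/\ (i < cnt n0 w u)%N,
  (forall n, exists2 j, (n <= j)%N & S j w = u) &
  (forall j, (n0 <= j)%N -> S j w != v)]] = 0%E.
Proof.
set A := [set w | _].
pose H (B : nat) := [set w | (i < cnt n0 w u)%N /\ (cnt n0 w u <= B)%N].
pose Q B n := [set w | (n0 <= n)%N ->
  H B w /\ forall j, (n0 <= j <= n)%N -> S j w != v].
have grows n m w (nm : (n <= m)%N) : (cnt n w u <= cnt m w u)%N.
  exact: (cnt_mono hTBRW).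
have hQ B n : adapted n (Q B n).
  apply: adapted_set => w w' ww' Qw nn; have [Hw Sw] := Qw nn; split.
    by rewrite /H /=; have [-> _] := same_past_state (same_past_le nn (same_past_sym ww')).
  move=> j /[dup] jn /andP[_ /ww'[_ <-]]; exact: Sw.
have mQ B n : measurable (Q B n) by exact: (adapted_measurable hTBRW (hQ B n)).
have hH B : adapted n0 (H B).
  by move=> w w' ww'; rewrite /H /= (adapted_cnt ww').
have mH B : measurable (H B) by exact: (adapted_measurable hTBRW (hH B)).
pose F (n : nat) (w : Omega) := f.
pose D n w := delta (cnt n w) (S n w).
have F0 n w c x : (0 <= F n w c x)%E.
  by rewrite /F /f; case: ifP => // _; rewrite lee_fin; exact: g_ge0.
have D0 n w : (0 <= D n w)%E.
  rewrite /D /delta; case: ifP => // _; rewrite lee_fin invr_ge0.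
  by rewrite (le_trans ler01)// one_le.
have hD n : adapted n (D n).
  by move=> w w' ww'; rewrite /D (adapted_cnt ww') (adapted_S ww').
pose CB B : R := b + ln (B%:R + rho).
have CB0 B : 0 <= CB B by rewrite addr_ge0 ?(ltW b0)// ln_ge0.
have lnle (k l : nat) : (k <= l)%N -> ln (k%:R + rho) <= ln (l%:R + rho) :> R.
  by move=> kl; rewrite ler_ln ?posrE ?Kden_gt0// lerD2r ler_nat.
have fB B : (\int[P]_(w in Q B n0) F n0 w (cnt n0 w) (S n0 w) <= (CB B)%:E)%E.
  apply: (@le_trans _ _ (\int[P]_(w in Q B n0) (CB B)%:E)%E).
    apply: (le_integral_proper rho0 hTBRW (n := n0)) => //.
    - exact: (adapted_state (phi := F n0)).
    - by move=> w; rewrite lee_fin.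
    - move=> w _ Qw; have [[_ cB] _] := Qw (leqnn _).
      rewrite /F /f; case: ifP => _; rewrite lee_fin//.
      by rewrite lerD2l lnle.
  rewrite integral_cst// -[leRHS]mule1 lee_wpmul2l ?lee_fin//.
  exact: probability_le1.
have sum_le B m : (\sum_(j < m) \int[P]_(w in Q B (n0 + j)%N) D (n0 + j)%N w +
     \int[P]_(w in Q B (n0 + m)%N) F (n0 + m)%N w (cnt (n0 + m) w) (S (n0 + m) w) <=
     (CB B)%:E)%E.
  apply: le_trans (fB B).
  apply: (super_drift rho0 hTBRW (Q := Q B) (f := F) (delta := D)) => //.
  - move=> n w Qw nn; have [Hw Sw] := Qw (leqW nn); split => // j /andP[j0 jn].
    by apply: Sw; rewrite j0 leqW.
  - move=> n w nn pw Qw; have [[iu _] Sw] := Qw nn.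
    apply: child_drift; first by apply: Sw; rewrite nn leqnn.
    exact: leq_trans (grows _ _ _ nn).
pose G B L j := Q B j `&` [set w | [/\ (n0 <= j)%N, S j w = u & (cnt j w u <= L)%N]].
have hG B L j : adapted j (G B L j).
  by move=> w w' ww'; rewrite /G /setI /= (hQ B j _ _ ww') (adapted_S ww') (adapted_cnt ww').
have mG B L j : measurable (G B L j) by exact: (adapted_measurable hTBRW (hG B L j)).
have G0 B L : P (lim_sup_set (fun j => G B L (n0 + j)%N)) = 0%E.
  apply: lim_sup_set_cvg0 => //.
  have LR : 0 < (L%:R + rho)^-1 :> R by rewrite invr_gt0 Kden_gt0.
  apply: (@le_lt_trans _ _ ((CB B / (L%:R + rho)^-1)%:E)); last by rewrite ltry.
  apply: lime_le; first by apply: is_cvg_nneseries.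
  apply: nearW => m; rewrite big_mkord.
  have h : (\sum_(j < m) ((L%:R + rho)^-1)%:E * P (G B L (n0 + j)%N) <= (CB B)%:E)%E.
    apply: le_trans (sum_le B m); rewrite -[leLHS]adde0; apply: leeD; last first.
      by apply: integral_ge0.
    apply: lee_sum => j _; rewrite -integral_cst//.
    apply: (@le_trans _ _ (\int[P]_(w in G B L (n0 + j)%N) D (n0 + j)%N w)%E).
      apply: (le_integral_proper rho0 hTBRW (n := (n0 + j)%N)) => //.
      + by move=> w; rewrite lee_fin ltW.
      + move=> w _ [_ [_ Su cL]]; rewrite /D /delta Su eqxx lee_fin.
        by rewrite lef_pV2 ?posrE ?Kden_gt0// lerD2r ler_nat.
    apply: ge0_subset_integral => //; last by move=> w [].
    exact: (adapted_measurable_fun hTBRW _ (hD _)).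
  rewrite -(@lee_pmul2l _ ((L%:R + rho)^-1)%:E)// ?lte_fin//.
  by rewrite ge0_sume_distrr// -EFinM mulrCA mulfV ?mulr1 ?gt_eqF.
have mS j x : measurable (S j @^-1` [set x]) by exact: measurable_S hTBRW _ _.
have mA : measurable A.
  rewrite (_ : A = [set w | (i < cnt n0 w u)%N] `&`
    lim_sup_set (fun j => S j @^-1` [set u]) `&`
    \bigcap_(j in [set j | (n0 <= j)%N]) ~` (S j @^-1` [set v])).
    apply: measurableI; first apply: measurableI.
    - apply: (adapted_measurable hTBRW (n := n0)) => w w' ww'.
      by rewrite /= (adapted_cnt ww').
    - by apply: bigcapT_measurable => k; apply: bigcup_measurable.
    - by apply: bigcap_measurableType => j _; apply: measurableC.
  apply/seteqP; split => [w [iu io nv]|w [[iu io] nv]].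
    split; first split => //.
      by move=> n _; have [j nj Sj] := io n; exists j.
    by move=> j jn; apply/eqP/nv.
  split => //; last by move=> j jn; apply/eqP/nv.
  by move=> n; have [j nj Sj] := io n I; exists j.
pose K B L j := (A `&` H B) `&` [set w | (L < cnt j w u)%N].
have mK B L j : measurable (K B L j).
  apply: measurableI; first exact: measurableI.
  apply: (adapted_measurable hTBRW (n := j)) => w w' ww'.
  by rewrite /= (adapted_cnt ww').
have PK B L j : (P (K B L j) <= (CB B / CB L)%:E)%E.
  have CL0 : 0 < CB L by rewrite ltr_wpDr// ln_ge0.
  pose E := Q B (n0 + j)%N `&` [set w | S (n0 + j)%N w != v /\ (L < cnt (n0 + j)%N w u)%N].
  have hE : adapted (n0 + j) E.
    by move=> w w' ww'; rewrite /E /setI /= (hQ B _ _ _ ww') (adapted_S ww') (adapted_cnt ww').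
  have mE : measurable E by exact: (adapted_measurable hTBRW hE).
  apply: (@le_trans _ _ (P E)).
    apply: le_measure; rewrite ?inE//.
    move=> w [[[iu io nv] Hw] Lc]; split.
      by move=> _; split => // k /andP[k0 _]; exact: nv.
    split; first by apply: nv; exact: leq_addr.
    by apply: leq_trans (grows _ _ _ _); [exact: Lc|exact: leq_addl].
  apply: (@markov_bound (Q B (n0 + j)%N) E
    (fun w => F (n0 + j)%N w (cnt (n0 + j) w) (S (n0 + j) w)) _ _ (n0 + j)) => //.
  - exact: (adapted_state (phi := F (n0 + j)%N)).
  - by move=> w [].
  - move=> w pw [_ [Sv /ltnW cL]]; rewrite /F /f (negbTE Sv) lee_fin.
    by rewrite lerD2l lnle.
  - apply: le_trans (sum_le B j); rewrite -[leLHS]add0e; apply: leeD => //.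
    by apply: sume_ge0 => k _; apply: integral_ge0.
have AH B L : A `&` H B `<=`
    lim_sup_set (fun j => G B L (n0 + j)%N) `|` \bigcup_j K B L j.
  move=> w [Aw Hw]; apply: contrapT => /not_orP[ns nK].
  apply: ns => n _; have [iu io nv] := Aw.
  have [j nj Sj] := io (n0 + n)%N; exists (j - n0)%N => /=.
    by rewrite leq_subRL// (leq_trans _ nj)// leq_addr.
  rewrite subnKC; last by rewrite (leq_trans _ nj)// leq_addr.
  split; first by move=> _; split => // k /andP[k0 _]; exact: nv.
  split => //; first by rewrite (leq_trans _ nj)// leq_addr.
  by rewrite leqNgt; apply/negP => Lc; apply: nK; exists j.
have PAH B : P (A `&` H B) = 0%E.
  apply/eqP; rewrite eq_le measure_ge0 andbT; apply/lee_addgt0Pr => e e0; rewrite add0e.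
  have := archi_boundP (normr_ge0 (expR (CB B / e))); set L := Num.bound _ => hL.
  have CL0 : 0 < CB L by rewrite ltr_wpDr// ln_ge0.
  have CBL : CB B / CB L <= e.
    rewrite ler_pdivrMr// mulrC -ler_pdivrMr//.
    apply: (@le_trans _ _ (ln (L%:R + rho))); last by rewrite lerDr ltW.
    rewrite -[leLHS]expRK ler_ln ?posrE ?expR_gt0 ?Kden_gt0//.
    by apply: le_trans (ler_norm _) _; apply: le_trans (ltW hL) _; rewrite lerDl ltW.
  have mls : measurable (lim_sup_set (fun j => G B L (n0 + j)%N)).
    by apply: bigcapT_measurable => k; apply: bigcup_measurable.
  have mcup : measurable (\bigcup_j K B L j) by apply: bigcupT_measurable.
  apply: (@le_trans _ _ (P (lim_sup_set (fun j => G B L (n0 + j)%N) `|` \bigcup_j K B L j))).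
    apply: le_measure; rewrite ?inE; [exact: measurableI|exact: measurableU|exact: AH].
  apply: le_trans (measureU2 _ _ _) _ => //.
  rewrite [X in (X + _)%E](G0 B L) add0e; apply: le_trans (increasing_bound (mK B L) _ (PK B L)) _.
    by move=> j w [AHw Lc]; split => //=; apply: leq_trans Lc _; exact: grows.
  by rewrite lee_fin.
apply: measure_negligible => //.
have -> : A = \bigcup_B (A `&` H B).
  apply/seteqP; split => [w Aw|w [B _ []]//].
  by exists (cnt n0 w u) => //; split => //; case: Aw.
by apply: negligible_bigcup => B; apply/negligibleP; [exact: measurableI|exact: PAH].
Qed.

End Child.

Lemma finite_nat_lt (A : set nat) : finite_set A -> exists N, forall n, A n -> (n < N)%N.
Proof.
move=> /finite_seqP[s ->]; exists (\max_(x <- s) x).+1 => n /= ns.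
by rewrite ltnS; apply: (@leq_bigmax_seq _ s xpredT id).
Qed.

Lemma infinite_visits v w : (forall n, exists2 j, (n <= j)%N & S j w = v) ->
  infinite_set (visits S v w).
Proof.
move=> io /finite_nat_lt[N hN]; have [j Nj Sj] := io N.
by have := hN j Sj; rewrite ltnNge Nj.
Qed.

(** The root is visited infinitely often, hence so is each of its children once
    it is born, and so on along the generations. *)
Lemma recurrent_walk : recurrent P T S.
Proof.
pose Never n0 := [set w | forall j, (n0 <= j)%N -> S j w != [::]].
pose Miss u i n0 := [set w | [/\ (i < cnt n0 w u)%N,
  (forall n, exists2 j, (n <= j)%N & S j w = u) &
  (forall j, (n0 <= j)%N -> S j w != rcons u i)]].
pose Miss' k := if choice.unpickle k is Some (u, i) then \bigcup_n0 Miss u i n0 else set0.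
have mS j x : measurable (S j @^-1` [set x]) by exact: measurable_S hTBRW _ _.
have nN : P.-negligible (\bigcup_n0 Never n0).
  apply: negligible_bigcup => n0; apply/negligibleP; last exact: root_hit.
  rewrite (_ : Never n0 = \bigcap_(j in [set j | (n0 <= j)%N]) ~` (S j @^-1` [set [::]])).
    by apply: bigcap_measurableType => j _; apply: measurableC.
  by apply/seteqP; split => w h j jn; apply/eqP/h.
have nM : P.-negligible (\bigcup_k Miss' k).
  apply: negligible_bigcup => k; rewrite /Miss'; case: choice.unpickle => [[u i]|]; last first.
    exact: negligible_set0.
  apply: negligible_bigcup => n0; apply/negligibleP; last exact: child_hit.
  rewrite (_ : Miss u i n0 = [set w | (i < cnt n0 w u)%N] `&`
    lim_sup_set (fun j => S j @^-1` [set u]) `&`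
    \bigcap_(j in [set j | (n0 <= j)%N]) ~` (S j @^-1` [set rcons u i])).
    apply: measurableI; first apply: measurableI.
    - apply: (adapted_measurable hTBRW (n := n0)) => w w' ww'.
      by rewrite /= (adapted_cnt ww').
    - by apply: bigcapT_measurable => k'; apply: bigcup_measurable.
    - by apply: bigcap_measurableType => j _; apply: measurableC.
  apply/seteqP; split => [w [iu io nv]|w [[iu io] nv]].
    split; first split => //.
      by move=> n _; have [j nj Sj] := io n; exists j.
    by move=> j jn; apply/eqP/nv.
  split => //; last by move=> j jn; apply/eqP/nv.
  by move=> n; have [j nj Sj] := io n I; exists j.
have nP : P.-negligible (~` proper).
  apply/negligibleP; last exact: (proper_ae rho0 hTBRW).
  by apply: measurableC; exact: (measurable_proper hTBRW).
apply: negligibleS (negligibleU nP (negligibleU nN nM)) => w /= nrec.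
apply: contrapT => /not_orP[/contrapT pw /not_orP[wN wM]]; apply: nrec => v [n vn].
apply: infinite_visits.
suff H x : (x \in T n w) || (x == [::]) -> forall m, exists2 j, (m <= j)%N & S j w = x.
  by apply: H; rewrite vn.
elim/last_ind: x => [_ m|u i IH].
  apply: contrapT => nj; apply: wN; exists m => // j mj; apply/eqP => Sj.
  by apply: nj; exists j.
rewrite (negbTE (rcons_neq_nil u i)) orbF => ui m.
have iu : (i < cnt n w u)%N by rewrite -(counted_T hTBRW n w).
have uT : (u \in T n w) || (u == [::]).
  case/lastP: u iu {IH ui} => [|u' j] iu; first by rewrite eqxx orbT.
  rewrite (counted_T hTBRW n w) ltnNge; apply/orP; left; apply/negP => h.
  by have [wf _] := proper_good hTBRW n pw; move: iu; rewrite wf.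
have {}IH := IH uT.
apply: contrapT => nj; apply: wM; exists (choice.pickle (u, i)) => //.
rewrite /Miss' choice.pickleK; exists (maxn n m) => //; split => //.
  by apply: leq_trans iu _; apply: (cnt_mono hTBRW); exact: leq_maxl.
move=> j jm; apply/eqP => Sj; apply: nj; exists j => //.
by rewrite (leq_trans _ jm)// leq_maxr.
Qed.

End Recurrence.

(** * Return times *)

Section ReturnTimes.
Context d (Omega : measurableType d) (R : realType).
Variables (P : probability Omega R) (rho : R) (nu : probability nat R).
Variables (xi : nat -> Omega -> nat) (T : nat -> Omega -> tree).
Variables (S : nat -> Omega -> vertex).
Hypothesis rho0 : 0 < rho.
Hypothesis hnu : (nu [set 0%N] < 1)%E.
Hypothesis hTBRW : is_TBRW P rho nu xi T S.

Notation cnt := (cnt T).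
Notation adapted := (adapted T S).
Notation same_past := (same_past T S).
Notation proper := (proper T S).

Definition returns (n : nat) (w : Omega) : nat :=
  count (fun j => S j w == tree_root) (iota 1 n).

Lemma returnsS n w : returns n.+1 w = (returns n w + (S n.+1 w == [::]))%N.
Proof. by rewrite /returns -[X in iota 1 X]addn1 iotaD count_cat /= addn0 add1n. Qed.

Lemma returns_le m n w : (m <= n)%N -> (returns m w <= returns n w)%N.
Proof.
move=> /subnK <-; elim: (n - m)%N => [|k IH]; first by rewrite add0n.
by apply: leq_trans IH _; rewrite addSn returnsS leq_addr.
Qed.

Lemma adapted_returns n : adapted n (returns n).
Proof.
move=> w w' ww'; apply: eq_in_count => j; rewrite mem_iota add1n ltnS => /andP[_ jn].
by have [_ ->] := ww' _ jn.
Qed.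

Lemma return_timeE k w : (0 < k)%N -> return_time R S k w =
  (\sum_(0 <= n <oo) (if (returns n w < k)%N then 1 else 0))%E.
Proof.
move=> k0; have s0 n : (0 <= (if (returns n w < k)%N then 1 else 0) :> \bar R)%E.
  by case: ifP.
have [[n0 kn0]|nk] := pselect (exists n, (k <= returns n w)%N).
  have ex : exists n, (k <= returns n w)%N by exists n0.
  case: (ex_minnP ex) => n kn nmin.
  have lt_n j : (j < n)%N -> (returns j w < k)%N.
    by move=> jn; rewrite ltnNge; apply/negP => /nmin; rewrite leqNgt jn.
  have n1 : (0 < n)%N by case: n kn {nmin lt_n} => //; rewrite /returns leqNgt k0.
  have rn : returns n w = k /\ S n w = [::].
    case: n n1 kn lt_n {nmin} => // n _; rewrite returnsS => kn lt_n.
    have := lt_n n (ltnSn n); case: eqP kn => /= [-> kn ?|_].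
      by split => //; apply/eqP; rewrite eqn_leq kn andbT addn1.
    by rewrite addn0 leqNgt => /negbTE ->.
  have unique m : is_return_time S k w m -> m = n.
    case=> m1 Sm rm; apply/eqP; rewrite eqn_leq andbC nmin /=; last by rewrite /returns rm.
    rewrite leqNgt; apply/negP; case: m m1 Sm rm => // m _ Sm rm nm.
    have := returns_le w (n := m) (m := n); rewrite -ltnS nm => /(_ isT).
    have : returns m.+1 w = k by [].
    rewrite returnsS Sm eqxx addn1; case: rn => rn _; rewrite rn => km.
    by rewrite -km ltnn.
  have -> : return_time R S k w = n%:R%:E.
    rewrite /return_time (_ : [set _ | _ in _] = [set n%:R%:E]) ?ereal_inf1//.
    apply/seteqP; split => [_ [m /unique -> <-]//|_ ->]; exists n => //.
    by case: rn => rn Sn; split.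
  rewrite (nneseries_split 0 n)// add0n eseries0 ?adde0; last first.
    move=> j nj _; rewrite ifF//; apply/negbTE; rewrite -leqNgt.
    exact: leq_trans kn (returns_le w nj).
  rewrite big_mkord (eq_bigr (fun=> 1%E)); last by move=> j _; rewrite lt_n.
  by rewrite sumEFin sumr_const card_ord.
have -> : return_time R S k w = +oo%E.
  rewrite /return_time (_ : [set _ | _ in _] = set0) ?ereal_inf0//.
  apply/seteqP; split => // z [m [_ _ rm] _] /=; apply: nk; exists m.
  by rewrite /returns rm.
apply/esym/eq_infty => x.
have := archi_boundP (normr_ge0 x); set N := Num.bound _ => hN.
apply: (@le_trans _ _ (\sum_(0 <= n < N) (if (returns n w < k)%N then 1 else 0))%E).
  rewrite big_mkord (eq_bigr (fun=> 1%E)); last first.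
    by move=> j _; rewrite ifT// ltnNge; apply/negP => h; apply: nk; exists j.
  rewrite sumEFin sumr_const card_ord lee_fin.
  by rewrite (le_trans (ler_norm _))// ltW.
exact: nneseries_lim_ge.
Qed.

(** The mean of a time is the sum of the probabilities that it is not yet over. *)
Lemma integral_return_time k : (0 < k)%N ->
  (\int[P]_w return_time R S k w =
   \sum_(0 <= n <oo) P [set w | (returns n w < k)%N])%E.
Proof.
move=> k0.
have h n : adapted n (fun w => if (returns n w < k)%N then 1 else 0 : \bar R)%E.
  by move=> w w' ww'; rewrite (adapted_returns ww').
under eq_integral do rewrite return_timeE//.
rewrite integral_nneseries//; last 2 first.
- by move=> n; apply: (adapted_measurable_fun hTBRW _ (h n)).
- by move=> n w _; case: ifP.
apply: eq_eseriesr => n _.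
rewrite (eq_integral (fun w => (\1_[set w | (returns n w < k)%N] w)%:E)); last first.
  move=> w _; rewrite indicE; case: ifP => h1.
    by rewrite mem_set.
  by rewrite memNset//= h1.
rewrite integral_indic ?setIT//.
apply: (adapted_measurable hTBRW (n := n)) => w w' ww'.
by rewrite /= (adapted_returns ww').
Qed.

Section Positive.
Variable M : R.
Hypothesis meanM : mean nu = M%:E.
Hypothesis pos : 1 + 2 * M < rho.
Variable k : nat.

Let M0 : 0 < M.
Proof. by rewrite -lte_fin -meanM mean_gt0. Qed.

Let b : R := 4 * M + 1.
Let dl : R := Num.min 1 (rho - 2 * M * (rho / (rho - 1))).

Let rho1 : 0 < rho - 1.
Proof. by have := pos; have := M0; lra. Qed.

Let dl0 : 0 < dl.
Proof.
rewrite lt_min ltr01/=.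
have -> : rho - 2 * M * (rho / (rho - 1)) = rho * (rho - 1 - 2 * M) / (rho - 1).
  by field; rewrite gt_eqF.
by rewrite divr_gt0// mulr_gt0//; have := pos; lra.
Qed.

Let b0 : 0 <= b. Proof. by have := M0; rewrite /b; lra. Qed.

(** Between two returns the linear potential has a negative drift; at the root it
    is at most doubled, which the factor [2 ^+ (k - r)] pays for, together with the
    constant [b]. Writing [r] in terms of the position [v] makes the function
    itself depend on the past up to time [n.-1] only. *)
Let f (n : nat) (w : Omega) (c : counts) (v : vertex) : \bar R :=
  let r := (returns n.-1 w + ((0 < n) && (v == [::])))%N in
  if (r < k)%N then
    (2 ^+ (k - r) * ((if v is [::] then 2 else 1) * (lin rho n.+2 c v + b)))%:E
  else 0%E.

Let f0 n w c v : (0 <= f n w c v)%E.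
Proof.
rewrite /f; case: ifP => // _; rewrite lee_fin.
by apply: mulr_ge0; [exact: exprn_ge0|apply: mulr_ge0; [case: v|rewrite addr_ge0 ?lin_ge0]].
Qed.

Let f_le n w c v : (returns n w < k)%N ->
  (f n.+1 w c v <= (2 ^+ (k - returns n w))%:E * ((lin rho n.+3 c v)%:E + b%:E))%E.
Proof.
move=> rk; have L0 : 0 <= lin rho n.+3 c v + b by rewrite addr_ge0 ?lin_ge0.
rewrite -EFinD -EFinM /f /=; case: v L0 => [|i v] L0 /=; last first.
  by rewrite addn0 rk mul1r.
case: ifP => rk'; rewrite lee_fin; last by rewrite mulr_ge0// exprn_ge0.
rewrite mulrA -exprSr ler_wpM2r//.
by rewrite addn1 -subSn// subSS.
Qed.

Let drift n w : proper w -> (returns n w < k)%N ->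
  (walk_step rho nu (f n.+1 w) (cnt n w) (S n w) + dl%:E <= f n w (cnt n w) (S n w))%E.
Proof.
move=> pw rk; have g := proper_good hTBRW n pw; have sz := proper_size hTBRW n pw.
set c := cnt n w in g *; set v := S n w in g sz *.
set x : R := 2 ^+ (k - returns n w).
have x1 : 1 <= x by rewrite exprn_ege1// ler1n.
have x0 : 0 <= x by apply: le_trans x1.
have L0 c' v' : (0 <= (lin rho n.+3 c' v')%:E)%E by rewrite lee_fin lin_ge0.
have Lb0 c' v' : (0 <= (lin rho n.+3 c' v')%:E + b%:E)%E by rewrite adde_ge0// lee_fin.
pose K := Kop nu rho c v (fun c' => (lin rho n.+3 c' (father v))%:E)
   (fun c' i => (lin rho n.+3 c' (rcons v i))%:E).
have step : (walk_step rho nu (f n.+1 w) c v <= x%:E * (K + b%:E))%E.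
  rewrite /K -[X in (_ + X)%E](Kop_cst nu rho0 c v) -KopD//.
  rewrite -KopZ//; apply: Kop_le => //.
  - by move=> m; exact: f_le.
  - by move=> m i _; exact: f_le.
have fuel : lin rho n.+3 c v = lin rho n.+2 c v.
  rewrite /lin potential_fuel// => [u nu'|]; last exact: leqW.
  by apply: (proper_depth hTBRW pw); exact: ltnW.
have L2 : 0 <= lin rho n.+2 c v by exact: lin_ge0.
have rE : (returns n.-1 w + ((0 < n) && (v == [::])))%N = returns n w.
  by rewrite /v; case: (n) => [|n'] //=; rewrite returnsS.
have dx (y : R) : dl <= y -> dl <= x * y.
  move=> dy; have y0 : 0 <= y by rewrite (le_trans _ dy)// ltW.
  by apply: le_trans dy _; rewrite ler_peMl.
apply: (@le_trans _ _ (x%:E * (K + b%:E) + dl%:E)%E); first by rewrite leeD2r.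
rewrite /f rE rk -/x.
have [v0|v0] := eqVneq v [::].
  have KE : (K <= (2 * (lin rho n.+2 c v + 2 * M))%:E)%E.
    rewrite -fuel /K v0; apply: (lin_root_le rho0 meanM) => //.
    by rewrite -v0.
  apply: (@le_trans _ _ (x%:E * ((2 * (lin rho n.+2 c v + 2 * M))%:E + b%:E) + dl%:E)%E).
    by rewrite leeD2r// lee_wpmul2l ?lee_fin// leeD2r.
  have -> : (if v is [::] then 2 else 1) = 2 :> R by rewrite v0.
  rewrite -(EFinM x) -(EFinD _ dl) lee_fin -lerBrDl -mulrBr; apply: dx.
  rewrite ge_min; apply/orP; left; rewrite /b; lra.
have -> : (if v is [::] then 2 else 1) = 1 :> R by case: (v) v0.
have KE : K = (lin rho n.+2 c v + 2 * geo rho (size v) * M - rho)%:E.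
  by rewrite -fuel /K (lin_drift rho0 meanM)// !ltnS ltnW.
rewrite KE mul1r -(EFinM x) -(EFinD _ dl) lee_fin -lerBrDl -mulrBr; apply: dx.
rewrite ge_min; apply/orP; right.
have := geo_closed (size v) (lt0r_neq0 rho0).
set gg := geo _ _ => gE.
have gle : gg <= rho / (rho - 1).
  rewrite ler_pdivlMr// mulrC gE gerBl exprn_ge0// invr_ge0 ltW//.
have : 2 * M * gg <= 2 * M * (rho / (rho - 1)) by rewrite ler_wpM2l// mulr_ge0// ltW.
lra.
Qed.

Lemma positive_recurrence : (0 < k)%N -> (\int[P]_w return_time R S k w < +oo)%E.
Proof.
move=> k0; rewrite integral_return_time//.
pose Q n := [set w | (returns n w < k)%N].
have hQ n : adapted n (Q n) by move=> w w' ww'; rewrite /Q /= (adapted_returns ww').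
have mQ n : measurable (Q n) by exact: (adapted_measurable hTBRW (hQ n)).
pose B : R := 2 ^+ k * (2 * (lin rho 2 no_counts [::] + b)).
have B0 : 0 <= B by rewrite !mulr_ge0 ?exprn_ge0// addr_ge0 ?lin_ge0.
have fB : (\int[P]_(w in Q 0%N) f 0%N w (cnt 0%N w) (S 0%N w) <= B%:E)%E.
  rewrite (eq_integral (cst B%:E)); last first.
    move=> w _; rewrite /f (cnt_init hTBRW) (S_init hTBRW) /= addn0 /returns /= k0 subn0.
    by [].
  rewrite integral_cst// -[leRHS]mule1 lee_wpmul2l ?lee_fin//.
  exact: probability_le1.
have sum_le m : (\sum_(i < m) P (Q i) <= (B / dl)%:E)%E.
  have -> : (B / dl)%:E = (dl^-1%:E * B%:E)%E by rewrite -EFinM mulrC.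
  have -> : (\sum_(i < m) P (Q i) = dl^-1%:E * \sum_(i < m) \int[P]_(w in Q i) dl%:E)%E.
    rewrite ge0_sume_distrr//; last by move=> i _; apply: integral_ge0 => w _; rewrite lee_fin ltW.
    by apply: eq_bigr => i _; rewrite integral_cst// muleA -EFinM mulVf ?mul1e// gt_eqF.
  rewrite lee_wpmul2l ?lee_fin ?invr_ge0 ?(ltW dl0)//.
  apply: le_trans fB; have := super_drift rho0 hTBRW (Q := Q) (f := f)
    (delta := fun _ _ => dl%:E) (n0 := 0%N).
  move=> /(_ hQ) h; apply: le_trans (h _ _ _ _ _ _ m).
  - by rewrite leeDl// integral_ge0.
  - by move=> n w; apply: leq_ltn_trans; exact: returns_le.
  - move=> n w w' ww'; apply/funext => c; apply/funext => v.
    by rewrite /f (adapted_returns ww').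
  - by [].
  - by move=> n w c v; exact: f0.
  - by move=> n w; rewrite lee_fin ltW.
  - by move=> n w _ pw Qw; exact: drift.
apply: (@le_lt_trans _ _ (B / dl)%:E); last by rewrite ltry.
apply: lime_le; first by apply: is_cvg_nneseries.
by apply: nearW => m; rewrite big_mkord; exact: sum_le.
Qed.

End Positive.

(** Before the first return the walk stays in the subtree of a child [i] of the
    root. There the functional [F] of [null_functional], applied to that subtree,
    loses at most 1 per step; as it is bounded, its initial mean bounds from below
    the mean duration, if finite, of the excursion. This holds with [F] starting
    as high as desired. *)
Lemma null_recurrence (M : R) (k : nat) : mean nu = M%:E -> rho = 1 + 2 * M ->
  (0 < k)%N -> (\int[P]_w return_time R S k w = +oo)%E.
Proof.
move=> meanM rhoE k0; rewrite integral_return_time//.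
pose Q n := [set w | (returns n w < 1)%N].
have hQ n : adapted n (Q n) by move=> w w' ww'; rewrite /Q /= (adapted_returns ww').
have mQ n : measurable (Q n) by exact: (adapted_measurable hTBRW (hQ n)).
have mQk n : measurable [set w | (returns n w < k)%N].
  apply: (adapted_measurable hTBRW (n := n)) => w w' ww'.
  by rewrite /= (adapted_returns ww').
apply: contrapT => /eqP; rewrite -ltey => fin.
have [B0 PB] : exists B : R, forall m, (\sum_(i < m) P (Q i) <= B%:E)%E.
  exists (fine (\sum_(0 <= n <oo) P [set w | (returns n w < k)%N])%E) => m.
  rewrite fineK; last first.
    by rewrite ge0_fin_numE//; apply: nneseries_ge0.
  apply: le_trans (nneseries_lim_ge m _) => //.
  rewrite big_mkord; apply: lee_sum => i _; apply: le_measure; rewrite ?inE//.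
  by move=> w /= h; apply: leq_trans k0.
set B := Num.max B0 0; have {}PB m : (\sum_(i < m) P (Q i) <= B%:E)%E.
  by apply: le_trans (PB m) _; rewrite lee_fin le_max lexx.
have B_ge0 : 0 <= B by rewrite le_max lexx orbT.
(* [p] bounds from below the probability that the first step leaves the root *)
pose p : R := birth_prob nu / (1 + rho).
have rho1 : 0 < 1 + rho by rewrite addr_gt0.
have p0 : 0 < p by rewrite divr_gt0 ?birth_prob_gt0.
have [F [C [C0 FC Fo Fstep]]] := null_functional rho0 hnu ((B + 1) / p) meanM rhoE.
have F_ge0 c v : 0 <= F c v by have /andP[] := FC c v.
pose h (c : counts) (v : vertex) : \bar R :=
  if v is i :: w then (F (below [:: i] c) w)%:E else 0%E.
have h0 c v : (0 <= h c v)%E by case: v => [|i v] //=; rewrite lee_fin.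
pose a n := (\int[P]_(w in Q n) h (cnt n w) (S n w))%E.
have ha n : adapted n (fun w => h (cnt n w) (S n w)).
  exact: (adapted_state (phi := fun _ => h)).
have hstep n : adapted n (fun w => walk_step rho nu h (cnt n w) (S n w)).
  by move=> w w' ww'; rewrite (adapted_cnt ww') (adapted_S ww').
have ws0 n w : (0 <= walk_step rho nu h (cnt n w) (S n w))%E by exact: walk_step_ge0.
have mws n : measurable_fun (Q n) (fun w => walk_step rho nu h (cnt n w) (S n w)).
  exact: (adapted_measurable_fun hTBRW _ (hstep n)).
(* [h] vanishes at the root, so nothing is lost by restricting to [Q n.+1] *)
have next n : (\int[P]_(w in Q n) walk_step rho nu h (cnt n w) (S n w) = a n.+1)%E.
  rewrite -(markov_on rho0 hTBRW (n := n) (phi := fun _ => h))//.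
  rewrite /a integral_mkcond [RHS]integral_mkcond; apply: eq_integral => w _.
  rewrite !patchE.
  have -> : (w \in Q n.+1) = (w \in Q n) && (S n.+1 w != [::]).
    apply/idP/andP => [|[]]; rewrite /Q !inE /= returnsS.
      by case: eqP; rewrite ?addn1 ?addn0.
    by move=> + /negbTE -> => ?; rewrite addn0.
  case: (w \in _) => //=; case: eqP => // ->; by [].
have le_a n : (a n <= P (Q n) + a n.+1)%E.
  rewrite -next -[P (Q n)]mul1e -integral_cst// -ge0_integralD//.
  apply: (le_integral_proper rho0 hTBRW (n := n)).
  - exact: mQ.
  - exact: ha.
  - by move=> w w' ww' /=; rewrite (hstep n w w' ww').
  - by move=> w; exact: h0.
  - by move=> w /=; apply: adde_ge0; [exact: lee01|exact: ws0].
  - move=> w pw _; have := proper_good hTBRW n pw.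
    case: (S n w) => [|i v] g /=; first by rewrite adde_ge0// walk_step_ge0.
    apply: le_trans (Fstep _ _ (good_below g)) _.
    rewrite leeD2l//; apply: Kop_le => //.
    + by move=> c; case: (v) => // *; rewrite lee_fin.
    + by move=> c j; rewrite lee_fin.
    + by move=> m; rewrite father_cons; case: v {g} => //= j v; rewrite -(below_grow [:: i]).
    + by move=> m j _; rewrite -(below_grow [:: i]).
have a_le n : (a n <= C%:E * P (Q n))%E.
  rewrite -integral_cst//; apply: (le_integral_proper rho0 hTBRW (n := n)) => //.
  move=> w _ _; rewrite /h; case: (S n w) => [|i v]; rewrite lee_fin//.
  by have /andP[] := FC (below [:: i] (cnt n w)) v.
have tele m : (a 1%N <= \sum_(i < m) P (Q i.+1) + a m.+1)%E.
  elim: m => [|m IH]; first by rewrite big_ord0 add0e.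
  by apply: le_trans IH _; rewrite big_ord_recr/= -addeA leeD2l.
have PB1 m : (\sum_(i < m) P (Q i.+1) <= B%:E)%E.
  apply: le_trans (PB m.+1); rewrite big_ord_recl/=; exact: leeDr.
have a1_le : (a 1%N <= (B + 1)%:E)%E.
  have [n Pn] := @summable_small R (fun i => P (Q i.+1)) B (C + 1)^-1
    (fun=> measure_ge0 _ _) PB1 (ltac:(by rewrite invr_gt0 ltr_wpDl)).
  apply: le_trans (tele n) _; rewrite EFinD; apply: leeD => //.
  apply: le_trans (a_le _) _; apply: (@le_trans _ _ (C%:E * ((C + 1)^-1)%:E)%E).
    by rewrite lee_wpmul2l ?lee_fin.
  by rewrite lee_fin ler_pdivrMr ?ltr_wpDl// mul1r lerDl.
have : ((p * F no_counts [::])%:E <= a 1%N)%E.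
  rewrite -next (eq_integral (cst (walk_step rho nu h no_counts [::]))); last first.
    by move=> w _; rewrite (cnt_init hTBRW) (S_init hTBRW).
  rewrite integral_cst//; have Q0 : Q 0%N = setT by apply/seteqP; split.
  rewrite Q0 [X in (_ * X)%E](@probability_setT _ _ _ P) mule1 mulrC /p EFinM.
  have -> : (birth_prob nu / (1 + rho))%:E = ((1 + rho)^-1%:E * (birth_prob nu)%:E)%E.
    by rewrite -EFinM mulrC.
  rewrite -birth_probE -!ExZ//; last first.
    by move=> m; rewrite lee_fin mulr_ge0// invr_ge0 ltW.
  rewrite /walk_step /Kop; apply: Ex_le => m; first by rewrite !mule_ge0 ?lee_fin// invr_ge0 ltW.
  rewrite /= mule0 add0e grow_same add0n.
  rewrite (eq_bigr (fun=> (F no_counts [::])%:E)); last first.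
    by move=> i _; congr (F _ _)%:E; apply/funext => z.
  rewrite sumEFin sumr_const card_ord -[F _ _ *+ m]mulr_natl -!EFinM lee_fin.
  rewrite [leRHS]mulrA mulrC ler_wpM2r//.
  case: m => [|m] /=; first by rewrite !mulr0.
  rewrite mulr1 ler_pdivlMl ?Kden_gt0// ler_pdivrMr//.
  have : 1 <= m.+1%:R :> R by rewrite ler1n.
  by have := rho0; nra.
move=> /le_trans/(_ a1_le); rewrite lee_fin leNgt => /negP; apply.
by rewrite mulrC -ltr_pdivrMr.
Qed.

End ReturnTimes.

(** * Transience *)

Section Transience.
Context d (Omega : measurableType d) (R : realType).
Variables (P : probability Omega R) (rho : R) (nu : probability nat R).
Variables (xi : nat -> Omega -> nat) (T : nat -> Omega -> tree).
Variables (S : nat -> Omega -> vertex).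
Hypothesis rho0 : 0 < rho.
Hypothesis hnu : (nu [set 0%N] < 1)%E.
Hypothesis hTBRW : is_TBRW P rho nu xi T S.

Notation cnt := (cnt T).
Notation adapted := (adapted T S).
Notation same_past := (same_past T S).
Notation proper := (proper T S).

Definition leaves (u : Omega -> vertex) (m k : nat) : set Omega :=
  [set w | exists2 i, (i <= k)%N & ~~ prefix (u w) (S (m + i)%N w)].

Lemma adapted_leaves u m k : adapted m u -> adapted (m + k) (leaves u m k).
Proof.
move=> hu; apply: adapted_set => w w' ww' [i ik nu']; exists i => //.
have mk : (m + i <= m + k)%N by rewrite leq_add2l.
have <- : u w = u w' by apply: hu; apply: same_past_le ww'; exact: leq_addr.
by have [_ <-] := ww' _ mk.
Qed.

(** As long as the walk stays in the subtree of [u], the outside of that subtree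
    plays no part in its transitions. *)
Lemma leaves_le k m u (G : set Omega) : adapted m u -> adapted m G ->
  (forall w, G w -> u w != [::] /\ prefix (u w) (S m w)) ->
  (P (G `&` leaves u m k) <= \int[P]_(w in G)
    exit_prob nu rho k (below (u w) (cnt m w)) (drop (size (u w)) (S m w)))%E.
Proof.
elim: k m G => [|k IH] m G hu hG Gu.
  have -> : G `&` leaves u m 0 = set0.
    apply/seteqP; split => // w [Gw [i]]; rewrite leqn0 => /eqP -> /negP[].
    by rewrite addn0; have [] := Gu w Gw.
  by rewrite measure0; apply: integral_ge0 => w _; exact: exit_prob_ge0.
pose G1 := G `&` [set w | prefix (u w) (S m.+1 w)].
pose G2 := G `&` [set w | ~~ prefix (u w) (S m.+1 w)].
have hS := adaptedS hu.
have hG1 : adapted m.+1 G1.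
  by move=> w w' ww'; rewrite /G1 /setI /= (adaptedS hG ww') (adapted_S ww') (hS _ _ ww').
have hG2 : adapted m.+1 G2.
  by move=> w w' ww'; rewrite /G2 /setI /= (adaptedS hG ww') (adapted_S ww') (hS _ _ ww').
have mG1 : measurable G1 by exact: (adapted_measurable hTBRW hG1).
have mG2 : measurable G2 by exact: (adapted_measurable hTBRW hG2).
have mG : measurable G by exact: (adapted_measurable hTBRW hG).
have mL n j : adapted n u -> measurable (leaves u n j).
  move=> hn; apply: (adapted_measurable hTBRW (n := (n + j)%N)).
  exact: adapted_leaves.
pose phi (w : Omega) c x : \bar R := if prefix (u w) x then
  exit_prob nu rho k (below (u w) c) (drop (size (u w)) x) else 1%E.
have phi0 w c x : (0 <= phi w c x)%E by rewrite /phi; case: ifP => // _; exact: exit_prob_ge0.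
have hphi : adapted m phi by move=> w w' ww'; rewrite /phi (hu _ _ ww').
have GE : G = G2 `|` G1.
  apply/seteqP; split => [w Gw|w [[]|[]]//].
  by case: (boolP (prefix (u w) (S m.+1 w))) => h; [right|left].
apply: (@le_trans _ _ (P G2 + P (G1 `&` leaves u m.+1 k))%E).
  apply: le_trans (measureU2 _ _ _) => //; last by apply: measurableI => //; exact: mL.
  apply: le_measure; rewrite ?inE.
  - by apply: measurableI => //; exact: mL.
  - by apply: measurableU => //; apply: measurableI => //; exact: mL.
  - move=> w [Gw [[|i] ik]]; first by rewrite addn0; have [_ ->] := Gu w Gw.
    rewrite addnS -addSn => nu'.
    case: (boolP (prefix (u w) (S m.+1 w))) => h; [right|by left].
    by split; [split|exists i].
apply: (@le_trans _ _ (\int[P]_(w in G) phi w (cnt m.+1 w) (S m.+1 w))%E).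
  rewrite GE ge0_integral_setU//; last 2 first.
  - apply: (adapted_measurable_fun hTBRW _ (n := m.+1)); first exact: measurableU.
    exact: (adapted_state (adaptedS hphi)).
  - apply/disj_setPS => w [[_ /= /negP n1] [_ /= n2]]; exact: n1.
  apply: leeD.
    rewrite -[leLHS]mul1e -integral_cst// [leLHS](eq_integral (fun w => phi w (cnt m.+1 w) (S m.+1 w)))//.
    by move=> w; rewrite inE => -[_ /= /negbTE h]; rewrite /phi h.
  apply: le_trans (IH m.+1 G1 hS hG1 _) _.
    by move=> w [/Gu[u0 _] /= h].
  rewrite [leLHS](eq_integral (fun w => phi w (cnt m.+1 w) (S m.+1 w)))//.
  by move=> w; rewrite inE => -[_ /= h]; rewrite /phi h.
rewrite (markov_on rho0 hTBRW hG hphi phi0).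
apply: (le_integral_proper rho0 hTBRW (n := m)); first exact: mG.
- exact: (adapted_step _ _ hphi).
- by move=> w w' ww'; rewrite (hu _ _ ww') (adapted_cnt ww') (adapted_S ww').
- by move=> w; exact: walk_step_ge0.
- by move=> w; exact: exit_prob_ge0.
move=> w _ Gw; have [u0 /prefixP[x ->]] := Gu w Gw.
rewrite drop_size_cat// exit_prob_rec; move: (phi0 w); rewrite /phi.
set U := u w in u0 *; move=> {}phi0.
apply: Kop_le => //.
- move=> n; rewrite -below_grow; case: x => [|j x].
    by case: ifP => // _; exact: exit_prob_le1.
  by rewrite father_cat prefix_prefix drop_size_cat.
- by move=> n i _; rewrite -below_grow rcons_cat prefix_prefix drop_size_cat.
Qed.

Lemma fresh_below c u : good c u -> c u = 0%N -> below u c = no_counts.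
Proof.
case=> wf _ cu; apply/funext; elim/last_ind => [|z i IH]; first by rewrite /below cats0.
by rewrite /below -rcons_cat wf// -/(below u c z) IH.
Qed.

Lemma intree_prefix c p i v : intree c v -> prefix (rcons p i) v -> (i < c p)%N.
Proof.
move=> + /prefixP[z vE]; rewrite {}vE; elim/last_ind: z => [|z j IH].
  by rewrite cats0 intree_rcons => /andP[].
by rewrite -rcons_cat intree_rcons => /andP[/IH].
Qed.

Section Target.
Variable v : vertex.
Let E : set Omega := lim_sup_set (fun n => S n @^-1` [set v]).

Let mE : measurable E.
Proof.
by apply: bigcapT_measurable => k; apply: bigcup_measurable => j _; exact: measurable_S hTBRW _ _.
Qed.

(** If the conditional probability of [E] is at most [mu] whenever [A] occurs, it
    is so at the first time that [A] occurs. *)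
Lemma first_time (mu : R) n (A : nat -> set Omega) : (forall m, adapted (n + m) (A m)) ->
  (forall m G, adapted (n + m) G -> G `<=` A m -> P (E `&` G) <= mu%:E * P G)%E ->
  (P (E `&` \bigcup_m A m) <= mu%:E * P (\bigcup_m A m))%E.
Proof.
move=> hA Amu.
have hD m : adapted (n + m) (seqDU A m).
  move=> w w' ww'; rewrite /seqDU /setD /= (hA _ _ _ ww'); congr (_ /\ ~ _).
  rewrite -!bigcup_mkord; apply/propext; split => -[j /= jm Aj]; exists j => //.
    rewrite -(hA j w w')//; apply: same_past_le ww'; first by rewrite leq_add2l ltnW.
  rewrite (hA j w w')//; apply: same_past_le ww'; by rewrite leq_add2l ltnW.
have mD m : measurable (seqDU A m) by exact: (adapted_measurable hTBRW (hD m)).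
have tD := trivIset_seqDU A.
rewrite seqDU_bigcup_eq setI_bigcupr measure_bigcup//; last 2 first.
- by move=> m _; exact: measurableI.
- by apply: trivIset_setIl.
rewrite [X in (_ <= _ * X)%E](measure_bigcup P)// -nneseriesZl//.
by apply: lee_nneseries => // m _; apply: Amu => // w [].
Qed.

(** [lam] bounds the conditional probability, given the past, of infinitely many
    visits of [v], once [v] is created. *)
Definition return_bound (lam : R) : Prop := forall n H, adapted n H ->
  (forall w, H w -> intree (cnt n w) v) -> (P (E `&` H) <= lam%:E * P H)%E.

(** At a fresh vertex the walk starts a new excursion in an empty subtree, which
    does not contain [v] if [v] is already created. *)
Definition fresh (c : counts) (x : vertex) : bool := (c x == 0%N) && ~~ prefix x v.

Let intree_later n m w : intree (cnt n w) v -> intree (cnt (n + m) w) v.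
Proof. by apply: intree_le => u; apply: (cnt_mono hTBRW); exact: leq_addr. Qed.

(** To reach [v] from a fresh vertex, the walk must first leave the subtree of
    that vertex, which has probability at most [s]. *)
Lemma return_bound_fresh (lam s : R) n H : 0 <= lam ->
  (forall k, exit_prob nu rho k no_counts [::] <= s%:E)%E -> return_bound lam ->
  adapted n H -> (forall w, H w -> intree (cnt n w) v) ->
  (forall w, H w -> fresh (cnt n w) (S n w)) ->
  (P (E `&` H) <= (lam * s)%:E * P H)%E.
Proof.
move=> lam0 exits bound hH Hv Hf.
have mH : measurable H by exact: (adapted_measurable hTBRW hH).
pose A m := H `&` [set w | ~~ prefix (S n w) (S (n + m)%N w)].
have nm m : (n <= n + m)%N by exact: leq_addr.
have hA m : adapted (n + m) (A m).
  move=> w w' ww'; rewrite /A /setI /= (adapted_le (nm m) hH ww') (adapted_S ww').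
  by rewrite (adapted_S (same_past_le (nm m) ww')).
have mA m : measurable (A m) by exact: (adapted_measurable hTBRW (hA m)).
have mU : measurable (\bigcup_m A m) by exact: bigcupT_measurable.
have s0 : 0 <= s by rewrite -lee_fin; exact: exits 0%N.
apply: (@le_trans _ _ (P (E `&` \bigcup_m A m))).
  apply: le_measure; rewrite ?inE; [exact: measurableI|exact: measurableI|].
  move=> w [Ew Hw]; split => //; have [j /= nj Sj] := Ew n I.
  exists (j - n)%N => //; split => //=; rewrite subnKC// Sj.
  by have /andP[] := Hf w Hw.
apply: le_trans (first_time hA _) _.
  move=> m G hG GA; apply: (bound (n + m)%N) => // w /GA[/Hv h _].
  exact: intree_later.
rewrite EFinM -muleA lee_wpmul2l ?lee_fin//.
have UE : \bigcup_m A m = \bigcup_k (H `&` leaves (S n) n k).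
  apply/seteqP; split => w [m _ [Hw h]]; first by exists m => //; split => //; exists m.
  by case: h => i im nu'; exists i.
have hSn : adapted n (S n) by exact: adapted_S.
have hL k : adapted (n + k) (H `&` leaves (S n) n k).
  move=> w w' ww'; rewrite /setI /= (adapted_le (nm k) hH ww').
  by rewrite (adapted_leaves hSn ww').
rewrite UE; apply: increasing_bound => [k|k w [Hw [i ik h]]|k].
- exact: (adapted_measurable hTBRW (hL k)).
- by split => //; exists i => //; exact: leqW.
apply: le_trans (leaves_le k hSn hH _) _.
  move=> w Hw; split; last exact: prefix_refl.
  have /andP[_] := Hf w Hw; apply: contraNneq => ->; exact: prefix0s.
rewrite -integral_cst//; apply: (le_integral_proper rho0 hTBRW (n := n)).
- exact: mH.
- by move=> w w' ww'; rewrite (adapted_cnt ww') (adapted_S ww').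
- by [].
- by move=> w; exact: exit_prob_ge0.
- by move=> w; rewrite lee_fin.
move=> w pw Hw; have /andP[/eqP c0 _] := Hf w Hw.
by rewrite fresh_below ?drop_size//; exact: (proper_good hTBRW n pw).
Qed.

Let step_le (N k I : nat) (b : bool) : (k <= I)%N -> (k <= N)%N -> (b -> (k < N)%N) ->
  (N%:R + rho)^-1 * (rho + k%:R) + b%:R / (I%:R + 1 + rho) <= 1.
Proof.
move=> kI kN bk; have D := Kden_gt0 rho0 N.
have I0 : 0 < I%:R + 1 + rho by rewrite ltr_wpDl// addr_ge0.
rewrite mulrC; case: b bk => [/(_ isT) {}kN|_]; last first.
  by rewrite mul0r addr0 ler_pdivrMr// mul1r addrC lerD2r ler_nat.
rewrite -lerBrDl -[X in X - _](mulfV (lt0r_neq0 D)) -mulrBl.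
rewrite mul1r -[leLHS]mul1r ler_pdivrMr// mulrAC ler_pdivlMr// mul1r.
have [a aE] : exists a : nat, N = (k + a.+1)%N by exists (N - k.+1)%N; lia.
have kI' : (k%:R : R) <= I%:R by rewrite ler_nat.
have a0 : 0 <= a%:R :> R by [].
have k0 : 0 <= k%:R :> R by [].
rewrite aE natrD -natr1.
have h1 : 0 <= a%:R * I%:R :> R by rewrite mulr_ge0.
have h2 : 0 <= a%:R * rho by rewrite mulr_ge0// ltW.
lra.
Qed.

(** A finite set [D] with this property keeps it until the next arrival at a
    fresh vertex. *)
Definition explored (D : seq vertex) (c : counts) (x : vertex) : Prop :=
  [/\ x \in D, (forall u, (0 < c u)%N -> u \in D),
      (forall u, prefix u v -> u \in D) & (forall u, u \in D -> father u \in D)].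

Lemma explored_step D c x m y : explored D c x -> ~~ fresh (grow c x m) y ->
  y \in neighbours (grow c x m) x -> explored D (grow c x m) y.
Proof.
case=> xD cD pD fD ny yx.
have gD u : (0 < grow c x m u)%N -> u \in D.
  by have [->//|ux] := eqVneq u x; rewrite grow_other//; exact: cD.
split => //; move: yx; rewrite in_cons => /predU1P[->|_]; first exact: fD.
move: ny; rewrite /fresh negb_and negbK -lt0n => /orP[|]; [exact: gD|exact: pD].
Qed.

(** Newborn children are fresh, and the children that are not fresh lie in [D]:
    among the [N] children at most [size D] are not fresh, and at most [N.-1] if
    there was a birth. *)
Lemma fresh_step D c x : good c x -> intree c v -> explored D c x ->
  (walk_step rho nu (fun c x => (~~ fresh c x)%:R%:E) c x +
   (birth_prob nu / ((size D)%:R + 1 + rho))%:E <= 1)%E.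
Proof.
move=> [wf _] vT [xD cD pD _].
have I0 : 0 < (size D)%:R + 1 + rho :> R by rewrite ltr_wpDl// addr_ge0.
have -> : (birth_prob nu / ((size D)%:R + 1 + rho))%:E =
    Ex nu (fun m => (((size D)%:R + 1 + rho)^-1%:E * (0 < m)%N%:R%:E)%E).
  by rewrite ExZ ?birth_probE -?EFinM 1?mulrC.
have t0 m := Kterm_ge0 rho0 (grow c x m x)
  (u := (~~ fresh (grow c x m) (father x))%:R%:E)
  (d := fun i => (~~ fresh (grow c x m) (rcons x i))%:R%:E)
  (ltac:(by rewrite lee_fin)) (ltac:(by move=> i; rewrite lee_fin)).
rewrite /walk_step /Kop -ExD; last 2 first.
- exact: t0.
- by move=> m; rewrite mule_ge0// lee_fin// invr_ge0 ltW.
apply: Ex_le1 => m /=.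
  by apply: adde_ge0; [exact: t0|rewrite mule_ge0// lee_fin invr_ge0 ltW].
set c' := grow c x m; have c'x : c' x = (c x + m)%N by rewrite /c' grow_same.
set N := c' x in c'x *.
pose B := [set i : 'I_N | ~~ fresh c' (rcons x i)]%SET.
have -> : (\sum_(i < N) (~~ fresh c' (rcons x i))%:R%:E = #|B|%:R%:E :> \bar R)%E.
  rewrite sumEFin -natr_sum -sum1_card [in RHS]big_mkcond; congr (_%:R%:E).
  by apply: eq_bigr => i _; rewrite inE; case: (fresh _ _).
have other i : c' (rcons x i) = c (rcons x i).
  rewrite /c' grow_other//; apply/eqP => /(congr1 size).
  by rewrite size_rcons => /eqP; rewrite eqn_leq ltnn.
have BI : (#|B| <= size D)%N.
  rewrite cardE -(size_map (fun i : 'I_N => rcons x i)); apply: uniq_leq_size.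
    by rewrite map_inj_uniq ?enum_uniq// => i j /rcons_inj[/val_inj].
  move=> _ /mapP[i + ->]; rewrite mem_enum inE /fresh other negb_and negbK -lt0n.
  by case/orP; [exact: cD|exact: pD].
have BN : (#|B| <= N)%N by rewrite -[leqRHS]card_ord max_card.
have Bm : (0 < m)%N -> (#|B| < N)%N.
  move=> m0; have cN : (c x < N)%N by rewrite c'x -[ltnLHS]addn0 ltn_add2l.
  have : B \subset [set~ Ordinal cN]%SET.
    apply/fintype.subsetP => i; rewrite !inE; apply: contraNneq => -> /=.
    rewrite /fresh other wf// eqxx/=; apply/negP => /(intree_prefix vT).
    by rewrite ltnn.
  move/subset_leq_card; rewrite cardsC1 card_ord => h.
  by apply: leq_ltn_trans h _; rewrite ltn_predL (leq_trans _ cN).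
apply: (@le_trans _ _ ((N%:R + rho)^-1 * (rho + #|B|%:R) +
    (0 < m)%N%:R / ((size D)%:R + 1 + rho))%:E); last by rewrite lee_fin step_le.
rewrite EFinD; apply: leeD; last by rewrite -EFinM mulrC.
rewrite EFinM; apply: lee_wpmul2l; first exact: Kinv_ge0.
rewrite EFinD; apply: leeD2r; rewrite -EFinM lee_fin -[leRHS]mulr1.
by apply: ler_wpM2l; [exact: ltW|case: (fresh _ _)].
Qed.

(** The prefixes of [v] and of the vertices visited up to time [n]. The bound on
    the length of the prefixes makes the size of the list deterministic. *)
Let known n w : seq vertex :=
  [seq take k y | y <- v :: [seq S i w | i <- iota 0 n.+1], k <- iota 0 (n + size v).+1].

Let known_prefix n w y u : proper w ->
  y \in v :: [seq S i w | i <- iota 0 n.+1] -> prefix u y -> u \in known n w.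
Proof.
move=> pw yl /prefixP[z yE]; apply/allpairsP; exists (y, size u).
split => //; last by rewrite yE /= take_size_cat.
  rewrite mem_iota add0n ltnS; have : (size u <= size y)%N by rewrite yE size_cat leq_addr.
  move=> /leq_trans; apply; move: yl; rewrite in_cons => /predU1P[->|/mapP[i]].
    exact: leq_addl.
  rewrite mem_iota ltnS => /= ni ->; apply: leq_trans (proper_size hTBRW i pw) _.
  exact: leq_trans ni (leq_addr _ _).
Qed.

Let known_visited n i w : proper w -> (i <= n)%N -> S i w \in known n w.
Proof.
move=> pw ni; apply: (known_prefix (y := S i w)) => //; last exact: prefix_refl.
by rewrite in_cons map_f ?orbT// mem_iota ltnS.
Qed.

Let cnt_visited n w u : (0 < cnt n w u)%N -> exists2 i, (i < n)%N & S i w = u.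
Proof.
elim: n => [|n IH]; first by rewrite (cnt_init hTBRW).
have [<- _|Su] := eqVneq (S n w) u; first by exists n.
rewrite (cnt_next hTBRW) grow_other 1?eq_sym// => /IH[i ni Si].
by exists i => //; exact: ltnW.
Qed.

Let explored_known n w : proper w -> explored (known n w) (cnt n w) (S n w).
Proof.
move=> pw; split; first exact: known_visited.
- by move=> u /cnt_visited[i ni <-]; apply: known_visited => //; exact: ltnW.
- by move=> u; apply: known_prefix => //; exact: mem_head.
- move=> u /allpairsP[[y k] [/= yl kl ->]]; apply: (known_prefix (y := y)) => //.
  have pt m (z : vertex) : prefix (take m z) z.
    by apply/prefixP; exists (drop m z); rewrite cat_take_drop.
  exact: prefix_trans (pt _ _) (pt _ _).
Qed.

(** Without fresh arrival the walk stays among finitely many vertices, and from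
    these the probability of a fresh arrival at the next step is bounded below. *)
Lemma fresh_arrival n :
  P [set w | intree (cnt n w) v /\ forall j, ~~ fresh (cnt (n + j) w) (S (n + j) w)] = 0%E.
Proof.
pose G j := [set w | intree (cnt n w) v /\
  forall i, (i <= j)%N -> ~~ fresh (cnt (n + i) w) (S (n + i) w)].
have hG j : adapted (n + j) (G j).
  apply: adapted_set => w w' ww' [iw fw]; split => [|i ij].
    by rewrite -(adapted_cnt (same_past_le (leq_addr _ _) ww')).
  have ni : (n + i <= n + j)%N by rewrite leq_add2l.
  by have [<- <-] := same_past_state (same_past_le ni ww'); exact: fw.
have mG j : measurable (G j) by exact: (adapted_measurable hTBRW (hG j)).
pose sz := (n.+2 * (n + size v).+1)%N.
have sI w : size (known n w) = sz by rewrite size_allpairs /= size_map !size_iota.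
pose e : R := birth_prob nu / (sz%:R + 1 + rho).
have I1 : 1 < sz%:R + 1 + rho by rewrite -addrA addrCA ltrDl ltr_wpDl.
have birth1 : birth_prob nu <= 1.
  rewrite -lee_fin -birth_probE; apply: Ex_le1 => m; rewrite lee_fin//.
  by case: (0 < m)%N.
have b0 := birth_prob_gt0 hnu.
have e0 : 0 < e by rewrite divr_gt0// (lt_trans _ I1).
have e1 : e < 1.
  by rewrite ltr_pdivrMr ?(lt_trans _ I1)// mul1r (le_lt_trans birth1).
have known_later j w : proper w -> G j w -> explored (known n w) (cnt (n + j) w) (S (n + j) w).
  move=> pw; elim: j => [|j IH] [iw fw]; first by rewrite addn0; exact: explored_known.
  have Gj : G j w by split => // i ij; apply: fw; exact: leqW.
  have := fw j.+1 (leqnn _); have := pw (n + j)%N.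
  by rewrite addnS (cnt_next hTBRW) => yN nf; exact: explored_step (IH Gj) nf yN.
pose nf (_ : Omega) c x : \bar R := (~~ fresh c x)%:R%:E.
have nf0 w c x : (0 <= nf w c x)%E by rewrite lee_fin.
have hnf m : adapted m nf by [].
have PS j : (P (G j.+1) <= (1 - e)%:E * P (G j))%E.
  apply: (@le_trans _ _ (\int[P]_(w in G j) nf w (cnt (n + j).+1 w) (S (n + j).+1 w))%E).
    apply: (@le_trans _ _ (\int[P]_(w in G j.+1) nf w (cnt (n + j).+1 w) (S (n + j).+1 w))%E).
      rewrite -[leLHS]mul1e -integral_cst//.
      rewrite (eq_integral (fun w => nf w (cnt (n + j).+1 w) (S (n + j).+1 w)))//.
      move=> w; rewrite inE => -[_ /(_ j.+1 (leqnn _))].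
      by rewrite /nf addnS => ->.
    apply: ge0_subset_integral => //.
      apply: (adapted_measurable_fun hTBRW _ (n := (n + j).+1)) => //.
      exact: (adapted_state (phi := nf)).
    by move=> w [iw fw]; split => // i ij; apply: fw; exact: leqW.
  rewrite (markov_on rho0 hTBRW (hG j) (hnf _) nf0) -integral_cst//.
  apply: (le_integral_proper rho0 hTBRW (n := (n + j)%N)).
  - exact: mG.
  - exact: (adapted_step _ _ (hnf _)).
  - by [].
  - by move=> w; exact: walk_step_ge0.
  - by move=> w; rewrite lee_fin subr_ge0 ltW.
  move=> w pw Gw; have := fresh_step (proper_good hTBRW (n + j) pw) _ (known_later j w pw Gw).
  rewrite sI -/e EFinB leeBrDr//; apply.
  by apply: intree_later; have [] := Gw.
have Pj j : (P (G j) <= ((1 - e) ^+ j)%:E)%E.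
  elim: j => [|j IH]; first by rewrite expr0; exact: probability_le1.
  apply: le_trans (PS j) _; rewrite exprS EFinM lee_wpmul2l// lee_fin subr_ge0 ltW//.
set N := [set w | _].
have NG j : N `<=` G j by move=> w [iw fw]; split.
have mN : measurable N.
  rewrite (_ : N = \bigcap_j G j); first exact: bigcapT_measurable.
  apply/seteqP; split => [w Nw j _|w Gw]; first exact: NG.
  by split => [|j]; [have [] := Gw 0%N I|have [_ ->] := Gw j I].
apply/eqP; rewrite eq_le measure_ge0 andbT; apply/lee_addgt0Pr => x x0; rewrite add0e.
have q01 : 0 < 1 - e < 1 by rewrite subr_gt0 e1/= gtrDl oppr_lt0.
have [J hJ] := expr_small q01 x0.
apply: (@le_trans _ _ (P (G J))); first by apply: le_measure; rewrite ?inE.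
by apply: le_trans (Pj J) _; rewrite lee_fin hJ.
Qed.

(** A fresh arrival is certain, and costs the factor [s]. *)
Lemma return_bound_contract (lam s : R) : 0 <= lam ->
  (forall k, exit_prob nu rho k no_counts [::] <= s%:E)%E ->
  return_bound lam -> return_bound (lam * s).
Proof.
move=> lam0 exits bound n H hH Hv.
have s0 : 0 <= s by rewrite -lee_fin; exact: exits 0%N.
have mH : measurable H by exact: (adapted_measurable hTBRW hH).
pose A m := H `&` [set w | fresh (cnt (n + m) w) (S (n + m) w)].
have hA m : adapted (n + m) (A m).
  move=> w w' ww'; rewrite /A /setI /= (adapted_le (leq_addr _ _) hH ww').
  by rewrite (adapted_S ww') (adapted_cnt ww').
have mA m : measurable (A m) by exact: (adapted_measurable hTBRW (hA m)).
have mU : measurable (\bigcup_m A m) by exact: bigcupT_measurable.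
set N := [set w | intree (cnt n w) v /\ forall j, ~~ fresh (cnt (n + j) w) (S (n + j) w)].
have mN : measurable N.
  rewrite (_ : N = [set w | intree (cnt n w) v] `&`
    \bigcap_j [set w | ~~ fresh (cnt (n + j) w) (S (n + j) w)]).
    apply: measurableI.
      by apply: (adapted_measurable hTBRW (n := n)) => w w' ww'; rewrite /= (adapted_cnt ww').
    apply: bigcapT_measurable => j; apply: (adapted_measurable hTBRW (n := (n + j)%N)).
    by move=> w w' ww'; rewrite /= (adapted_cnt ww') (adapted_S ww').
  apply/seteqP; split => w [iw fw]; split => // j; [by move=> _; exact: fw|exact: fw].
apply: (@le_trans _ _ (P (E `&` \bigcup_m A m) + P N)%E).
  apply: le_trans (measureU2 _ _ _) => //; last exact: measurableI.
  apply: le_measure; rewrite ?inE.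
  - exact: measurableI.
  - by apply: measurableU => //; exact: measurableI.
  move=> w [Ew Hw]; have [[m fm]|nf] := pselect (exists m, fresh (cnt (n + m) w) (S (n + m) w)).
    by left; split => //; exists m.
  right; split => [|j]; first exact: Hv.
  by apply/negP => fj; apply: nf; exists j.
rewrite [X in (_ + X)%E](fresh_arrival n) adde0.
apply: (@le_trans _ _ ((lam * s)%:E * P (\bigcup_m A m))%E).
  apply: (first_time hA) => m G hG GA.
  apply: (return_bound_fresh lam0 exits bound hG) => w /GA[Hw fw] //.
  by apply: intree_later; exact: Hv.
rewrite lee_wpmul2l ?lee_fin ?mulr_ge0//; apply: le_measure; rewrite ?inE//.
by move=> w [m _ []].
Qed.

Lemma finitely_many_visits : (rho%:E < 1 + 2%:E * mean nu)%E -> P E = 0%E.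
Proof.
move=> sup; have [s0 /andP[s00 s01] exits0] := transient_escape rho0 hnu sup.
pose s := Num.max s0 2^-1.
have s01' : 0 < s < 1.
  rewrite lt_max gt_max s01 invr_gt0 ltr0n orbT/= invf_lt1 ?ltr1n//.
have exits k : (exit_prob nu rho k no_counts [::] <= s%:E)%E.
  by apply: le_trans (exits0 k) _; rewrite lee_fin le_max lexx.
have s_ge0 : 0 <= s by have /andP[/ltW] := s01'.
have bound k : return_bound (s ^+ k).
  elim: k => [|k IH]; last by rewrite exprSr; apply: return_bound_contract => //; exact: exprn_ge0.
  move=> n H hH Hv; rewrite expr0 mul1e; have mH := adapted_measurable hTBRW hH.
  by apply: le_measure; rewrite ?inE//; exact: measurableI.
pose V n := [set w | intree (cnt n w) v].
have hV n : adapted n (V n) by move=> w w' ww'; rewrite /V /= (adapted_cnt ww').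
have mV n : measurable (V n) by exact: (adapted_measurable hTBRW (hV n)).
have EV n : P (E `&` V n) = 0%E.
  apply/eqP; rewrite eq_le measure_ge0 andbT; apply/lee_addgt0Pr => x x0; rewrite add0e.
  have [J hJ] := expr_small s01' x0.
  apply: le_trans (bound J n (V n) (hV n) _) _ => //.
  apply: (@le_trans _ _ ((s ^+ J)%:E * 1)%E); last by rewrite mule1 lee_fin hJ.
  by rewrite lee_wpmul2l ?lee_fin ?exprn_ge0//; exact: probability_le1.
apply: measure_negligible => //.
have nP : P.-negligible (~` proper).
  apply/negligibleP; last exact: (proper_ae rho0 hTBRW).
  by apply: measurableC; exact: (measurable_proper hTBRW).
have nV : P.-negligible (\bigcup_n (E `&` V n)).
  apply: negligible_bigcup => n.
  by apply/negligibleP; [exact: measurableI|exact: EV].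
apply: negligibleS (negligibleU nP nV) => w Ew.
have [pw|] := pselect (proper w); [right|by left].
have [n _ Sn] := Ew 0%N I; exists n => //; split => //.
by rewrite /V /= -Sn; have [] := proper_good hTBRW n pw.
Qed.

End Target.

Lemma finite_visits v w : ~ lim_sup_set (fun n => S n @^-1` [set v]) w ->
  finite_set (visits S v w).
Proof.
move=> /existsNP[n /not_implyP[_ nE]]; apply: (sub_finite_set _ (finite_II n)).
move=> j Sj /=; rewrite ltnNge; apply/negP => nj; apply: nE; by exists j.
Qed.

Lemma transient_walk : (rho%:E < 1 + 2%:E * mean nu)%E ->
  {ae P, forall w, forall v, finite_set (visits S v w)}.
Proof.
move=> sup; pose Io k : set Omega :=
  if choice.unpickle k is Some v then lim_sup_set (fun n => S n @^-1` [set v]) else set0.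
have nI : P.-negligible (\bigcup_k Io k).
  apply: negligible_bigcup => k; rewrite /Io; case: choice.unpickle => [v|]; last first.
    exact: negligible_set0.
  apply/negligibleP; last exact: finitely_many_visits.
  apply: bigcapT_measurable => j; apply: bigcup_measurable => i _.
  exact: measurable_S hTBRW _ _.
apply: negligibleS nI => w /= /existsNP[v nv]; exists (choice.pickle (v : vertex)) => //.
by rewrite /Io choice.pickleK; apply: contrapT => /finite_visits.
Qed.

End Transience.

(** * Phase transition *)

Theorem theorem1p1 (R : realType) (d : measure_display)
    (Omega : measurableType d) (P : probability Omega R)
    (nu : probability nat R) (hnu : (nu [set 0%N] < 1)%E)
    (rho : R) (hrho : 0 < rho)
    (xi : nat -> Omega -> nat) (T : nat -> Omega -> tree)
    (S : nat -> Omega -> vertex) (hTBRW : is_TBRW P rho nu xi T S) :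
  ((rho%:E < 1 + 2%:E * mean nu)%E ->
     transient P T S /\ {ae P, forall w, finite_set (visits S tree_root w)}) /\
  ((1 + 2%:E * mean nu <= rho%:E)%E ->
     recurrent P T S /\
     (rho%:E = (1 + 2%:E * mean nu)%E ->
        forall k : nat, (1 <= k)%N ->
          (\int[P]_w (return_time R S k w))%E = +oo%E) /\
     ((1 + 2%:E * mean nu < rho%:E)%E ->
        forall k : nat, (1 <= k)%N ->
          (\int[P]_w (return_time R S k w) < +oo)%E)).
Proof.
split => [sup|rec].
  have fin := transient_walk hrho hnu hTBRW sup.
  split; first by apply: filterS fin => w fin_w v _; exact: fin_w.
  by apply: filterS fin => w; exact.
have m0 := mean_gt0 hnu.
have [M meanM] : exists M, mean nu = M%:E.
  case: (mean nu) m0 rec => [M| |] // _; first by exists M.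
  by rewrite mulry gtr0_sg// mul1e addey// leye_eq.
have rec' : 1 + 2 * M <= rho by move: rec; rewrite meanM -EFinM -EFinD lee_fin.
rewrite meanM -EFinM -EFinD lte_fin; split; first exact: (recurrent_walk hrho hnu hTBRW meanM).
split => [[rhoE] k k1|pos k k1].
  exact: (null_recurrence hrho hnu hTBRW meanM).
exact: (positive_recurrence hrho hnu hTBRW meanM).
Qed.
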